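(* Let \[ g(t)=\frac{1}{\pi}\left(\sqrt{1-t^2}-t\arccos t\right),\quad t\in[-1,1], \] and let \[ \Omega=\{(t,s)\in\mathbb{R}^2 : -1\le t\le 1,\ \max(0,-t)\le s\le g(t)\}. \] Let $N_\Omega(\mu)=\#\left(\mu\Omega\cap(\mathbb{Z}^2+(0,-1/4))\right)$ and $P_\Omega(\mu)=N_\Omega(\mu)-\mathrm{Area}(\Omega)\mu^2$. Then \[ P_\Omega(\mu)=-\frac{\mu}{2}+O\left(\mu^{2/3-1/495}\right)\qquad\text{as }\mu\to\infty . \]
   Context: Here $\mu\Omega=\{\mu x : x\in\Omega\}$ is the dilation of $\Omega$ by $\mu>0$, and $\mathbb{Z}^2+(0,-1/4)$ is the integer lattice translated by the vector $(0,-1/4)$. *)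

(* Defs.v *)
From HB Require Import structures.
From mathcomp Require Import all_boot all_order all_algebra.
From mathcomp Require Import finmap.
From mathcomp Require Import all_classical all_reals all_analysis.

Set Implicit Arguments.
Unset Strict Implicit.
Unset Printing Implicit Defensive.

Import Order.TTheory GRing.Theory Num.Theory.
Import numFieldNormedType.Exports.

Local Open Scope classical_set_scope.
Local Open Scope ring_scope.

Definition g {R : realType} (t : R) : R :=
  pi^-1 * (Num.sqrt (1 - t ^+ 2) - t * acos t).

Definition Omega (R : realType) : set (R * R) :=
  [set p | -1 <= p.1 <= 1 /\ Num.max 0 (- p.1) <= p.2 <= g p.1].
Arguments Omega : clear implicits.

Definition dilation {R : realType} (mu : R) (A : set (R * R)) : set (R * R) :=
  [set (mu * p.1, mu * p.2) | p in A].

Definition translate {R : realType} (A : set (R * R)) (v : R * R) :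
    set (R * R) :=
  [set (p.1 + v.1, p.2 + v.2) | p in A].

Definition Z2 (R : realType) : set (R * R) :=
  [set (k.1%:~R, k.2%:~R) | k in [set: int * int]].
Arguments Z2 : clear implicits.

(* [fine] and [fset_set] return 0 and the empty set on infinite arguments;
   [Omega R] is bounded, so neither default is reached below. *)
Definition area {R : realType} (A : set (R * R)) : R :=
  fine ((lebesgue_measure \x lebesgue_measure)%E A).

Definition N_Omega {R : realType} (mu : R) : nat :=
  #|` fset_set (dilation mu (Omega R) `&` translate (Z2 R) (0, - (1 / 4)))|%fset.

Definition P_Omega {R : realType} (mu : R) : R :=
  (N_Omega mu)%:R - area (Omega R) * mu ^+ 2.

(* Lets the Landau notations find the filter [+oo], as they find [\oo]. *)
Canonical pinfty_nbhs_filter_on (R : numFieldType) :=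
  FilterType (pinfty_nbhs R) _.

(* Main.v *)
(** Write [mu g(m/mu) = (mu/pi) (sin t - t cos t)] with [cos t = m/mu]. Since
    [g (-t) = g t + t], the columns over [m] and [-m] hold the same number of
    points, [floor (mu g(m/mu) + 1/4)], and a trapezoid estimate in the variable
    [t] leaves, up to [O(1)], twice the sum over [0 <= m <= mu] of the sawtooth
    function at [mu g(m/mu) + 1/4].  Averaging the sawtooth at scale [d] reduces
    that sum to the exponential sums with frequencies [h] and weights
    [min(1/h, 1/(d h^2))].

    Poisson summation is replaced by an elementary stationary phase argument:
    the sum over [m] is cut where [h t/pi] crosses half-integers, each block is
    a Fresnel integral up to a Kusmin-Landau remainder, and the result is a dual
    sum of length [h/2] with phase [2 h mu sin (pi l/h)].  The trivial bound for
    the dual sum gives [sqrt (mu h)] and the classical exponent 2/3.  The family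
    [A sin (pi l/h + c)] is closed under differencing, so four van der Corput
    steps followed by the Kusmin-Landau inequality save a factor [y^3] when
    [mu = y^990] and [y^326 <= h <= y^338]; with [d = y^-332] everything is
    [O(y^658)], and 658/990 = 2/3 - 1/495. *)

(* The exponents solve one balance. With [d = y^-D] and a saving [y^s] over [sqrt (mu h)], smoothing
   costs [y^(990 - D)] and the frequencies near [1/d] cost [y^(495 - s + D/2)]. For [s = 0] this
   gives [D = 330] and the exponent 660; for [s = 3] it gives [D = 332] and 658. The saving is
   needed only within a factor [y^6] of [1/d]: beyond it the weights themselves gain [y^3], whence
   the range from 326 to 338.

   The dual phase has amplitude about [h mu], and a differencing step multiplies it by a factor
   between [q/h] and [Q q/h], up to constants. After three steps its increments are still far above
   1, after four they are below 1. The opposite danger is an amplitude so small that the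
   Kusmin-Landau bound is useless; shifting only by multiples of a large [q] keeps it from below.
   The increments also degenerate at [l = h/2], where the cosine vanishes, so a proportion [y^-6] of
   the dual range is cut off and counted trivially.

   Integrals are handled through primitives: an integration by parts becomes the monotonicity of an
   auxiliary function with a sign parameter. *)
Require Import Defs.
From mathcomp Require Import all_boot all_order all_algebra.
From mathcomp Require Import finmap.
From mathcomp Require Import all_classical all_reals all_analysis.
From mathcomp Require Import measurable_realfun.
From mathcomp Require Import ring lra zify.
Import Order.TTheory GRing.Theory Num.Theory.
Import numFieldNormedType.Exports.
Set Implicit Arguments.
Unset Strict Implicit.
Unset Printing Implicit Defensive.
Local Open Scope ring_scope.

(** * Calculus and trigonometric inequalities *)

Section isd.
Context {R : realType}.

(* A definition rather than a notation, so that derivative side conditions are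
   not discharged by the instance resolution attached to [is_derive]. *)
Definition has_deriv (f : R -> R) (x df : R) : Prop := is_derive x 1 f df.

Implicit Types (f g : R -> R) (x df dg : R).

Lemma isd_eq f x df dg : has_deriv f x df -> df = dg -> has_deriv f x dg.
Proof. by move=> H <-. Qed.

Lemma isd_cst x (c : R) : has_deriv (fun=> c) x 0.
Proof. exact: is_derive_cst. Qed.

Lemma isd_sin0 x : has_deriv sin x (cos x).
Proof. exact: is_derive_sin. Qed.

Lemma isd_cos0 x : has_deriv cos x (- sin x).
Proof. exact: is_derive_cos. Qed.

Lemma isd_id x : has_deriv (fun y : R => y) x 1.
Proof. exact: is_derive_id. Qed.

Lemma isd_add f g x df dg : has_deriv f x df -> has_deriv g x dg ->
  has_deriv (fun y => f y + g y) x (df + dg).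
Proof. by move=> hf hg; apply: is_deriveD. Qed.

Lemma isd_opp f x df : has_deriv f x df -> has_deriv (fun y => - f y) x (- df).
Proof. by move=> hf; apply: is_deriveN. Qed.

Lemma isd_mul f g x df dg : has_deriv f x df -> has_deriv g x dg ->
  has_deriv (fun y => f y * g y) x (df * g x + f x * dg).
Proof.
move=> hf hg; apply: (isd_eq (is_deriveM hf hg)).
by rewrite /GRing.scale/= addrC [g x * _]mulrC.
Qed.

Lemma isd_comp f g x df dg : has_deriv f (g x) df -> has_deriv g x dg ->
  has_deriv (fun y => f (g y)) x (df * dg).
Proof.
by move=> hf hg; exact: (isd_eq (is_derive1_comp hf hg)).
Qed.

Lemma isd_sin g x dg : has_deriv g x dg ->
  has_deriv (fun y => sin (g y)) x (cos (g x) * dg).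
Proof. by move=> hg; apply: isd_comp hg; exact: isd_sin0. Qed.

Lemma isd_cos g x dg : has_deriv g x dg ->
  has_deriv (fun y => cos (g y)) x (- sin (g x) * dg).
Proof. by move=> hg; apply: isd_comp hg; exact: isd_cos0. Qed.

Lemma isd_exp g x dg n : has_deriv g x dg ->
  has_deriv (fun y => g y ^+ n) x (n%:R * g x ^+ n.-1 * dg).
Proof.
case: n => [_|n hg].
  by rewrite !mul0r (_ : (fun y => _) = fun=> 1)//; exact: isd_cst.
rewrite (_ : (fun y => _) = g ^+ n.+1); last by apply/funext => y; rewrite exprfctE.
apply: (isd_eq (is_deriveX n.+1 hg)).
by rewrite /GRing.scale.
Qed.

Lemma isd_inv g x dg : g x != 0 -> has_deriv g x dg ->
  has_deriv (fun y => (g y)^-1) x (- (g x) ^- 2 * dg).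
Proof.
move=> g0 hg; apply: (isd_eq (is_deriveV g0 hg)).
by rewrite /GRing.scale.
Qed.

End isd.

(** The rule for inverses is left out because of its nonvanishing side condition; it is applied by
    hand. *)
Ltac isd := repeat first
  [ apply: isd_cst | apply: isd_id | apply: isd_sin0 | apply: isd_cos0 | apply: isd_add | apply: isd_opp
  | apply: isd_sin | apply: isd_cos | apply: isd_exp | apply: isd_mul ].

Ltac isdr := apply: isd_eq; [isd|rewrite /=; ring].

Section calc.
Context {R : realType}.
Implicit Types (f df : R -> R) (a b c x y : R).

Lemma mvt_within f df a b : a <= b ->
  (forall x, a <= x <= b -> has_deriv f x (df x)) ->
  exists2 c, (a <= c <= b) & f b - f a = df c * (b - a).
Proof.
move=> ab fdf.
have [||c cab ->] := @MVT_segment R f df a b ab.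
- by move=> x; rewrite in_itv/= => /andP[ax xb]; apply: fdf; rewrite !ltW.
- apply: derivable_within_continuous => x; rewrite in_itv/= => xab.
  by have H : is_derive x 1 f (df x) := fdf x xab; exact: ex_derive.
by exists c => //; rewrite in_itv in cab.
Qed.

Lemma mvt_norm_le f df a b c :
  (forall x, (a <= x <= b) || (b <= x <= a) -> has_deriv f x (df x)) ->
  (forall x, (a <= x <= b) || (b <= x <= a) -> `|df x| <= c) ->
  `|f b - f a| <= c * `|b - a|.
Proof.
move=> fdf dfc; have [ab|/ltW ba] := leP a b.
  have [x xab|x xab ->] := @mvt_within f df a b ab; first by apply: fdf; rewrite xab.
  by rewrite normrM ler_wpM2r// dfc// xab.
have [x xab|x xab e] := @mvt_within f df b a ba; first by apply: fdf; rewrite xab orbT.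
by rewrite distrC e normrM (distrC b) ler_wpM2r// dfc// xab orbT.
Qed.

Lemma ger0_derive_le f df a b : a <= b ->
  (forall x, a <= x <= b -> has_deriv f x (df x)) ->
  (forall x, a <= x <= b -> 0 <= df x) -> f a <= f b.
Proof.
move=> ab fdf df0; rewrite -subr_ge0.
by have [x xab ->] := mvt_within ab fdf; rewrite mulr_ge0 ?df0 ?subr_ge0.
Qed.

Lemma sin_le x : 0 <= x -> sin x <= x.
Proof.
move=> x0; rewrite -subr_ge0.
have := @ger0_derive_le (fun x => x - sin x) (fun x => 1 - cos x) 0 x x0.
rewrite /= sin0 subr0; apply.
  by move=> y _; apply: isd_eq; [isd|ring].
by move=> y _; rewrite subr_ge0 cos_le1.
Qed.

Lemma norm_sinB_le x y : `|sin y - sin x| <= `|y - x|.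
Proof.
have := @mvt_norm_le sin cos x y 1; rewrite mul1r; apply => z _.
  exact: isd_sin0.
exact: cos_max.
Qed.

Lemma norm_cosB_le x y : `|cos y - cos x| <= `|y - x|.
Proof.
have := @mvt_norm_le cos (fun x => - sin x) x y 1; rewrite mul1r; apply => z _.
  exact: isd_cos0.
by rewrite normrN sin_max.
Qed.

(** Comparing [cos z + z * sin x] at [x] and [y] needs only that [sin] is 1-Lipschitz, at the price
    of the constant 1 instead of 1/2. *)
Lemma norm_cosB_taylor x y : `|cos y - cos x + (y - x) * sin x| <= (y - x) ^+ 2.
Proof.
have H := @mvt_norm_le (fun z => cos z + z * sin x) (fun z => - sin z + sin x) x y `|y - x|.
rewrite -real_normK ?num_real// expr2.
rewrite (_ : _ + _ * sin x = cos y + y * sin x - (cos x + x * sin x)); last by ring.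
apply: H => z zxy.
  by isdr.
rewrite addrC (le_trans (norm_sinB_le _ _))// distrC.
by move: zxy => /orP[]/andP[h1 h2]; [rewrite !ger0_norm|rewrite !ler0_norm]; lra.
Qed.

Lemma cos_le x y : 0 <= x -> x <= y -> y <= pi -> cos y <= cos x.
Proof.
move=> x0 xy ypi; rewrite leNgt ltr_cos ?in_itv/= -?leNgt//; apply/andP; split; lra.
Qed.

(** The derivative of [sin z - z * cos y] is [cos z - cos y], whose sign on each side of [y] is
    known since [cos] decreases. This tangent form of concavity later yields the phase increments
    and the trapezoid error. *)
Lemma sin_tangent_le x y : 0 <= x <= pi -> 0 <= y <= pi ->
  sin x <= sin y + (x - y) * cos y.
Proof.
move=> /andP[x0 xpi] /andP[y0 ypi].
have [xy|/ltW yx] := leP x y.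
- have := @ger0_derive_le (fun z => sin z - z * cos y) (fun z => cos z - cos y) x y xy.
  suff: sin x - x * cos y <= sin y - y * cos y -> sin x <= sin y + (x - y) * cos y.
    move=> + H; apply; apply: H => z /andP[xz zy].
      by isdr.
    by rewrite subr_ge0 cos_le//; lra.
  lra.
- have := @ger0_derive_le (fun z => z * cos y - sin z) (fun z => cos y - cos z) y x yx.
  suff: y * cos y - sin y <= x * cos y - sin x -> sin x <= sin y + (x - y) * cos y.
    move=> + H; apply; apply: H => z /andP[xz zy].
      by isdr.
    by rewrite subr_ge0 cos_le//; lra.
  lra.
Qed.

Lemma mulr_cos_le_sin x : 0 <= x <= pi -> x * cos x <= sin x.
Proof.
move=> hx; have := @sin_tangent_le 0 x; rewrite sin0 lexx pi_ge0 hx => /(_ isT isT).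
lra.
Qed.

Lemma sin_double x : sin x = 2 * sin (x / 2) * cos (x / 2).
Proof. by rewrite {1}(_ : x = x / 2 *+ 2) ?sin_mulr2n; [ring|field]. Qed.

Lemma cosB_prod x y : cos x - cos y = 2 * sin ((x + y) / 2) * sin ((y - x) / 2).
Proof.
have -> : cos x = cos ((x + y) / 2 - (y - x) / 2) by congr cos; field.
have -> : cos y = cos ((x + y) / 2 + (y - x) / 2) by congr cos; field.
by rewrite cosB cosD; ring.
Qed.

Lemma sinB_prod x y : sin x - sin y = 2 * sin ((x - y) / 2) * cos ((x + y) / 2).
Proof.
have -> : sin x = sin ((x + y) / 2 + (x - y) / 2) by congr sin; field.
have -> : sin y = sin ((x + y) / 2 - (x - y) / 2) by congr sin; field.
by rewrite sinD sinB; ring.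
Qed.

(** A weak Jordan inequality: [2 sin (x/2) cos (x/2) >= x cos^2 (x/2)], and
    [2 cos^2 (x/2) = 1 + cos x >= 1]. *)
Lemma sin_ge_half x : 0 <= x <= pi / 2 -> x / 2 <= sin x.
Proof.
move=> /andP[x0 xpi].
have xpi' : 0 <= x / 2 <= pi by apply/andP; split; lra.
have c0 : 0 <= cos x by apply: cos_ge0_pihalf; apply/andP; split; lra.
have c20 : 0 <= cos (x / 2) by apply: cos_ge0_pihalf; apply/andP; split; lra.
have c2 : cos x = 2 * cos (x / 2) ^+ 2 - 1.
  by rewrite {1}(_ : x = x / 2 *+ 2) ?cos_mulr2n; [ring|field].
have h := mulr_cos_le_sin xpi'; rewrite (sin_double x).
apply: (@le_trans _ _ (2 * (x / 2 * cos (x / 2)) * cos (x / 2))).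
  by rewrite [leRHS](_ : _ = x / 2 * (2 * cos (x / 2) ^+ 2)); [rewrite ler_peMr; lra|field].
by rewrite ler_wpM2r// ler_pM2l.
Qed.

(** Take [t] times the tangent inequality at [t * x], then replace [t * x * cos (t * x)] by the
    larger [sin (t * x)]. *)
Lemma sin_concave t x : 0 <= t <= 1 -> 0 <= x <= pi -> t * sin x <= sin (t * x).
Proof.
move=> /andP[t0 t1] /andP[x0 xpi].
have tx : 0 <= t * x <= pi by apply/andP; split; [exact: mulr_ge0|nra].
have := @sin_tangent_le x (t * x); rewrite x0 xpi => /(_ isT tx) h1.
have := mulr_cos_le_sin tx => h2.
nra.
Qed.

Lemma sin_ge0_pihalf x : 0 <= x <= pi / 2 -> 0 <= sin x.
Proof. by move=> /andP[? ?]; apply: sin_ge0_pi; apply/andP; split; lra. Qed.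

End calc.

(** * The Kusmin-Landau inequality *)

Section exponential_sums.
Context {R : realType}.

Definition monotone_below (M : nat) (c : nat -> R) : Prop :=
  (forall n, (n.+1 < M)%N -> c n <= c n.+1) \/
  (forall n, (n.+1 < M)%N -> c n.+1 <= c n).

(** Partial summation: a monotone sequence in [[0, K]] has total variation at most [K]. The
    auxiliary [T] adds the boundary term to the partial sum, so that one step only adds
    [(c m.+1 - c m) * s m.+1]. *)
Lemma abel_sum_le (c s : nat -> R) (K B : R) (M : nat) : 0 <= K ->
  (forall n, (n < M)%N -> 0 <= c n <= K) -> monotone_below M c ->
  (forall n, (n <= M)%N -> `|s n| <= B) ->
  `|\sum_(0 <= n < M) c n * (s n - s n.+1)| <= 2 * K * B.
Proof.
move=> K0 c0K cmono sB.
have B0 : 0 <= B by apply: le_trans (sB 0%N isT).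
case: M c0K cmono sB => [|M] c0K cmono sB; first by rewrite big_nil normr0 !mulr_ge0.
pose T m := \sum_(0 <= n < m) c n * (s n - s n.+1) + c m * s m.
have TS m : T m.+1 = T m + (c m.+1 - c m) * s m.+1.
  by rewrite /T big_nat_recr//=; ring.
have T0 : T 0%N = c 0%N * s 0%N by rewrite /T big_nil add0r.
have -> : \sum_(0 <= n < M.+1) c n * (s n - s n.+1) = T M - c M * s M.+1.
  by rewrite /T big_nat_recr//=; ring.
have step m : (m < M)%N -> `|T m.+1| <= `|T m| + `|c m.+1 - c m| * B.
  move=> mM; rewrite TS (le_trans (ler_normD _ _))// lerD2l normrM.
  by rewrite ler_wpM2l// sB// ltnS ltnW.
have cs0 : `|T 0%N| <= c 0%N * B.
  have /andP[? ?] := c0K 0%N isT.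
  by rewrite T0 normrM ger0_norm// ler_wpM2l// sB.
have /andP[cM0 cMK] := c0K M (ltnSn M).
have /andP[c00 c0K'] := c0K 0%N isT.
have cMs : `|c M * s M.+1| <= c M * B.
  by rewrite normrM ger0_norm// ler_wpM2l// sB.
rewrite (le_trans (ler_normB _ _))//.
case: cmono => cm.
- have TM m : (m <= M)%N -> `|T m| <= c m * B.
    elim: m => [//|m IH] mM; rewrite (le_trans (step _ mM))//.
    have := IH (ltnW mM); have := cm m mM => h.
    rewrite (ger0_norm (_ : 0 <= c m.+1 - c m)) ?subr_ge0//; nra.
  by have := TM M (leqnn M); nra.
(* In the decreasing case the initial value [c 0] and the variation [c 0 - c m] accumulate. *)
- have TM m : (m <= M)%N -> `|T m| <= (2 * c 0%N - c m) * B.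
    elim: m => [_|m IH mM]; first by rewrite (le_trans cs0)//; nra.
    rewrite (le_trans (step _ mM))//.
    have := IH (ltnW mM); have := cm m mM => h.
    rewrite (ler0_norm (_ : c m.+1 - c m <= 0)) ?subr_le0//; nra.
  by have := TM M (leqnn M); nra.
Qed.

Lemma cot_le (x : R) : 0 < x -> x <= pi / 2 -> 0 <= cos x / sin x <= x^-1.
Proof.
move=> x0 xpi.
have sx : 0 < sin x by apply: sin_gt0_pi; apply/andP; split => //; have := pi_gt0 R; lra.
have cx : 0 <= cos x by apply: cos_ge0_pihalf; apply/andP; split; lra.
rewrite divr_ge0 ?(ltW sx)//= ler_pdivrMr// ler_pdivlMl//.
by apply: mulr_cos_le_sin; apply/andP; split; have := pi_gt0 R; lra.
Qed.

Lemma cot_anti (x y : R) : 0 < x -> x <= y -> y <= pi / 2 ->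
  cos y / sin y <= cos x / sin x.
Proof.
move=> x0 xy ypi; have pi0 := pi_gt0 R.
have sx : 0 < sin x by apply: sin_gt0_pi; apply/andP; split => //; lra.
have sy : 0 < sin y by apply: sin_gt0_pi; apply/andP; split => //; lra.
rewrite ler_pdivrMr// mulrAC ler_pdivlMr//.
have : 0 <= sin (y - x) by apply: sin_ge0_pi; apply/andP; split; lra.
by rewrite sinB; lra.
Qed.

(** With [d n] half the increment, [cos (F n)] is half a telescoping difference of cosines minus
    [cot (d n)] times half a difference of sines. Since [d n] lies in [(0, pi/2]], the cotangent is
    at most [2 / lam] and monotone in [n], so partial summation gives [2 / lam]. The telescoped part
    and the last term, which has no increment, cost 1 each. *)
Lemma kusmin_landau (F : nat -> R) (N : nat) (lam : R) : 0 < lam ->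
  (forall n, (n.+1 < N)%N -> lam <= F n.+1 - F n <= pi) ->
  monotone_below N.-1 (fun n => F n.+1 - F n) ->
  `|\sum_(0 <= n < N) cos (F n)| <= 2 + 2 / lam.
Proof.
move=> lam0; have l0 : 0 <= 2 / lam by rewrite divr_ge0// ltW.
case: N => [_ _|N dF dmono]; first by rewrite big_nil normr0; lra.
pose d n := (F n.+1 - F n) / 2.
pose c n := cos (d n) / sin (d n).
have dn n : (n < N)%N -> lam / 2 <= d n <= pi / 2.
  by move=> nN; have := dF n nN; rewrite /d => /andP[? ?]; apply/andP; split; lra.
have cosF n : (n < N)%N -> cos (F n) = (cos (F n) - cos (F n.+1)) / 2
    - c n * (sin (F n) - sin (F n.+1)) / 2.
  move=> /dn/andP[d1 d2].
  have sd : sin (d n) != 0.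
    by apply: lt0r_neq0; apply: sin_gt0_pi; have := pi_gt0 R => pi0; apply/andP; split; lra.
  rewrite cosB_prod (sinB_prod (F n)).
  have -> : (F n.+1 - F n) / 2 = d n by [].
  have -> : (F n - F n.+1) / 2 = - d n by rewrite /d; field.
  have -> : (F n + F n.+1) / 2 = F n + d n by rewrite /d; field.
  have {1}-> : F n = F n + d n - d n by ring.
  by rewrite cosB sinN /c; field.
have c_le n : (n < N)%N -> 0 <= c n <= 2 / lam.
  move=> nN; have /andP[d1 d2] := dn n nN.
  have /andP[-> h2] := @cot_le (d n) (lt_le_trans (divr_gt0 lam0 (ltr0n _ 2)) d1) d2.
  rewrite (le_trans h2)//= -(invrK (2 / lam)) lef_pV2 ?posrE ?invr_gt0 ?divr_gt0//.
    by rewrite invf_div.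
  by move: (dF n nN) => /andP[? ?]; lra.
rewrite big_nat_recr//=.
under eq_big_nat => n /andP[_ nN] do rewrite cosF//.
rewrite sumrB -mulr_suml -[X in _ - X + _]mulr_suml.
have -> : \sum_(0 <= n < N) (cos (F n) - cos (F n.+1)) = cos (F 0%N) - cos (F N).
  rewrite -[LHS]opprK -sumrN; under eq_bigr do rewrite opprB.
  by rewrite (telescope_sumr (fun n => cos (F n)))// opprB.
have /(_ (2 / lam) 1 N l0 c_le) := @abel_sum_le c (fun n => sin (F n)).
have dE n : d n = (F n.+1 - F n) / 2 by [].
have cm : monotone_below N c.
  rewrite /c; case: dmono => h; [right|left] => n nN;
    have /andP[? ?] := dn n (ltnW nN); have /andP[? ?] := dn n.+1 nN;
    apply: cot_anti; have := h n nN => /=; have := dE n; have := dE n.+1; clearbody d; lra.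
move=> /(_ cm (fun n _ => sin_max _)); rewrite mulr1.
move=> h; have := cos_max (F 0%N); have := cos_max (F N).
by move: h; rewrite !ler_norml; set S := \sum_(_ <= _ < _) _; move=> /andP[? ?] /andP[? ?] /andP[? ?]; apply/andP; split; lra.
Qed.
End exponential_sums.

(** * Van der Corput's inequality *)

Section weyl_differencing.
Context {R : realType}.

(** Nonnegativity of the variance of [f]. *)
Lemma sqr_sum_le (f : nat -> R) T :
  (\sum_(0 <= m < T) f m) ^+ 2 <= T%:R * \sum_(0 <= m < T) f m ^+ 2.
Proof.
case: T => [|T]; first by rewrite !big_nil expr0n/= mul0r.
set S := \sum_(_ <= _ < _) f _.
have T0 : (0 : R) < T.+1%:R by rewrite ltr0n.
have : 0 <= \sum_(0 <= m < T.+1) (f m - S / T.+1%:R) ^+ 2 by apply: sumr_ge0 => i _; exact: sqr_ge0.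
under eq_bigr do rewrite sqrrB.
rewrite big_split/= sumrB sumrMnl -mulr_suml -/S sumr_const_nat subn0.
set A := \sum_(_ <= _ < _) f _ ^+ 2.
rewrite (_ : _ + _ *+ T.+1 = (T.+1%:R * A - S ^+ 2) / T.+1%:R); last first.
  rewrite -[_ ^+ 2 *+ T.+1]mulr_natr; move: T0; move: (T.+1%:R : R) => t t0.
  by field; rewrite lt0r_neq0.
by rewrite pmulr_lge0 ?invr_gt0// subr_ge0.
Qed.

(** Pads a translated sum by zeros to a common range, so that different translates can be added term
    by term. *)
Lemma big_nat_shift (f : nat -> R) (k N T : nat) : (k + N <= T)%N ->
  \sum_(0 <= m < T) (if (k <= m < k + N)%N then f (m - k)%N else 0)
  = \sum_(0 <= n < N) f n.
Proof.
move=> kNT.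
rewrite (@big_cat_nat _ _ _ k)//=; last by rewrite (leq_trans (leq_addr _ _) kNT).
rewrite big_nat big1 ?add0r; last by move=> i /andP[_ ik]; rewrite leqNgt ik.
rewrite (@big_cat_nat _ _ _ (k + N)%N)//=; last exact: leq_addr.
rewrite [X in _ + X]big_nat [X in _ + X]big1 ?addr0; last first.
  by move=> i /andP[ki _]; rewrite [(i < _)%N]ltnNge ki andbF.
rewrite -{1}[k]add0n big_addn addKn; apply: eq_big_nat => i /andP[_ iN].
by rewrite addnK leq_addl addnC ltn_add2l iN.
Qed.

(* Averaging the sum over the [Q] translates by multiples of [q] and applying
   Cauchy-Schwarz. *)
Lemma van_der_corput (F : nat -> R) (N Q q : nat) (L B : R) :
  (0 < Q)%N -> N%:R <= L -> (Q * q)%:R <= L -> 0 <= B ->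
  (forall j, (0 < j < Q)%N ->
    `|\sum_(0 <= n < N - j * q) cos (F (n + j * q)%N - F n)| <= B) ->
  (\sum_(0 <= n < N) cos (F n)) ^+ 2 <= 2 * L * (L / Q%:R + B).
Proof.
move=> Q0 NL QqL B0 hB; set S := \sum_(_ <= _ < _) _.
have Q0' : (0 : R) < Q%:R by rewrite ltr0n.
have L0 : 0 <= L by rewrite (le_trans _ NL).
pose I j m := (j * q <= m < j * q + N)%N.
(* [C] and [D] are the real and imaginary parts of the translate of [exp (i F)] by [j * q], extended
   by zero. *)
pose C j m : R := if I j m then cos (F (m - j * q)%N) else 0.
pose D j m : R := if I j m then sin (F (m - j * q)%N) else 0.
pose T := (N + Q * q)%N.
have jT j : (j < Q)%N -> (j * q + N <= T)%N.
  by move=> jQ; rewrite /T addnC leq_add2l leq_mul2r ltnW// orbT.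
have QS : Q%:R * S = \sum_(0 <= m < T) \sum_(0 <= j < Q) C j m.
  rewrite exchange_big_nat/= (eq_big_nat _ _ (F2 := fun=> S)); last first.
    by move=> j /andP[_ jQ]; rewrite /C /I (big_nat_shift (fun n => cos (F n)))// jT.
  by rewrite sumr_const_nat subn0 mulr_natl.
pose E j k : R := \sum_(0 <= m < T) (C j m * C k m + D j m * D k m).
have Esym j k : E j k = E k j by rewrite /E; apply: eq_bigr => m _; ring.
have Elt j k : (j < k < Q)%N -> `|E j k| <= B.
  move=> /andP[jk kQ].
  have kjq : ((k - j) * q + j * q = k * q)%N by rewrite -mulnDl subnK// ltnW.
  have -> : E j k = \sum_(0 <= n < N - (k - j) * q) cos (F (n + (k - j) * q)%N - F n).
    rewrite -(@big_nat_shift (fun n => cos (F (n + (k - j) * q)%N - F n)) (k * q) _ T); last first.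
      by rewrite (leq_trans _ (jT _ kQ))// leq_add2l leq_subr.
    rewrite /E; apply: eq_bigr => m _; rewrite /C /D /I.
    have -> : (k * q <= m < k * q + (N - (k - j) * q) = (j * q <= m < j * q + N) && (k * q <= m < k * q + N))%N.
      by rewrite -kjq; apply/idP/idP; lia.
    case: ifPn => //= h1; last by rewrite !mul0r addr0.
    case: ifPn => //= h2; last by rewrite !mulr0 addr0.
    rewrite -cosB; congr (cos (F _ - _)); move: h1 h2; rewrite -kjq; lia.
  by apply: hB; rewrite subn_gt0 jk/= (leq_ltn_trans (leq_subr _ _)).
have Ejj j : (j < Q)%N -> E j j <= N%:R.
  move=> jQ; rewrite -[N in N%:R]subn0 -[(N - 0)%:R]/(1 *+ (N - 0)) -sumr_const_nat.
  rewrite -(@big_nat_shift (fun=> 1) (j * q) _ T) ?jT//.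
  by rewrite /E ler_sum// => m _; rewrite /C /D /I; case: ifPn => _; rewrite ?mulr0 ?addr0// -!expr2 cos2Dsin2.
have Ele j k : (j < Q)%N -> (k < Q)%N -> E j k <= B + (j == k)%:R * N%:R.
  move=> jQ kQ; case: (ltngtP j k) => jk.
  - by rewrite mul0r addr0 (le_trans (ler_norm _))// Elt// jk.
  - by rewrite mul0r addr0 Esym (le_trans (ler_norm _))// Elt// jk.
  - by rewrite jk mul1r (le_trans (Ejj _ _))// lerDr.
have sumE : \sum_(0 <= m < T) (\sum_(0 <= j < Q) C j m) ^+ 2 <= Q%:R ^+ 2 * B + Q%:R * N%:R.
  (* Adding the squares of the imaginary parts only increases the sum, and completes the products to
     correlations in which just the phase differences survive. *)
  apply: (@le_trans _ _ (\sum_(0 <= j < Q) \sum_(0 <= k < Q) E j k)).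
    rewrite /E; under [leRHS]eq_bigr do rewrite exchange_big_nat/=.
    rewrite [leRHS]exchange_big_nat/= ler_sum// => m _.
    rewrite -[leLHS]addr0.
    rewrite [leRHS](_ : _ = (\sum_(0 <= j < Q) C j m) ^+ 2 + (\sum_(0 <= j < Q) D j m) ^+ 2).
      by rewrite lerD2l sqr_ge0.
    rewrite !expr2 !mulr_suml -big_split/=; apply: eq_bigr => j _.
    by rewrite !mulr_sumr -big_split.
  apply: (@le_trans _ _ (\sum_(0 <= j < Q) \sum_(0 <= k < Q) (B + (j == k)%:R * N%:R))).
    by rewrite !big_mkord ler_sum// => j _; rewrite !big_mkord ler_sum// => k _; exact: Ele.
  rewrite (eq_big_nat _ _ (F2 := fun=> Q%:R * B + N%:R)).
    by rewrite sumr_const_nat subn0 -[leLHS]mulr_natl mulrDr expr2 mulrA.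
  move=> j /andP[_ jQ]; rewrite big_split/= sumr_const_nat subn0 -[B *+ Q]mulr_natl; congr (_ + _).
  rewrite big_mkord (bigD1 (Ordinal jQ))//= eqxx mul1r big1 ?addr0// => k kj.
  by rewrite (negbTE (_ : j != k)) ?mul0r//; apply: contra kj => /eqP jk; apply/eqP/val_inj.
have TL : T%:R <= 2 * L by rewrite /T natrD; lra.
have : (Q%:R * S) ^+ 2 <= 2 * L * (Q%:R ^+ 2 * B + Q%:R * L).
  rewrite QS (le_trans (sqr_sum_le _ _))//; apply: ler_pM => //.
    by apply: sumr_ge0 => m _; exact: sqr_ge0.
  by rewrite (le_trans sumE)// lerD2l ler_wpM2l// ltW.
rewrite exprMn (_ : _ * _ * (_ + _) = Q%:R ^+ 2 * (2 * L * (L / Q%:R + B))).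
  by rewrite ler_pM2l ?exprn_gt0.
by field; rewrite lt0r_neq0.
Qed.

End weyl_differencing.

(** * Sums with a sine phase *)

Section sine_phase.
Context {R : realType}.
Variables (h q Q M : nat) (A0 L eta : R).
Hypothesis h0 : (0 < h)%N.
Hypothesis q0 : (0 < q)%N.
Hypothesis Q0 : (0 < Q)%N.
Hypothesis Qqh : (Q * q <= h)%N.
Hypothesis A00 : 0 < A0.

(* The phases [A sin(pi n / h + d)] are stable under differencing: a step of
   length [j q] multiplies [A] by [2 sin (pi j q / 2 h)] and moves [d] by
   [pi / 2 + pi j q / 2 h]. *)
Definition sine_phase (r s : nat) (A : R) (n : nat) : R :=
  A * sin (pi * n%:R / h%:R + (pi * r%:R / 2 + pi * (s * q)%:R / (2 * h%:R))).

(** The index [r] counts the differencings already made. The bound is uniform in [N], [s] and [A]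
    because differencing by [j * q] shortens the sum, moves the shift from [s] to [s + j] and
    changes the amplitude by a factor depending on [j]; the condition [N + s * q <= M] is
    preserved. *)
Definition sine_bound (r : nat) (B : R) : Prop := forall (N s : nat) (A c : R),
  (N + s * q <= M)%N ->
  A0 * (pi * q%:R / (2 * h%:R)) ^+ r <= A <= A0 * (pi * (Q * q)%:R / h%:R) ^+ r ->
  `|\sum_(0 <= n < N) cos (sine_phase r s A n + c)| <= B.

Let hr : (0 : R) < h%:R. Proof. by rewrite ltr0n. Qed.

Lemma sine_phase_diff r s A n j :
  sine_phase r s A (n + j * q) - sine_phase r s A n =
  sine_phase r.+1 (s + j) (A * (2 * sin (pi * (j * q)%:R / (2 * h%:R)))) n.
Proof.
rewrite /sine_phase -mulrBr sinB_prod.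
set x := _ + (_ + _); set y := _ + (_ + _); set z := _ + (_ + _).
have -> : (x - y) / 2 = pi * (j * q)%:R / (2 * h%:R).
  by rewrite /x /y !natrD !natrM; field; rewrite lt0r_neq0.
have -> : (x + y) / 2 = z - pi / 2.
  by rewrite /x /y /z -addn1 !mulnDl !natrD !natrM; field; rewrite lt0r_neq0.
by rewrite cosBpihalf; ring.
Qed.

(** The new amplitude factor is [2 sin x] with [x = pi j q / (2 h)]. It is at least [pi q / (2 h)]
    by [sin x >= x / 2] and [j >= 1], and at most [pi Q q / h] by [sin x <= x] and [j < Q], so the
    amplitude stays in the range prescribed for [r.+1]. *)
Lemma sine_bound_step r B B' : 0 <= B -> 0 <= B' -> M%:R <= L -> (Q * q)%:R <= L ->
  2 * L * (L / Q%:R + B) <= B' ^+ 2 -> sine_bound r.+1 B -> sine_bound r B'.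
Proof.
move=> B0 B'0 ML QqL hBB' hB N s A c NsM /andP[A1 A2].
have NM : N%:R <= L by rewrite (le_trans _ ML)// ler_nat (leq_trans _ NsM)// leq_addr.
rewrite -(@ler_pXn2r _ 2)// ?nnegrE//.
rewrite -normrX ger0_norm ?sqr_ge0// (le_trans _ hBB')//.
apply: (@van_der_corput _ _ N Q q L B) => // j /andP[j0 jQ].
have [jqN|Njq] := leqP (j * q) N; last first.
  by rewrite (_ : (N - j * q)%N = 0%N) ?big_nil ?normr0//; apply/eqP; rewrite subn_eq0 ltnW.
under eq_bigr do rewrite opprD addrACA subrr addr0 sine_phase_diff.
under eq_bigr do rewrite -[sine_phase _ _ _ _]addr0.
have jqQq : (j * q <= Q * q)%N by rewrite leq_mul2r ltnW// orbT.
have jqh : (j * q)%:R <= (h%:R : R) by rewrite ler_nat (leq_trans jqQq).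
have pi0 := pi_gt0 R.
have xb : 0 <= @pi R * (j * q)%:R / (2 * h%:R) <= pi / 2.
  apply/andP; split; first by rewrite divr_ge0 ?mulr_ge0// ltW.
  rewrite ler_pdivrMr ?mulr_gt0//.
  by rewrite (_ : _ / 2 * _ = pi * h%:R) ?ler_pM2l//; field.
have Ar : 0 <= A0 * (pi * q%:R / (2 * h%:R)) ^+ r.
  by rewrite mulr_ge0 ?(ltW A00)// exprn_ge0// divr_ge0 ?mulr_ge0// ltW.
apply: hB.
  by rewrite mulnDl addnCA addnC subnK// addnC.
apply/andP; split.
- rewrite exprSr [leLHS]mulrA ler_pM//; first by rewrite divr_ge0 ?mulr_ge0// ltW.
  have := sin_ge_half xb; rewrite ler_pdivrMr// [_ * 2]mulrC => /(le_trans _); apply.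
  by rewrite ler_pM2r ?invr_gt0 ?mulr_gt0// ler_pM2l// ler_nat leq_pmull.
- rewrite exprSr [leRHS]mulrA ler_pM//.
  + exact: le_trans A1.
  + by rewrite mulr_ge0// sin_ge0_pihalf.
  + have /andP[/sin_le hs _] := xb.
    apply: (@le_trans _ _ (2 * (pi * (j * q)%:R / (2 * h%:R)))); first by rewrite ler_pM2l.
    rewrite (_ : 2 * _ = pi * (j * q)%:R / h%:R); last by field; rewrite lt0r_neq0.
    by rewrite ler_pM2r ?invr_gt0// ler_pM2l// ler_nat.
Qed.

(** After four differencings the shift [r pi / 2] is a full period, so the increments are
    [2 A sin (pi / (2 h)) cos (u n)]: positive and decreasing as long as [u n] stays in the first
    quadrant. The factor [1 - eta] keeps [u n] at distance [pi eta / 2] from [pi / 2]. *)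
Lemma sine_bound_last B : 0 < eta -> M%:R * 2 <= (1 - eta) * h%:R ->
  A0 * (pi * (Q * q)%:R / h%:R) ^+ 4 / h%:R <= 1 ->
  2 + 2 / (2 * (A0 * (pi * q%:R / (2 * h%:R)) ^+ 4) * (pi / (4 * h%:R)) * (pi * eta / 4)) <= B ->
  sine_bound 4 B.
Proof.
move=> eta0 Meta hup hB N s A c NsM /andP[A1 A2]; apply: le_trans hB.
have pi0 := pi_gt0 R.
have qr : (0 : R) < q%:R by rewrite ltr0n.
set lam := (X in 2 / X).
(* The midpoint angle, shift included; [N + s * q <= M] bounds it by [pi * M / h]. *)
set u : nat -> R := fun n => pi * (n%:R + 1 / 2 + (s * q)%:R / 2) / h%:R.
have dE n : sine_phase 4 s A n.+1 + c - (sine_phase 4 s A n + c)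
    = 2 * A * sin (pi / (2 * h%:R)) * cos (u n).
  rewrite opprD addrACA subrr addr0 /sine_phase -mulrBr sinB_prod.
  set x := _ + (_ + _); set y := _ + (_ + _).
  have -> : (x - y) / 2 = pi / (2 * h%:R).
    by rewrite /x /y -addn1 natrD; field; rewrite lt0r_neq0.
  have -> : (x + y) / 2 = u n + pi *+ 2.
    by rewrite /x /y /u -addn1 natrD; field; rewrite lt0r_neq0.
  by rewrite cosD2pi; ring.
have alo : 0 < A0 * (pi * q%:R / (2 * h%:R)) ^+ 4.
  by rewrite mulr_gt0// exprn_gt0// divr_gt0 ?mulr_gt0.
have Agt : 0 < A by exact: lt_le_trans A1.
have hge1 : (1 : R) <= h%:R by rewrite ler1n.
have x1 : 0 <= @pi R / (2 * h%:R) <= pi / 2.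
  apply/andP; split; first by rewrite divr_ge0 ?mulr_ge0// ltW.
  by rewrite ler_pM2l// lef_pV2 ?posrE ?mulr_gt0//; lra.
have s1 := sin_ge_half x1.
have s2 : sin (pi / (2 * h%:R)) <= pi / (2 * h%:R) :> R by apply: sin_le; case/andP: x1.
have s0 : 0 < pi / (2 * h%:R) / 2 :> R by rewrite !divr_gt0// mulr_gt0.
have lam0 : 0 < lam by rewrite /lam !mulr_gt0// ?invr_gt0 ?mulr_gt0.
have uE n : (n.+1 < N)%N -> 0 <= u n /\ u n <= pi / 2 - pi * eta / 2.
  move=> nN; split; first by rewrite divr_ge0// mulr_ge0 ?(ltW pi0)// !addr_ge0// divr_ge0.
  rewrite ler_pdivrMr//.
  have : (n%:R + 1 / 2 + (s * q)%:R / 2 : R) <= M%:R.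
    have : ((n.+1 + s * q)%:R : R) <= M%:R by rewrite ler_nat (leq_trans _ NsM)// leq_add2r ltnW.
    rewrite -addn1 !natrD; have : 0 <= ((s * q)%:R : R) by []. 
    lra.
  nra.
have eta1 : eta <= 1.
  have : 0 <= (M%:R : R) by [].
  nra.
have cosu n : (n.+1 < N)%N -> pi * eta / 4 <= cos (u n).
  move=> /uE[u0 u1]; rewrite (_ : u n = pi / 2 - (pi / 2 - u n)); last by ring.
  rewrite cosB cos_pihalf mul0r add0r sin_pihalf mul1r.
  have : (pi / 2 - u n) / 2 <= sin (pi / 2 - u n) by apply: sin_ge_half; apply/andP; split; nra.
  lra.
apply: kusmin_landau => //.
- move=> n nN; rewrite dE.
  have := cosu n nN; have := cos_le1 (u n) => c1 c2.
  have e0 : 0 < pi * eta / 4 by rewrite divr_gt0// mulr_gt0.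
  apply/andP; split.
    rewrite /lam !ler_pM//; rewrite ?mulr_ge0 ?invr_ge0 ?(ltW alo) ?(ltW pi0) ?(ltW eta0) ?(ltW A00)//.
    by rewrite (le_trans _ s1)// le_eqVlt; apply/orP; left; apply/eqP; field; rewrite lt0r_neq0.
  apply: (@le_trans _ _ (2 * A * (pi / (2 * h%:R)) * 1)).
    rewrite ler_pM//; last by rewrite ler_pM2l// mulr_gt0.
      by rewrite !mulr_ge0// ?(ltW Agt)// (le_trans _ s1)// ltW.
    by rewrite (le_trans _ c2)// ltW.
  rewrite (_ : _ * 1 = A / h%:R * pi); last by field; rewrite lt0r_neq0.
  by rewrite ler_piMl ?(ltW pi0)// (le_trans _ hup)// ler_pM2r ?invr_gt0.
- right=> n; rewrite ltn_predRL => nN; rewrite !dE ler_pM2l.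
    apply: cos_le.
    + by have [] := uE n (ltnW nN).
    + by rewrite ler_pM2r ?invr_gt0// ler_pM2l// -addn1 natrD; lra.
    + by have [_] := uE n.+1 nN; nra.
  by rewrite !mulr_gt0// (lt_le_trans _ s1).
Qed.

(** Each van der Corput step takes the square root of the saving: [Y^16] from Kusmin-Landau, then
    [Y^8], [Y^4], [Y^2], [Y]. The constant 3 reproduces itself because [2 * (1 + 3) <= 3 ^ 2]. *)
Theorem sine_sum_le (Y c : R) : 0 < eta -> M%:R * 2 <= (1 - eta) * h%:R ->
  M%:R <= L -> (Q * q)%:R <= L ->
  A0 * (pi * (Q * q)%:R / h%:R) ^+ 4 / h%:R <= 1 ->
  2 + 2 / (2 * (A0 * (pi * q%:R / (2 * h%:R)) ^+ 4) * (pi / (4 * h%:R)) * (pi * eta / 4))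
    <= L / Q%:R ->
  1 <= Y -> Y ^+ 16 <= Q%:R ->
  `|\sum_(0 <= n < M) cos (A0 * sin (pi * n%:R / h%:R) + c)| <= 3 * L / Y.
Proof.
move=> eta0 Meta ML QqL hup hlow Y1 YQ.
have L0 : 0 <= L by rewrite (le_trans _ ML).
have Y0 : 0 < Y by rewrite (lt_le_trans _ Y1).
pose z := Y^-1.
have z0 : 0 <= z by rewrite invr_ge0 ltW.
have z1 : z <= 1 by rewrite invf_le1.
have Qz : L / Q%:R <= L * z ^+ 16.
  by rewrite ler_wpM2l// exprVn lef_pV2 ?posrE ?exprn_gt0// ltr0n.
have QL0 : 0 <= L / Q%:R by rewrite divr_ge0.
have zz k : 0 <= z ^+ k <= 1 by rewrite exprn_ge0// exprn_ile1.
have step B k : (k <= 8)%N -> 0 <= B -> B <= 3 * L * z ^+ k.*2 ->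
    2 * L * (L / Q%:R + B) <= (3 * L * z ^+ k) ^+ 2.
  move=> k8 B0 hB.
  have h16 : z ^+ 16 <= z ^+ k.*2 by rewrite ler_wiXn2l// -[16%N]/(8.*2) leq_double.
  have : L / Q%:R + B <= 4 * L * z ^+ k.*2.
    have := ler_wpM2l L0 h16. lra.
  move=> hh; rewrite (_ : (_ * _) ^+ 2 = 9 * L ^+ 2 * z ^+ k.*2); last first.
    by rewrite -muln2 exprM; ring.
  apply: (@le_trans _ _ (2 * L * (4 * L * z ^+ k.*2))); first by rewrite ler_wpM2l// mulr_ge0.
  by rewrite (_ : _ * (_ * _) = 8 * (L ^+ 2 * z ^+ k.*2)); [rewrite -mulrA ler_wpM2r ?mulr_ge0 ?sqr_ge0// ?exprn_ge0//; lra|ring].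
have P k : 0 <= 3 * L * z ^+ k by rewrite !mulr_ge0// exprn_ge0.
have b4 := sine_bound_last eta0 Meta hup hlow.
have b3 : sine_bound 3 (3 * L * z ^+ 8).
  apply: sine_bound_step b4 => //; apply: step => //; rewrite (le_trans Qz)//.
  by rewrite ler_wpM2r ?exprn_ge0// ler_peMl//; lra.
have b2 : sine_bound 2 (3 * L * z ^+ 4) by apply: sine_bound_step b3 => //; exact: step.
have b1 : sine_bound 1 (3 * L * z ^+ 2) by apply: sine_bound_step b2 => //; exact: step.
have b0 : sine_bound 0 (3 * L * z).
  have := P 1%N; rewrite expr1 => P1; apply: sine_bound_step b1 => //.
  by rewrite -[X in _ <= (_ * X) ^+ 2]expr1; exact: step.
have := b0 M 0%N A0 c; rewrite mul0n addn0 !expr0 mulr1 lexx leqnn => /(_ isT isT).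
rewrite /sine_phase; under eq_bigr do rewrite mul0n !mulr0 !mul0r !addr0.
by [].
Qed.

End sine_phase.

(** * Stationary phase *)

Section fresnel.
Context {R : realType}.

(** Fresnel integrals enter only through the derivative of a primitive on a bounded window, so
    integrating from [- K] suffices. *)
Lemma antiderivative_exists (f : R -> R) (K : R) : continuous f ->
  exists Phi : R -> R, forall u, `|u| < K -> has_deriv Phi u (f u).
Proof.
move=> cf; exists (fun x => \int[lebesgue_measure]_(t in `[- K, x]) f t)%R.
move=> u; rewrite ltr_norml => /andP[Ku uK].
have [|d1 d2] := @continuous_FTC1_closed R f (- K) u K uK _ Ku (cf u).
  apply: continuous_compact_integrable; first exact: segment_compact.
  exact: continuous_subspaceT.
rewrite derive1E in d2; exact: DeriveDef d1 d2.
Qed.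

Variables (S C : R -> R).
Hypothesis dS : forall x, has_deriv S x (C x).
Hypothesis S1 : forall x, `|S x| <= 1.
Hypothesis C1 : forall x, `|C x| <= 1.

(** Integration by parts in monotone form: [Phi u - S (u^2) / (2 u)] has derivative
    [S (u^2) / (2 u^2)], dominated by that of [- 1 / (2 u)]; hence [G s] increases for [s = 1] and
    [s = -1]. The pair [(S, C)] stands for [(sin, cos)] and for [(- cos, sin)]. *)
Lemma fresnel_half (Phi : R -> R) (r : R) : 1 <= r ->
  (forall u, 1 <= u <= r -> has_deriv Phi u (C (u ^+ 2))) ->
  `|Phi r - Phi 1| <= 3 / 2.
Proof.
move=> r1 dPhi.
pose G (s : R) (u : R) := s * (Phi u - S (u ^+ 2) * (2 * u)^-1) - (2 * u)^-1.
have dG s u : 1 <= u <= r ->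
    has_deriv (G s) u (s * (S (u ^+ 2) * (2 * u ^+ 2)^-1) + (2 * u ^+ 2)^-1).
  move=> u1; have u0 : u != 0 by rewrite lt0r_neq0//; lra.
  apply: isd_eq.
    apply: isd_add; last first.
      by apply: isd_opp; apply: isd_inv; [rewrite mulf_neq0|isd].
    apply: isd_mul; first exact: isd_cst.
    apply: isd_add; first exact: dPhi.
    apply: isd_opp; apply: isd_mul; last by apply: isd_inv; [rewrite mulf_neq0|isd].
    by apply: isd_comp (dS _) _; isd.
  by rewrite /=; field.
have pos s : `|s| <= 1 -> G s 1 <= G s r.
  move=> s1; apply: (ger0_derive_le r1 (dG s)) => u u1.
  rewrite -[X in _ + X]mul1r mulrA -mulrDl.
  apply: mulr_ge0; last by rewrite invr_ge0 pmulr_rge0// sqr_ge0.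
  have : `|s * S (u ^+ 2)| <= 1 by rewrite normrM mulr_ile1.
  by rewrite ler_norml => /andP[? _]; lra.
have hp := pos 1; have hm := pos (-1).
rewrite normr1 in hp; rewrite normrN1 in hm.
move: (hp (lexx _)) (hm (lexx _)); rewrite /G => {}hp {}hm.
have r0 : 0 < (2 * r)^-1 by rewrite invr_gt0; lra.
have r2 : (2 * r)^-1 <= 2^-1 by rewrite lef_pV2 ?posrE; lra.
have : `|S (r ^+ 2) * (2 * r)^-1| <= 2^-1.
  by rewrite normrM -[leRHS]mul1r ler_pM// gtr0_norm.
have : `|S (1 ^+ 2) * (2 * 1)^-1| <= 2^-1.
  by rewrite normrM -[leRHS]mul1r ler_pM// ger0_norm ?invr_ge0; lra.
move: hp hm; rewrite !ler_norml; set a := S _ * _; set b := S _ * _.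
by move=> hp hm /andP[? ?] /andP[? ?]; apply/andP; split; lra.
Qed.

Lemma fresnel_bound (Phi : R -> R) (r : R) : 1 <= r ->
  (forall u, `|u| <= r -> has_deriv Phi u (C (u ^+ 2))) ->
  `|Phi r - Phi (- r)| <= 5.
Proof.
move=> r1 dPhi.
have h1 : `|Phi r - Phi 1| <= 3 / 2.
  by apply: fresnel_half => // u /andP[? ?]; apply: dPhi; rewrite ger0_norm//; lra.
have h2 : `|- Phi (- r) - - Phi (- 1)| <= 3 / 2.
  apply: (@fresnel_half (fun u => - Phi (- u))) => // u /andP[? ?].
  apply: isd_eq.
    apply: isd_opp; apply: isd_comp; first by apply: dPhi; rewrite normrN ger0_norm//; lra.
    by isd.
  by rewrite /= sqrrN; ring.
have h3 : `|Phi 1 - Phi (- 1)| <= 1 * `|1 - - 1|.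
  apply: (@mvt_norm_le _ _ (fun u => C (u ^+ 2))) => // u /orP[]/andP[? ?];
    apply: dPhi; rewrite ler_norml; lra.
move: h3; rewrite mul1r opprK (ger0_norm (_ : 0 <= 1 + 1)) //.
move: h1 h2; rewrite !ler_norml => /andP[? ?] /andP[? ?] /andP[? ?].
by apply/andP; split; lra.
Qed.

Hypothesis C_lip : forall x y, `|C y - C x| <= `|y - x|.

(** The sample points advance by [s], and [C (u^2)] varies by at most [2 (r + 1) s] between
    neighbours. Moving each end of the integral to the nearest sample point costs at most [s], which
    after division by [s] is the term 2. *)
Lemma riemann_sum_le (Phi : R -> R) (r s x0 : R) (a b : nat) :
  1 <= r -> 0 < s <= 1 -> (a <= b)%N ->
  (forall u, `|u| < r + 2 -> has_deriv Phi u (C (u ^+ 2))) ->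
  - r <= s * (a%:R - x0) <= - r + s -> r <= s * (b%:R - x0) <= r + s ->
  `|\sum_(a <= n < b) C ((s * (n%:R - x0)) ^+ 2) - (Phi r - Phi (- r)) / s|
    <= 2 + (b - a)%:R * (s * (2 * (r + 1))).
Proof.
move=> r1 /andP[s0 s1] ab dPhi /andP[ua1 ua2] /andP[ub1 ub2].
pose u n := s * (n%:R - x0).
have ur n : (a <= n <= b)%N -> - r <= u n <= r + s.
  move=> /andP[an nb]; rewrite (le_trans ua1)/=; last by rewrite ler_pM2l// lerD2r ler_nat.
  by rewrite (le_trans _ ub2)// ler_pM2l// lerD2r ler_nat.
have uS n : u n.+1 = u n + s by rewrite /u -addn1 natrD; ring.
have step n : (a <= n < b)%N ->
    `|Phi (u n.+1) - Phi (u n) - s * C (u n ^+ 2)| <= s * (s * (2 * (r + 1))).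
  move=> /andP[an nb].
  have /andP[h1 h2] := ur n (introT andP (conj an (ltnW nb))).
  have /andP[h3 h4] := ur n.+1 (introT andP (conj (leqW an) nb)).
  have us : u n <= u n.+1 by rewrite uS; lra.
  have [z zb|z /andP[z1 z2] ->] := @mvt_within _ Phi (fun z => C (z ^+ 2)) _ _ us.
    by apply: dPhi; move: zb => /andP[z1 z2]; rewrite ltr_norml; apply/andP; split; lra.
  rewrite uS in z2 h4 *.
  rewrite (_ : _ - _ = s * (C (z ^+ 2) - C (u n ^+ 2))); last by ring.
  rewrite normrM gtr0_norm// ler_pM2l// (le_trans (C_lip _ _))//.
  rewrite subr_sqr normrM; apply: ler_pM => //; first by rewrite ger0_norm; lra.
  by rewrite ler_norml; apply/andP; split; lra.
have tot : `|Phi (u b) - Phi (u a) - s * \sum_(a <= n < b) C (u n ^+ 2)|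
    <= (b - a)%:R * (s * (s * (2 * (r + 1)))).
  rewrite -(telescope_sumr (fun n => Phi (u n)) ab) mulr_sumr -sumrB.
  rewrite (le_trans (ler_norm_sum _ _ _))//.
  rewrite (@le_trans _ _ (\sum_(a <= n < b) (s * (s * (2 * (r + 1))))))//.
    by rewrite ler_sum_nat// => n; exact: step.
  by rewrite sumr_const_nat -[leLHS]mulr_natl.
have end1 : `|Phi (u b) - Phi r| <= s.
  rewrite (@le_trans _ _ (1 * `|u b - r|))//; last by rewrite mul1r ger0_norm /u; lra.
  apply: (@mvt_norm_le _ _ (fun u => C (u ^+ 2))) => // z zb.
  by apply: dPhi; rewrite ltr_norml; move: zb => /orP[]/andP[]; rewrite /u => ? ?; apply/andP; split; lra.
have end2 : `|Phi (u a) - Phi (- r)| <= s.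
  rewrite (@le_trans _ _ (1 * `|u a - - r|))//; last by rewrite mul1r ger0_norm /u; lra.
  apply: (@mvt_norm_le _ _ (fun u => C (u ^+ 2))) => // z zb.
  by apply: dPhi; rewrite ltr_norml; move: zb => /orP[]/andP[]; rewrite /u => ? ?; apply/andP; split; lra.
rewrite -(@ler_pM2l _ s)//.
set T := (\sum_(_ <= _ < _) _); have -> : T = \sum_(a <= n < b) C (u n ^+ 2) by [].
rewrite -{1}(gtr0_norm s0) -normrM mulrBr mulrCA divff ?lt0r_neq0// mulr1.
move: tot end1 end2; set T' := \sum_(_ <= _ < _) _.
rewrite [s * (2 + _)]mulrDr [s * ((b - a)%:R * _)]mulrCA; set X := (b - a)%:R * _.
rewrite !ler_norml => /andP[? ?] /andP[? ?] /andP[? ?].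
by apply/andP; split; lra.
Qed.

End fresnel.

(** * Rounding up to natural numbers and restricting a range to a block *)

Section natceil.
Context {R : realType}.

(** The ceiling is clipped at 0, so that the adjunction [natceil_le] holds for negative [x] as
    well. *)
Definition natceil (x : R) : nat := `|Num.max (0 : int) (Num.ceil x)|%N.

Lemma natceil_le (x : R) n : (natceil x <= n)%N = (x <= n%:R).
Proof.
rewrite /natceil -lez_nat gez0_abs ?le_max ?lexx//.
by rewrite ge_max ceil_le_int lez_nat leq0n.
Qed.

Lemma ltn_natceil (x : R) n : (n < natceil x)%N = (n%:R < x).
Proof. by rewrite ltnNge natceil_le ltNge. Qed.

Lemma natceil_ge (x : R) : x <= (natceil x)%:R.
Proof. by rewrite -natceil_le. Qed.

Lemma natceil_mono (x y : R) : x <= y -> (natceil x <= natceil y)%N.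
Proof. by move=> xy; rewrite natceil_le (le_trans xy)// natceil_ge. Qed.

Lemma natceil_lt (x : R) : 0 <= x -> (natceil x)%:R < x + 1.
Proof.
move=> x0; case E : (natceil x) => [|n]; first by rewrite ltr_wpDl.
by rewrite -addn1 natrD ltrD2r -ltn_natceil E.
Qed.

Lemma natceil_width (x y : R) : 0 <= y ->
  (natceil y - natceil x)%:R <= Num.max 0 (y - x) + 1 :> R.
Proof.
move=> y0; have [xy|yx] := leqP (natceil y) (natceil x).
  by move: xy; rewrite -subn_eq0 => /eqP ->; rewrite addr_ge0// le_max lexx.
rewrite natrB ?(ltnW yx)//.
have := natceil_lt y0; have := natceil_ge x => h1 h2.
have : y - x <= Num.max 0 (y - x) by rewrite le_max lexx orbT.
lra.
Qed.

Definition clip (a b m : nat) : nat := minn b (maxn a m).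

Lemma clip_ge a b m : (a <= b)%N -> (a <= clip a b m <= b)%N.
Proof. by move=> ab; rewrite /clip; lia. Qed.

Lemma clip_id a b m : (a <= m)%N -> (m <= b)%N -> clip a b m = m.
Proof. by rewrite /clip; lia. Qed.

Lemma clip_mono a b m n : (m <= n)%N -> (clip a b m <= clip a b n)%N.
Proof. by move=> ab; rewrite /clip; lia. Qed.

Lemma clip_width a b m n : (clip a b n - clip a b m <= n - m)%N.
Proof. by rewrite /clip; lia. Qed.

Lemma norm_sum_nat_le (u : nat -> R) (a b : nat) :
  (forall n, (a <= n < b)%N -> `|u n| <= 1) -> `|\sum_(a <= n < b) u n| <= (b - a)%:R.
Proof.
move=> u1; rewrite (le_trans (ler_norm_sum _ _ _))//.
rewrite (@le_trans _ _ (\sum_(a <= n < b) 1))//; first exact: ler_sum_nat.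
by rewrite sumr_const_nat.
Qed.

End natceil.

(** * The phase in the angular variable *)

Section boundary_phase.
Context {R : realType}.
Variables (mu : R) (h : nat).
Hypothesis mu0 : 0 < mu.
Hypothesis h0 : (0 < h)%N.

Definition theta (n : nat) : R := acos (n%:R / mu).

(** This is [2 * pi * h * height mu n] (see [phase_height]). As a function of real [n = mu cos t]
    its derivative is [- 2 h t]. *)
Definition phase (n : nat) : R :=
  2 * h%:R * mu * (sin (theta n) - theta n * cos (theta n)).

Lemma divr_mu_itv n : n%:R <= mu -> -1 <= n%:R / mu <= 1.
Proof.
move=> nmu; rewrite ler_pdivrMr// mul1r nmu andbT.
by rewrite (@le_trans _ _ 0)// divr_ge0// ltW.
Qed.

Lemma cos_theta n : n%:R <= mu -> cos (theta n) = n%:R / mu.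
Proof. by move=> nmu; rewrite /theta acosK// in_itv/= divr_mu_itv. Qed.

Lemma mu_cos_theta n : n%:R <= mu -> mu * cos (theta n) = n%:R.
Proof. by move=> nmu; rewrite cos_theta// mulrC divfK// lt0r_neq0. Qed.

Lemma theta_itv n : n%:R <= mu -> 0 <= theta n <= pi / 2.
Proof.
move=> nmu; have pi0 := pi_gt0 R.
have t0 := acos_ge0 (divr_mu_itv nmu); have tpi := acos_lepi (divr_mu_itv nmu).
rewrite t0/= leNgt; apply/negP => lt.
have : cos (theta n) < cos (pi / 2).
  by rewrite ltr_cos// in_itv/=; apply/andP; split; rewrite ?t0 ?tpi//; lra.
by rewrite cos_pihalf cos_theta// ltNge divr_ge0// ltW.
Qed.

Lemma theta_le (n : nat) (x : R) : n%:R <= mu -> 0 <= x <= pi ->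
  (theta n <= x) = (mu * cos x <= n%:R).
Proof.
move=> nmu x0; have /andP[t0 t1] := theta_itv nmu.
rewrite -{1}(mu_cos_theta nmu) ler_pM2l//.
by rewrite [LHS]leNgt -ltr_cos -?leNgt// in_itv/= ?x0// t0/=; have := pi_gt0 R; lra.
Qed.

(** The phase is convex in [n], since its derivative [- 2 h theta n] increases. The tangent
    inequality for [sin] gives this without differentiating [acos]. *)
Lemma phase_step n : n.+1%:R <= mu ->
  - (2 * h%:R * theta n) <= phase n.+1 - phase n <= - (2 * h%:R * theta n.+1).
Proof.
move=> nmu; have nmu' : n%:R <= mu by rewrite (le_trans _ nmu)// ler_nat.
have pi0 := pi_gt0 R.
have tn := theta_itv nmu; have tn' := theta_itv nmu'.
have ton m : 0 <= theta m <= pi / 2 -> 0 <= theta m <= pi.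
  by move=> /andP[? ?]; apply/andP; split; lra.
have c1 : mu * cos (theta n.+1) - mu * cos (theta n) = 1.
  by rewrite !mu_cos_theta// -addn1 natrD; ring.
have hh : (0 : R) <= 2 * h%:R by rewrite mulr_ge0.
have e1 := sin_tangent_le (ton _ tn) (ton _ tn').
have e2 := sin_tangent_le (ton _ tn') (ton _ tn).
move: c1 e1 e2; rewrite /phase.
set c := cos (theta n); set c' := cos (theta n.+1); set s := sin (theta n); set s' := sin (theta n.+1).
set t := theta n; set t' := theta n.+1 => c1 e1 e2.
have k0 : 0 <= 2 * h%:R * mu by rewrite mulr_ge0// ltW.
apply/andP; split.
- rewrite -subr_ge0 (_ : _ - _ = 2 * h%:R * mu * (s' - s + (t - t') * c')
     + 2 * h%:R * t * (1 - (mu * c' - mu * c))); last by ring.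
  by rewrite c1 subrr mulr0 addr0 mulr_ge0//; lra.
- rewrite -subr_ge0 (_ : _ - _ = 2 * h%:R * mu * (s - s' + (t' - t) * c)
     - 2 * h%:R * t' * (1 - (mu * c' - mu * c))); last by ring.
  by rewrite c1 subrr mulr0 subr0 mulr_ge0//; lra.
Qed.

Lemma cos_shift (x : R) (k : nat) : cos (x + 2 * pi * k%:R) = cos x.
Proof.
rewrite (_ : 2 * pi * k%:R = (pi *+ 2) *+ k); first exact: (periodicn (@cosD2pi R)).
by rewrite -[RHS]mulr_natr -[pi *+ 2]mulr_natl.
Qed.

(** Adding [2 pi l n] leaves the cosines unchanged and shifts the increments, which then vanish
    where [h theta = pi l]. On one side of that point they are positive; on the other they are
    negative, and the evenness of [cos] reverses them. *)
Lemma kl_side (l a b : nat) (lam c : R) : 0 < lam ->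
  (forall n, (a <= n < b)%N -> n%:R <= mu) ->
  (forall n, (a <= n < b)%N -> lam <= 2 * (h%:R * theta n - pi * l%:R) <= pi) \/
  (forall n, (a <= n < b)%N -> lam <= 2 * (pi * l%:R - h%:R * theta n) <= pi) ->
  `|\sum_(a <= n < b) cos (phase n + c)| <= 2 + 2 / lam.
Proof.
move=> lam0 nmu side.
pose F k := phase (k + a) + 2 * pi * (l * (k + a))%:R + c.
have -> : \sum_(a <= n < b) cos (phase n + c) = \sum_(0 <= k < b - a) cos (F k).
  rewrite -{1}[a]add0n big_addn; apply: eq_bigr => k _.
  by rewrite /F addrAC cos_shift.
have dF k : (k.+1 < b - a)%N ->
    2 * (pi * l%:R - h%:R * theta (k + a)) <= F k.+1 - F k
      <= 2 * (pi * l%:R - h%:R * theta (k + a).+1).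
  move=> kb; have /phase_step : (k + a).+1%:R <= mu.
    by apply: nmu; apply/andP; split; lia.
  rewrite /F addSn mulnS natrD.
  by move=> /andP[h1 h2]; apply/andP; split; lra.
case: side => side.
- under eq_bigr do rewrite -cosN.
  apply: kusmin_landau => //.
    move=> k kb; have /andP[h1 h2] := dF k kb.
    have /andP[h3 h4] : lam <= 2 * (h%:R * theta (k + a) - pi * l%:R) <= pi by apply: side; apply/andP; split; lia.
    have /andP[h5 h6] : lam <= 2 * (h%:R * theta (k + a).+1 - pi * l%:R) <= pi by apply: side; apply/andP; split; lia.
    by apply/andP; split; lra.
  right=> k; rewrite ltn_predRL => kb.
  have /andP[h1 h2] := dF k (ltnW kb); have /andP[h3 h4] := dF k.+1 kb.
  by rewrite addSn in h3; lra.
- apply: kusmin_landau => //.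
    move=> k kb; have /andP[h1 h2] := dF k kb.
    have /andP[h3 h4] : lam <= 2 * (pi * l%:R - h%:R * theta (k + a)) <= pi by apply: side; apply/andP; split; lia.
    have /andP[h5 h6] : lam <= 2 * (pi * l%:R - h%:R * theta (k + a).+1) <= pi by apply: side; apply/andP; split; lia.
    by apply/andP; split; lra.
  left=> k; rewrite ltn_predRL => kb.
  have /andP[h1 h2] := dF k (ltnW kb); have /andP[h3 h4] := dF k.+1 kb.
  by rewrite addSn in h3; lra.
Qed.

End boundary_phase.

Lemma big_nat_blocks {V : nmodType} (f : nat -> V) (beta : nat -> nat) k :
  (forall l, (l < k)%N -> (beta l.+1 <= beta l)%N) ->
  \sum_(beta k <= n < beta 0) f n
  = \sum_(0 <= l < k) \sum_(beta l.+1 <= n < beta l) f n.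
Proof.
elim: k => [|k IH] hb; first by rewrite !big_geq.
have hk : (beta k <= beta 0)%N.
  elim: k {IH} hb => // k IHk hb; rewrite (leq_trans (hb k _))// IHk// => l lk.
  exact/hb/ltnW.
rewrite big_nat_recr//= -IH => [|l lk]; last exact/hb/ltnW.
by rewrite addrC -big_cat_nat// hb.
Qed.

(** * Cutting the sum into blocks, and the trivial bound for a block *)

Section blocks.
Context {R : realType}.
Variables (mu : R) (h : nat).
Hypothesis mu1 : 1 <= mu.
Hypothesis h0 : (0 < h)%N.

Let mu0 : 0 < mu. Proof. exact: lt_le_trans mu1. Qed.
Let hr : (0 : R) < h%:R. Proof. by rewrite ltr0n. Qed.
Let hr1 : (1 : R) <= h%:R. Proof. by rewrite ler1n. Qed.
Let pi0 := pi_gt0 R.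

(** Block [l] runs from [block_bound l.+1] to [block_bound l] and holds the [n] for which
    [h theta n] is within [pi / 2] of [pi l]. The bounds decrease in [l] because [theta] decreases
    in [n]; the bound at 0 is one past the last column. *)
Definition block_bound (l : nat) : nat :=
  if l is k.+1 then natceil (mu * cos (pi * (k%:R + 1 / 2) / h%:R))
  else (Num.trunc mu).+1.

Lemma half_angle_itv k : (k.*2 <= h)%N -> 0 <= @pi R * (k%:R + 1 / 2) / h%:R <= pi.
Proof.
move=> kh; have : (k.*2%:R : R) <= h%:R by rewrite ler_nat.
rewrite -muln2 natrM => {}kh; apply/andP; split.
  by rewrite divr_ge0// mulr_ge0 ?(ltW pi0)// addr_ge0// divr_ge0.
by rewrite ler_pdivrMr// ler_pM2l//; have := hr1; lra.
Qed.

Lemma block_bound_le l : (l.*2 <= h)%N -> (block_bound l.+1 <= block_bound l)%N.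
Proof.
move=> lh; case: l lh => [|k] kh /=.
  rewrite natceil_le (le_trans _ (ltW (truncnS_gt mu)))//.
  by rewrite -[leRHS]mulr1 ler_pM2l// cos_le1.
have /andP[a1 a2] := half_angle_itv kh.
apply: natceil_mono; rewrite ler_pM2l//; apply: cos_le => //.
  by rewrite divr_ge0// mulr_ge0 ?(ltW pi0)// addr_ge0// divr_ge0.
by rewrite ler_pM2r ?invr_gt0// ler_pM2l// -[k.+1]addn1 natrD; lra.
Qed.

(** Here the cut angle is at least [pi / 2], so its cosine is nonpositive and [natceil] clips to 0:
    the blocks up to this [l] exhaust the sum. *)
Lemma block_bound_last l : (l.*2 <= h)%N -> (h <= l.*2.+1)%N -> block_bound l.+1 = 0%N.
Proof.
move=> lh hl; apply/eqP; rewrite -leqn0 /= natceil_le.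
have /andP[a1 a2] := half_angle_itv lh.
have hl' : h%:R <= 2 * l%:R + 1 :> R by rewrite -natrM mul2n -[1]/(1%:R) -natrD ler_nat addn1.
rewrite mulr_ge0_le0 ?(ltW mu0)// -cos_pihalf.
apply: cos_le => //; first by rewrite divr_ge0// ltW.
by rewrite ler_pdivlMr// mulrAC -mulrA ler_pM2l//; lra.
Qed.

Lemma block_theta l n : (l.*2 <= h)%N -> (block_bound l.+1 <= n < block_bound l)%N ->
  n%:R <= mu /\ - (pi / 2) <= h%:R * theta mu n - pi * l%:R <= pi / 2.
Proof.
move=> lh /andP[n1 n2].
have nmu : n%:R <= mu.
  rewrite -truncn_ge_nat ?(ltW mu0)//.
  have hb k : (k.*2 <= h)%N -> (block_bound k <= block_bound 0)%N.
    elim: k => // k IH kh; rewrite (leq_trans (block_bound_le _) (IH _))//; lia.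
  by have := leq_trans n2 (hb l lh).
split=> //; have := half_angle_itv lh => aitv.
move: n1; rewrite /= natceil_le -theta_le// ler_pdivlMr// => t1.
have /andP[t0 _] := theta_itv mu0 nmu.
apply/andP; split; last by lra.
case: l lh n2 {t1 aitv} => [|k] kh n2.
  by rewrite mulr0 subr0 (@le_trans _ _ 0) ?mulr_ge0 ?(ltW hr)// oppr_le0 divr_ge0// ltW.
have kh' : (k.*2 <= h)%N by lia.
have aitv := half_angle_itv kh'.
move: n2; rewrite /= ltn_natceil ltNge -theta_le// -ltNge ltr_pdivrMr// -[k.+1]addn1 natrD => t1.
by lra.
Qed.

(** Outside a window around the stationary point the increments have a fixed sign and size at least
    [lam], so Kusmin-Landau applies on both sides. The window may stick out of the block, hence the
    clipping. *)
Lemma block_split l (X Y lam c : R) : (l.*2 <= h)%N -> 0 < lam -> X <= Y ->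
  (forall n, (block_bound l.+1 <= n < block_bound l)%N -> n%:R < X ->
    lam <= 2 * (h%:R * theta mu n - pi * l%:R)) ->
  (forall n, (block_bound l.+1 <= n < block_bound l)%N -> Y <= n%:R ->
    lam <= 2 * (pi * l%:R - h%:R * theta mu n)) ->
  `|\sum_(block_bound l.+1 <= n < block_bound l) cos (phase mu h n + c)
    - \sum_(clip (block_bound l.+1) (block_bound l) (natceil X) <= n <
            clip (block_bound l.+1) (block_bound l) (natceil Y)) cos (phase mu h n + c)|
    <= 2 * (2 + 2 / lam).
Proof.
move=> lh lam0 XY hX hY; have ab := block_bound_le lh.
have hblock := block_theta lh.
set a := block_bound l.+1 in hX hY ab hblock *; set b := block_bound l in hX hY ab hblock *.
set p := clip _ _ _; set r := clip _ _ _.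
have /andP[ap pb] : (a <= p <= b)%N by exact: clip_ge.
have /andP[ar rb] : (a <= r <= b)%N by exact: clip_ge.
have pr : (p <= r)%N by exact/clip_mono/natceil_mono.
rewrite (big_cat_nat ap pb)/= (big_cat_nat pr rb)/= addrCA addrAC subrr add0r.
rewrite (le_trans (ler_normD _ _))// mulrDl mul1r.
have inp n : (a <= n < p)%N -> (a <= n < b)%N by move=> /andP[-> np]; rewrite (leq_trans np).
have inr n : (r <= n < b)%N -> (a <= n < b)%N by move=> /andP[rn ->]; rewrite (leq_trans ar).
apply: lerD.
- apply: (@kl_side _ _ _ mu0 h0 l) => //.
    by move=> n /inp/hblock[].
  left=> n hn; have [_ /andP[_ h2]] := hblock n (inp n hn).
  rewrite hX ?inp//=; first by lra.
  by rewrite -ltn_natceil; move: hn; rewrite /p /clip; lia.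
- apply: (@kl_side _ _ _ mu0 h0 l) => //.
    by move=> n /inr/hblock[].
  right=> n hn; have [_ /andP[h2 _]] := hblock n (inr n hn).
  rewrite hY ?inr//=; first by lra.
  by rewrite -natceil_le; move: hn; rewrite /r /clip; lia.
Qed.

(** The window has angular half-width [tau = (mu h)^(-1/2)]. It contains about [2 mu tau = 2 rho]
    points, and outside it Kusmin-Landau gives [2 / (2 h tau) = rho], so the two costs balance. *)
Lemma block_trivial l (c : R) : h%:R <= mu -> (l.*2 <= h)%N ->
  `|\sum_(block_bound l.+1 <= n < block_bound l) cos (phase mu h n + c)|
    <= 10 * Num.sqrt (mu / h%:R).
Proof.
move=> hmu lh; set rho := Num.sqrt _.
have muh0 : 0 < mu / h%:R by rewrite divr_gt0.
have rho0 : 0 < rho by rewrite sqrtr_gt0.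
have rho2 : rho ^+ 2 = mu / h%:R by rewrite sqr_sqrtr// ltW.
have rho1 : 1 <= rho.
  by rewrite -sqrtr1 ler_wsqrtr// ler_pdivlMr// mul1r.
pose tau := rho / mu.
have tau0 : 0 < tau by rewrite divr_gt0.
have tau2 : 0 < 2 * tau by rewrite pmulr_rgt0.
have mutau : mu * tau = rho by rewrite /tau mulrC divfK// lt0r_neq0.
have htau : h%:R * tau * rho = 1.
  rewrite (_ : _ * _ = h%:R * rho ^+ 2 / mu); last by rewrite /tau; ring.
  by rewrite rho2; field; rewrite !lt0r_neq0.
have tau1 : h%:R * tau <= 1.
  by rewrite -[leRHS]htau ler_peMr// mulr_ge0// ltW.
pose vt := pi * l%:R / h%:R : R.
have lr : (2 * l%:R : R) <= h%:R by rewrite -natrM mul2n ler_nat.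
have hvt : h%:R * vt = pi * l%:R by rewrite /vt mulrC divfK// lt0r_neq0.
have vt0 : 0 <= vt by rewrite divr_ge0// mulr_ge0// ltW.
have vt1 : vt <= pi / 2 by rewrite ler_pdivrMr// mulrAC -mulrA ler_pM2l//; lra.
have pi2 := pi_ge2 R.
have tau_le1 : tau <= 1 by rewrite (le_trans _ tau1)// ler_peMl// ltW.
have vtau : 0 <= vt + tau <= pi by apply/andP; split; lra.
have lam0 : 0 < 2 * h%:R * tau by rewrite mulr_gt0// mulr_gt0.
have lamE : 2 / (2 * h%:R * tau) = rho.
  apply: (mulIf (lt0r_neq0 lam0)); rewrite divfK ?lt0r_neq0//.
  have -> : rho * (2 * h%:R * tau) = 2 * (h%:R * tau * rho) by ring.
  by rewrite htau mulr1.
pose X := mu * cos (vt + tau).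
(* For [l = 0] the stationary point is the right end [mu] of the range, and [Y] is set past all
   columns so that nothing remains on that side. *)
pose Y := if (0 < l)%N then mu * cos (vt - tau) else (Num.trunc mu).+1%:R.
have vtl : (0 < l)%N -> tau <= vt.
  move=> l0; rewrite -(ler_pM2l hr) hvt (le_trans tau1)//.
  have : (1 : R) <= l%:R by rewrite ler1n.
  nra.
have tm := truncnS_gt mu; have tm' : (Num.trunc mu)%:R <= mu by rewrite truncn_le ltW.
have [Y0 XY XYw] : [/\ 0 <= Y, X <= Y & Y - X <= 2 * rho + 1].
  rewrite /X /Y; have [l0|l0] := posnP l.
    have vt00 : vt = 0 by rewrite /vt l0 mulr0 mul0r.
    rewrite vt00 add0r; split=> //.
      by rewrite (le_trans _ (ltW tm))// -[leRHS]mulr1 ler_pM2l// cos_le1.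
    have := norm_cosB_le 0 tau; rewrite cos0 subr0 (gtr0_norm tau0) distrC => /(le_trans (ler_norm _)).
    rewrite -(ler_pM2l mu0) mutau -natr1; lra.
  have tvt := vtl l0; split.
  - by rewrite mulr_ge0 ?(ltW mu0)// cos_ge0_pihalf//; apply/andP; split; lra.
  - by rewrite ler_pM2l//; apply: cos_le; lra.
  - have := norm_cosB_le (vt + tau) (vt - tau); rewrite (_ : vt - tau - (vt + tau) = - (2 * tau)); last by ring.
    rewrite normrN (gtr0_norm tau2) => /(le_trans (ler_norm _)).
    by rewrite -(ler_pM2l mu0) mulrCA mutau; lra.
have hbl := block_theta lh.
have := @block_split l X Y _ c lh lam0 XY; rewrite lamE.
set S := \sum_(_ <= _ < _) _; set T := \sum_(_ <= _ < _) _ => hS.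
have hT : `|T| <= 2 * rho + 2.
  rewrite (le_trans (norm_sum_nat_le _))//; first by move=> n _; exact: cos_max.
  have : (clip (block_bound l.+1) (block_bound l) (natceil Y) - clip (block_bound l.+1) (block_bound l) (natceil X))%:R
    <= (natceil Y - natceil X)%:R :> R by rewrite ler_nat clip_width.
  have := natceil_width X Y0; rewrite max_r ?subr_ge0//; lra.
have {hS} : `|S - T| <= 2 * (2 + rho).
  apply: hS => n hn.
    have [nmu /andP[n1 n2]] := hbl n hn.
    rewrite ltNge /X -theta_le// -ltNge => /ltW; rewrite -(ler_pM2l hr) mulrDr hvt; lra.
  have [nmu /andP[n1 n2]] := hbl n hn.
  rewrite /Y; have [l0|l0] := posnP l.
    by move=> /(lt_le_trans tm); rewrite ltNge nmu.
  rewrite -theta_le//; last by have tvt := vtl l0; apply/andP; split; lra.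
  by rewrite -(ler_pM2l hr) mulrBr hvt; lra.
rewrite ler_norml => /andP[h1 h2]; move: hT; rewrite !ler_norml => /andP[h3 h4].
by apply/andP; split; lra.
Qed.

Lemma sum_blocks (u : nat -> R) :
  \sum_(0 <= n < (Num.trunc mu).+1) u n
  = \sum_(0 <= l < h./2.+1) \sum_(block_bound l.+1 <= n < block_bound l) u n.
Proof.
have hh : (h./2.*2 <= h)%N by rewrite -[leqRHS]odd_double_half leq_addl.
have hh' : (h <= h./2.*2.+1)%N.
  by rewrite -[leqLHS]odd_double_half -add1n leq_add2r; case: odd.
rewrite -big_nat_blocks; first by rewrite (block_bound_last hh hh').
move=> l; rewrite ltnS => lh; apply: block_bound_le.
by rewrite (leq_trans _ hh)// leq_double.
Qed.

Lemma phase_sum_trivial (c : R) : h%:R <= mu ->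
  `|\sum_(0 <= n < (Num.trunc mu).+1) cos (phase mu h n + c)|
    <= 10 * h%:R * Num.sqrt (mu / h%:R).
Proof.
move=> hmu; rewrite sum_blocks (le_trans (ler_norm_sum _ _ _))//.
have hh : (h./2.*2 <= h)%N by rewrite -[leqRHS]odd_double_half leq_addl.
rewrite (@le_trans _ _ (\sum_(0 <= l < h./2.+1) (10 * Num.sqrt (mu / h%:R))))//.
  apply: ler_sum_nat => l /andP[_]; rewrite ltnS => lh; apply: block_trivial => //.
  by rewrite (leq_trans _ hh)// leq_double.
rewrite sumr_const_nat subn0 -[leLHS]mulr_natl mulrA [_ * 10]mulrC.
rewrite ler_wpM2r ?sqrtr_ge0// ler_pM2l// ler_nat.
by rewrite -[leqRHS]odd_double_half; move: h0; rewrite -{1}[h]odd_double_half; case: odd => /=; lia.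
Qed.

End blocks.

Definition stat_angle (R : realType) (h l : nat) : R := pi * l%:R / h%:R.
(** The square is half the second derivative of the phase at its stationary point
    [mu cos (stat_angle R h l)]; near it the phase is a constant plus the square of [stat_scale]
    times the distance, up to multiples of [2 pi]. *)
Definition stat_scale {R : realType} (mu : R) (h l : nat) : R :=
  Num.sqrt (h%:R / (mu * sin (stat_angle R h l))).

Lemma block_bound_pred {R : realType} (mu : R) (h l : nat) : (0 < l)%N ->
  block_bound mu h l = natceil (mu * cos (pi * (l.-1%:R + 1 / 2) / h%:R)).
Proof. by case: l. Qed.

(** * A block with an interior stationary point, as a Fresnel integral *)

Section fine_block.
Context {R : realType}.

Lemma sin_mono (x y : R) : 0 <= x -> x <= y -> y <= pi / 2 -> sin x <= sin y.
Proof.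
move=> x0 xy ypi; have : cos (pi / 2 - x) <= cos (pi / 2 - y).
  by apply: cos_le; have := pi_gt0 R; lra.
by rewrite !cosB cos_pihalf sin_pihalf !mul0r !mul1r !add0r.
Qed.

Lemma sin_half_ge (x : R) : 0 <= x <= pi -> sin x <= 2 * sin (x / 2).
Proof.
move=> /andP[x0 xpi]; rewrite sin_double -[leRHS]mulr1 ler_wpM2l ?cos_le1// mulr_ge0//.
by apply: sin_ge0_pihalf; apply/andP; split; lra.
Qed.

(* With [x = mu cos t] the left side is the error in replacing the phase by its
   second order Taylor polynomial in [x] at the stationary point [mu cos v]. *)
Lemma quadratic_phase_error (v t : R) : 0 < sin v ->
  (forall x, (v <= x <= t) || (t <= x <= v) -> 0 <= sin x <= 2 * sin v) ->
  `|2 * (sin t - sin v - (t - v) * cos t) - (cos t - cos v) ^+ 2 / sin v|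
    <= 4 * `|t - v| ^+ 3.
Proof.
move=> s0 hs; set s := sin v in s0 hs *.
pose G x := 2 * (sin x - s - (x - v) * cos x) - (cos x - cos v) ^+ 2 / s.
have Gv : G v = 0 by rewrite /G /s !subrr mul0r subr0 expr0n/= mul0r mulr0 subr0.
have -> : 2 * (sin t - s - (t - v) * cos t) - (cos t - cos v) ^+ 2 / s = G t - G v.
  by rewrite Gv subr0.
rewrite exprSr mulrA.
(* The second factor is the first order Taylor remainder of [cos] at [v], hence quadratic in
   [x - v]; one more mean value step makes the error cubic. *)
pose dG x := 2 * (sin x / s) * (cos x - cos v + (x - v) * s).
apply: (@mvt_norm_le _ G dG) => x xb.
  apply: isd_eq; first by rewrite /G; isd.
  by rewrite /dG /=; field; rewrite lt0r_neq0.
rewrite /dG normrM; have /andP[sx0 sx2] := hs x xb.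
rewrite ler_pM//.
  rewrite ger0_norm; last by rewrite mulr_ge0// divr_ge0// ltW.
  by rewrite (_ : 4 = 2 * 2 :> R) ?ler_pM2l// ?ler_pdivrMr//; ring.
rewrite (le_trans (norm_cosB_taylor _ _))//.
rewrite -(real_normK (num_real (x - v))) ler_pXn2r ?nnegrE//.
by move: xb => /orP[]/andP[h1 h2]; [rewrite !ger0_norm|rewrite !ler0_norm]; lra.
Qed.

Lemma sin_near (v x : R) : 0 < v <= pi / 2 -> v / 2 <= x <= v + v / 2 -> x <= pi / 2 ->
  0 <= sin x <= 2 * sin v.
Proof.
move=> /andP[v0 vpi] /andP[x1 x2] xpi.
rewrite sin_ge0_pihalf/=; last by apply/andP; split; lra.
rewrite (le_trans (sin_half_ge _))//; first by apply/andP; split; lra.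
by rewrite ler_pM2l//; apply: sin_mono; lra.
Qed.

Lemma cosB_near_le (v t : R) : 0 < v <= pi / 2 -> v / 2 <= t <= v + v / 2 -> t <= pi / 2 ->
  `|cos t - cos v| <= 2 * sin v * `|t - v|.
Proof.
move=> hv ht tpi; apply: (@mvt_norm_le _ _ (fun x => - sin x)) => x xb; first exact: isd_cos0.
rewrite normrN; have /andP[? ?] := hv; have /andP[? ?] := ht.
have /andP[s0 s1] : 0 <= sin x <= 2 * sin v.
  by apply: sin_near => //; [apply/andP; split|]; move: xb => /orP[]/andP[? ?]; lra.
by rewrite ger0_norm.
Qed.

(** In the product formula the midpoint is at least [3 v / 4], so concavity gives its sine the
    factor 3/4; the other sine is at least [|t - v| / 4]. Together [2 * 3/4 * 1/4 = 3/8]. *)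
Lemma cosB_near_ge (v t : R) : 0 < v <= pi / 2 -> v / 2 <= t <= v + v / 2 -> t <= pi / 2 ->
  3 / 8 * sin v * `|t - v| <= `|cos t - cos v|.
Proof.
move=> /andP[v0 vpi] /andP[t1 t2] tpi.
have h1 : 3 / 4 * sin v <= sin ((t + v) / 2).
  rewrite (@le_trans _ _ (sin (3 / 4 * v)))//.
    by apply: sin_concave; apply/andP; split; lra.
  by apply: sin_mono; lra.
have h2 : `|t - v| / 4 <= `|sin ((v - t) / 2)|.
  have [tv|/ltW tv] := leP t v.
    have hx : 0 <= (v - t) / 2 <= pi / 2 by apply/andP; split; lra.
    have := sin_ge_half hx; rewrite ler0_norm; last by lra.
    by rewrite ger0_norm; [lra|exact: sin_ge0_pihalf].
  have hx : 0 <= (t - v) / 2 <= pi / 2 by apply/andP; split; lra.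
  have := sin_ge_half hx; rewrite ger0_norm; last by lra.
  rewrite (_ : (v - t) / 2 = - ((t - v) / 2)); last by ring.
  by rewrite sinN normrN ger0_norm; [lra|exact: sin_ge0_pihalf].
have s0 : 0 <= sin v by apply: sin_ge0_pihalf; apply/andP; split; lra.
rewrite cosB_prod !normrM (ger0_norm (_ : 0 <= 2))//.
rewrite (_ : 3 / 8 * _ * _ = 2 * (3 / 4 * sin v) * (`|t - v| / 4)); last by field.
apply: ler_pM; [lra|by rewrite divr_ge0|rewrite ler_pM2l//|exact: h2].
by rewrite (le_trans h1)// ler_norm.
Qed.

Variables (mu : R) (h l : nat) (r : R).
Hypothesis mu1 : 1 <= mu.
Hypothesis l0 : (0 < l)%N.
Hypothesis lh : (l.*2 < h)%N.
Hypothesis r1 : 1 <= r.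
Hypothesis hr_mu : 16 * r ^+ 2 * h%:R ^+ 2 <= mu.

Local Notation vt := (stat_angle R h l).
Local Notation sv := (sin vt).
Local Notation sg := (stat_scale mu h l).
Local Notation wd := (r / sg).

Let mu0 : 0 < mu. Proof. exact: lt_le_trans mu1. Qed.
Let h0 : (0 < h)%N. Proof. by rewrite (leq_ltn_trans _ lh). Qed.
Let hr : (0 : R) < h%:R. Proof. by rewrite ltr0n. Qed.
Let pi0 := pi_gt0 R.
Let pi2 := pi_ge2 R.
Let r0 : 0 < r. Proof. exact: lt_le_trans r1. Qed.

Lemma vt_bounds : [/\ 0 < vt, vt <= pi / 2, vt + pi / (2 * h%:R) <= pi / 2 &
   pi / (2 * h%:R) <= vt / 2].
Proof.
have l1 : (1 : R) <= l%:R by rewrite ler1n.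
have lh' : 2 * l%:R + 1 <= h%:R :> R by rewrite -natrM mul2n -[1]/(1%:R) -natrD ler_nat addn1.
have e1 : 0 < pi / (2 * h%:R) :> R by rewrite divr_gt0// mulr_gt0.
have e2 : vt + pi / (2 * h%:R) <= pi / 2.
  rewrite /stat_angle (_ : _ + _ = pi / 2 * ((2 * l%:R + 1) / h%:R)); last by field; rewrite lt0r_neq0.
  by rewrite -[leRHS]mulr1 ler_pM2l ?divr_gt0// ler_pdivrMr// mul1r.
split=> //; rewrite ?/stat_angle.
- by rewrite divr_gt0// mulr_gt0// ltr0n.
- by move: e2; rewrite /stat_angle; lra.
- rewrite (_ : pi * _ / _ / 2 = pi / (2 * h%:R) * l%:R); last by field; rewrite lt0r_neq0.
  by rewrite ler_peMr// ltW.
Qed.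

Lemma sv_bounds : [/\ 0 < sv, sv <= 1 & 1 <= h%:R * sv].
Proof.
have [v0 vpi _ v2] := vt_bounds.
have vh : vt / 2 <= sv by apply: sin_ge_half; rewrite (ltW v0).
have s0 : 0 < sv by rewrite (lt_le_trans _ vh)// divr_gt0.
split=> //.
rewrite (@le_trans _ _ (h%:R * (pi / (2 * h%:R))))//; last by rewrite ler_pM2l// (le_trans v2).
by rewrite (_ : _ * _ = pi / 2); [have := pi2; lra|field; rewrite lt0r_neq0].
Qed.

(** As [h sin vt >= 1], the squared scale is at most [h^2 / mu]; the hypothesis [16 r^2 h^2 <= mu]
    then makes [r * sg] at most 1/4. *)
Lemma sg_bounds : [/\ 0 < sg, sg <= 1, r * sg <= 1 / 4 & sg ^+ 2 = h%:R / (mu * sv)].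
Proof.
have [s0 s1 hs] := sv_bounds.
have q0 : 0 < h%:R / (mu * sv) by rewrite divr_gt0// mulr_gt0.
have sg0 : 0 < sg by rewrite sqrtr_gt0.
have sg2 : sg ^+ 2 = h%:R / (mu * sv) by rewrite sqr_sqrtr// ltW.
have rsg : r * sg <= 1 / 4.
  rewrite -(@ler_pXn2r _ 2)// ?nnegrE//; last by rewrite mulr_ge0// ltW.
  rewrite exprMn sg2 mulrA ler_pdivrMr ?mulr_gt0//.
  rewrite -(ler_pM2l (_ : 0 < 16 * h%:R))//; last by rewrite mulr_gt0.
  apply: (@le_trans _ _ mu).
    by rewrite (le_trans _ hr_mu)// le_eqVlt; apply/orP; left; apply/eqP; ring.
  rewrite [leRHS](_ : _ = mu * (h%:R * sv)); last by field.
  by rewrite ler_peMr// ltW.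
split=> //; rewrite (@le_trans _ _ (r * sg))//; first by rewrite ler_peMl// ltW.
by rewrite (le_trans rsg)//; lra.
Qed.

Lemma wd_bounds : [/\ 1 <= wd, wd <= mu * sv / (4 * h%:R), sg * wd = r &
  h%:R * wd / (mu * sv) = r * sg].
Proof.
have [s0 s1 hs] := sv_bounds; have [g0 g1 rg g2] := sg_bounds.
have e : sg * wd = r by rewrite  mulrC divfK// lt0r_neq0.
have e2 : h%:R * wd / (mu * sv) = r * sg.
  by rewrite mulrAC -g2 expr2 -mulrA e mulrC.
split=> //.
- by rewrite  ler_pdivlMr// mul1r (le_trans g1).
- move: rg; rewrite -e2 ler_pdivrMr ?mulr_gt0// ler_pdivlMr ?mulr_gt0//; lra.
Qed.

Let a := block_bound mu h l.+1.
Let b := block_bound mu h l.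

Lemma lh' : (l.*2 <= h)%N. Proof. exact: ltnW. Qed.

Lemma block_theta_vt n : (a <= n < b)%N ->
  [/\ n%:R <= mu, vt / 2 <= theta mu n, theta mu n <= vt + vt / 2 &
      0 <= theta mu n <= pi / 2].
Proof.
move=> /(block_theta mu1 h0 lh')[nmu /andP[h1 h2]].
have [v0 vpi vp v2] := vt_bounds.
have hv : h%:R * vt = pi * l%:R by rewrite /stat_angle mulrC divfK// lt0r_neq0.
have ph : h%:R * (pi / (2 * h%:R)) = pi / 2 :> R by field; rewrite lt0r_neq0.
have v2h : h%:R * (pi / (2 * h%:R)) <= h%:R * (vt / 2) by rewrite ler_pM2l.
rewrite ph in v2h; have tn := theta_itv mu0 nmu; split=> //.
  by rewrite -(ler_pM2l hr); lra.
by rewrite -(ler_pM2l hr); lra.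
Qed.

(** The window lies inside the block. The cut angles are [vt] plus and minus [pi / (2 h)]; by the
    product formula the cuts are at distance at least [3 mu sv / (8 h)] from the centre, more than
    the half-width [wd <= mu sv / (4 h)]. *)
Lemma block_window :
  mu * cos (pi * (l%:R + 1 / 2) / h%:R) <= mu * cos vt - wd /\
  mu * cos vt + wd <= mu * cos (pi * (l.-1%:R + 1 / 2) / h%:R).
Proof.
have [v0 vpi vp v2] := vt_bounds; have [s0 s1 hs] := sv_bounds.
have [w1 w2 _ _] := wd_bounds.
have e1 : pi * (l%:R + 1 / 2) / h%:R = vt + pi / (2 * h%:R) by rewrite /stat_angle; field; rewrite lt0r_neq0.
have e2 : pi * (l.-1%:R + 1 / 2) / h%:R = vt - pi / (2 * h%:R).
  have -> : l.-1%:R = l%:R - 1 :> R by rewrite -{2}(prednK l0) -natr1 addrK.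
  by rewrite /stat_angle; field; rewrite lt0r_neq0.
rewrite e1 e2; set q := pi / (2 * h%:R) in vp v2 *.
have q0 : 0 < q by rewrite divr_gt0// mulr_gt0.
have sq : pi / (8 * h%:R) <= sin (q / 2).
  have -> : pi / (8 * h%:R) = q / 2 / 2 by rewrite /q; field; rewrite lt0r_neq0.
  by apply: sin_ge_half; apply/andP; split; lra.
have p8 : 1 / (4 * h%:R) <= pi / (8 * h%:R) :> R.
  rewrite ler_pdivrMr ?mulr_gt0// [leRHS](_ : _ = pi / 2); [have := pi2; lra|field; rewrite lt0r_neq0//].
have p80 : 0 < 1 / (4 * h%:R) :> R by rewrite divr_gt0// mulr_gt0.
have key x : 3 / 4 * sv <= x -> wd <= mu * (2 * x * sin (q / 2)).
  move=> hx; rewrite (le_trans w2)//.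
  rewrite (@le_trans _ _ (mu * (2 * (3 / 4 * sv) * (1 / (4 * h%:R)))))//.
    rewrite [leRHS](_ : _ = mu * sv / (4 * h%:R) * (3 / 2)); last by field; rewrite lt0r_neq0.
    by rewrite ler_peMr ?divr_ge0 ?mulr_ge0 ?(ltW mu0) ?(ltW s0)//; lra.
  rewrite ler_pM2l//; apply: ler_pM; [lra|exact: ltW|by rewrite ler_pM2l|].
  exact: le_trans sq.
split.
- rewrite lerBrDr -lerBrDl -mulrBr cosB_prod.
  have -> : (vt + q - vt) / 2 = q / 2 by ring.
  apply: key; rewrite (@le_trans _ _ sv)//; first lra.
  by apply: sin_mono; lra.
- rewrite -lerBrDl -mulrBr cosB_prod.
  have -> : (vt - (vt - q)) / 2 = q / 2 by ring.
  apply: key; rewrite (@le_trans _ _ (sin (3 / 4 * vt)))//.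
    by apply: sin_concave; apply/andP; split; lra.
  by apply: sin_mono; lra.
Qed.

End fine_block.

(** In the window [|t - vt| <= 3 r sg / h], so the cubic error is at most [4 h mu * 27 (r sg / h)^3
    = 108 sg r^3 * (mu sg^2 / h^2)], and the last factor is [1 / (h sv) <= 1]. The term [2 pi l n]
    cancels the linear part of the phase. *)
Lemma window_phase {R : realType} (mu : R) (h l n : nat) (r : R) : 1 <= mu ->
  (0 < l)%N -> (l.*2 < h)%N -> 1 <= r -> 16 * r ^+ 2 * h%:R ^+ 2 <= mu ->
  (block_bound mu h l.+1 <= n < block_bound mu h l)%N ->
  `|n%:R - mu * cos (stat_angle R h l)| <= r / stat_scale mu h l ->
  `|phase mu h n + 2 * pi * (l * n)%:R - 2 * h%:R * mu * sin (stat_angle R h l)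
     - (stat_scale mu h l * (n%:R - mu * cos (stat_angle R h l))) ^+ 2|
    <= 108 * stat_scale mu h l * r ^+ 3.
Proof.
move=> mu1 l0 lh r1 hr_mu hn hw.
have mu0 : 0 < mu by exact: lt_le_trans mu1.
have h0 : (0 < h)%N by rewrite (leq_ltn_trans _ lh).
have hr : (0 : R) < h%:R by rewrite ltr0n.
have pi0 := pi_gt0 R; have pi2 := pi_ge2 R.
have r0 : 0 < r by exact: lt_le_trans r1.
have [v0 vpi vp v2] := @vt_bounds R h l l0 lh; have [s0 s1 hs] := @sv_bounds R h l l0 lh.
have [g0 g1 rg g2] := sg_bounds mu1 l0 lh r1 hr_mu.
have [w1 w2 w3 w4] := wd_bounds mu1 l0 lh r1 hr_mu.
have btv := block_theta_vt mu1 l0 lh.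
set vt := stat_angle R h l in v0 vpi vp v2 s0 s1 hs g2 w2 w4 btv hw *.
set sv := sin vt in s0 s1 hs g2 w2 w4 *.
set sg := stat_scale mu h l in g0 g1 rg g2 w1 w2 w3 w4 hw *.
set wd := r / sg in w1 w2 w3 w4 hw *.
have [nmu t1 t2 /andP[t0 tpi]] := btv n hn.
have nE := mu_cos_theta mu0 nmu.
set t := theta mu n in t0 t1 t2 tpi nE *.
have ct : `|cos t - cos vt| <= wd / mu.
  by rewrite ler_pdivlMr// (le_trans _ hw)// -nE -mulrBr normrM (gtr0_norm mu0) mulrC.
have vt2 : 0 < vt <= pi / 2 by rewrite v0.
have tv : vt / 2 <= t <= vt + vt / 2 by rewrite t1.
have d_le : `|t - vt| <= 3 * (r * sg / h%:R).
  have := le_trans (cosB_near_ge vt2 tv tpi) ct; rewrite -/sv.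
  rewrite -(ler_pM2r mu0) divfK ?lt0r_neq0// => h3.
  have -> : r * sg / h%:R = wd / (mu * sv).
    by rewrite -w4; field; rewrite !lt0r_neq0.
  rewrite mulrA ler_pdivlMr ?mulr_gt0//.
  have : 0 <= `|t - vt| * (mu * sv) by rewrite mulr_ge0// mulr_ge0 ?ltW.
  move: h3; clear; lra.
have err := @quadratic_phase_error R vt t s0.
have hbetween x : (vt <= x <= t) || (t <= x <= vt) -> 0 <= sin x <= 2 * sin vt.
  move=> hx; apply: sin_near => //.
    by move: hx v0 t1 t2; clear; move=> /orP[]/andP[? ?] ? ? ?; apply/andP; split; lra.
  by move: hx tpi vpi; clear; move=> /orP[]/andP[? ?] ? ?; lra.
have {}err := err hbetween; rewrite -/sv in err.
have -> : phase mu h n + 2 * pi * (l * n)%:R - 2 * h%:R * mu * sv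
     - (sg * (n%:R - mu * cos vt)) ^+ 2
   = h%:R * mu * (2 * (sin t - sin vt - (t - vt) * cos t) - (cos t - cos vt) ^+ 2 / sv).
  rewrite exprMn g2 natrM -{1 2}nE /phase -/t -/sv.
  have -> : 2 * pi * (l%:R * (mu * cos t)) = 2 * h%:R * vt * (mu * cos t).
    by rewrite /vt /stat_angle; field; rewrite lt0r_neq0.
  by field; rewrite !lt0r_neq0.
rewrite normrM gtr0_norm ?mulr_gt0//.
apply: (@le_trans _ _ (h%:R * mu * (4 * (3 * (r * sg / h%:R)) ^+ 3))).
  rewrite ler_pM2l ?mulr_gt0// (le_trans err)// ler_pM2l// ler_pXn2r ?nnegrE//.
  by rewrite mulr_ge0// divr_ge0 ?mulr_ge0// ltW.
have -> : h%:R * mu * (4 * (3 * (r * sg / h%:R)) ^+ 3)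
  = 108 * sg * r ^+ 3 * (mu * sg ^+ 2 / h%:R ^+ 2) by field; rewrite !lt0r_neq0.
have -> : mu * sg ^+ 2 / h%:R ^+ 2 = (h%:R * sv)^-1 by rewrite g2; field; rewrite !lt0r_neq0.
rewrite ler_piMr ?mulr_ge0 ?exprn_ge0 ?(ltW g0) ?(ltW r0)// invf_le1//.
exact: lt_le_trans hs.
Qed.

(** The error has three sources: Kusmin-Landau with [lam = r * sg] outside the window; the cubic
    phase error, [108 sg r^3] for each of at most [3 r / sg] points, that is [324 r^4]; and two
    Riemann sums at [14 r^4] each. *)
Lemma block_fine {R : realType} (mu : R) (h l : nat) (r : R) (Phic Phis : R -> R) (c : R) :
  1 <= mu -> (0 < l)%N -> (l.*2 < h)%N -> 1 <= r -> 16 * r ^+ 2 * h%:R ^+ 2 <= mu ->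
  (forall u, `|u| < r + 2 -> has_deriv Phic u (cos (u ^+ 2))) ->
  (forall u, `|u| < r + 2 -> has_deriv Phis u (sin (u ^+ 2))) ->
  `|\sum_(block_bound mu h l.+1 <= n < block_bound mu h l) cos (phase mu h n + c)
    - ((Phic r - Phic (- r)) / stat_scale mu h l
         * cos (2 * h%:R * mu * sin (stat_angle R h l) + c)
       - (Phis r - Phis (- r)) / stat_scale mu h l
         * sin (2 * h%:R * mu * sin (stat_angle R h l) + c))|
    <= 4 + 4 / (r * stat_scale mu h l) + 352 * r ^+ 4.
Proof.
move=> mu1 l0 lh r1 hr_mu dPhic dPhis.
have mu0 : 0 < mu by exact: lt_le_trans mu1.
have h0 : (0 < h)%N by rewrite (leq_ltn_trans _ lh).
have hr : (0 : R) < h%:R by rewrite ltr0n.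
have pi0 := pi_gt0 R; have pi2 := pi_ge2 R.
have r0 : 0 < r by exact: lt_le_trans r1.
have [v0 vpi vp v2] := @vt_bounds R h l l0 lh; have [s0 s1 hs] := @sv_bounds R h l l0 lh.
have [g0 g1 rg g2] := sg_bounds mu1 l0 lh r1 hr_mu.
have [w1 w2 w3 w4] := wd_bounds mu1 l0 lh r1 hr_mu.
have btv := block_theta_vt mu1 l0 lh.
have [bw1 bw2] := block_window mu1 l0 lh r1 hr_mu.
have wph n := @window_phase R mu h l n r mu1 l0 lh r1 hr_mu.
set vt := stat_angle R h l in v0 vpi vp v2 s0 s1 hs g2 w2 w4 btv bw1 bw2 wph *.
set sv := sin vt in s0 s1 hs g2 w2 w4 *.
set sg := stat_scale mu h l in g0 g1 rg g2 w1 w2 w3 w4 bw1 bw2 wph *.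
set wd := r / sg in w1 w2 w3 w4 bw1 bw2 wph *.
set a := block_bound mu h l.+1 in btv wph *; set b := block_bound mu h l in btv wph *.
set x0 := mu * cos vt in bw1 bw2.
have w0 : 0 <= wd by rewrite (le_trans _ w1).
have XY : x0 - wd <= x0 + wd by rewrite lerD2l ge0_cp.
have lam0 : 0 < r * sg by rewrite mulr_gt0.
have hp1 : forall n, (a <= n < b)%N -> n%:R < x0 - wd ->
    r * sg <= 2 * (h%:R * theta mu n - pi * l%:R).
  move=> n hn nX; have [nmu t1 t2 /andP[t0 tpi]] := btv n hn.
  have nE := mu_cos_theta mu0 nmu; set t := theta mu n in t0 t1 t2 tpi nE *.
  have hct : wd <= mu * (cos vt - cos t) by rewrite mulrBr nE -/x0; move: nX; clear; lra.
  have vt_t : vt <= t.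
    rewrite leNgt; apply/negP => tv; have : cos vt <= cos t.
      by apply: cos_le; rewrite ?(ltW tv)//; move: vpi pi0; clear; lra.
    rewrite -(ler_pM2l mu0); move: hct w1; rewrite mulrBr; clear; lra.
  have vt2 : 0 < vt <= pi / 2 by rewrite v0.
  have tv : vt / 2 <= t <= vt + vt / 2 by rewrite t1.
  have : mu * (cos vt - cos t) <= mu * (2 * sv * (t - vt)).
    rewrite ler_pM2l//; have := cosB_near_le vt2 tv tpi; rewrite (ger0_norm (_ : 0 <= t - vt)) ?subr_ge0//.
    by rewrite distrC; apply: le_trans; exact: ler_norm.
  move=> /(le_trans hct) hw.
  rewrite -w4 ler_pdivrMr ?mulr_gt0//.
  rewrite -(ler_pM2l hr) in hw.
  rewrite (le_trans hw)// le_eqVlt; apply/orP; left; apply/eqP.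
  by rewrite /vt /stat_angle; field; rewrite lt0r_neq0.
have hp2 : forall n, (a <= n < b)%N -> x0 + wd <= n%:R ->
    r * sg <= 2 * (pi * l%:R - h%:R * theta mu n).
  move=> n hn nY; have [nmu t1 t2 /andP[t0 tpi]] := btv n hn.
  have nE := mu_cos_theta mu0 nmu; set t := theta mu n in t0 t1 t2 tpi nE *.
  have hct : wd <= mu * (cos t - cos vt) by rewrite mulrBr nE -/x0; move: nY; clear; lra.
  have vt_t : t <= vt.
    rewrite leNgt; apply/negP => tv; have : cos t <= cos vt.
      by apply: cos_le; rewrite ?(ltW tv) ?(ltW v0)//; move: tpi pi0; clear; lra.
    rewrite -(ler_pM2l mu0); move: hct w1; rewrite mulrBr; clear; lra.
  have vt2 : 0 < vt <= pi / 2 by rewrite v0.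
  have tv : vt / 2 <= t <= vt + vt / 2 by rewrite t1.
  have : mu * (cos t - cos vt) <= mu * (2 * sv * (vt - t)).
    rewrite ler_pM2l//; have := cosB_near_le vt2 tv tpi.
    rewrite (ler0_norm (_ : t - vt <= 0)) ?subr_le0// opprB.
    by apply: le_trans; exact: ler_norm.
  move=> /(le_trans hct) hw.
  rewrite -w4 ler_pdivrMr ?mulr_gt0//.
  rewrite -(ler_pM2l hr) in hw.
  rewrite (le_trans hw)// le_eqVlt; apply/orP; left; apply/eqP.
  by rewrite /vt /stat_angle; field; rewrite lt0r_neq0.
have split3 := @block_split _ mu h mu1 h0 l _ _ _ c (ltnW lh) lam0 XY hp1 hp2.
have aX : (a <= natceil (x0 - wd))%N by apply: natceil_mono.
have Yb : (natceil (x0 + wd) <= b)%N.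
  by rewrite /b (block_bound_pred _ _ l0); exact: natceil_mono.
have Xab := natceil_mono XY.
have clip1 := clip_id aX (leq_trans Xab Yb).
have clip2 := clip_id (leq_trans aX Xab) Yb.
rewrite -/a -/b clip1 clip2 in split3.
set p := natceil (x0 - wd) in aX Xab clip1 split3; set q := natceil (x0 + wd) in Yb Xab clip2 split3.
have X0 : 0 <= x0 - wd.
  rewrite (le_trans _ bw1)// mulr_ge0 ?(ltW mu0)// cos_ge0_pihalf//.
  rewrite (_ : _ / h%:R = vt + pi / (2 * h%:R)); last by rewrite /vt /stat_angle; field; rewrite lt0r_neq0.
  have q0 : 0 < pi / (2 * h%:R) :> R by rewrite divr_gt0// mulr_gt0.
  by apply/andP; split=> //; move: pi0 v0 q0; clear; lra.
have p1 := natceil_ge (x0 - wd); have p2 := natceil_lt X0; rewrite -/p in p1 p2.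
have q1 := natceil_ge (x0 + wd); have q2 := natceil_lt (le_trans X0 XY); rewrite -/q in q1 q2.
have card : (q - p)%:R <= 3 * wd :> R by rewrite natrB//; move: p1 p2 q1 q2 w1; clear; lra.
have ra : - r <= sg * (p%:R - x0) <= - r + sg.
  rewrite -w3; apply/andP; split.
    by rewrite -mulrN ler_pM2l//; move: p1; clear; lra.
  by rewrite (_ : - _ + _ = sg * (1 - wd)); [rewrite ler_pM2l//; move: p2; clear; lra|ring].
have rb : r <= sg * (q%:R - x0) <= r + sg.
  rewrite -w3; apply/andP; split; first by rewrite ler_pM2l//; move: q1; clear; lra.
  by rewrite (_ : _ + sg = sg * (1 + wd)); [rewrite ler_pM2l//; move: q2; clear; lra|ring].
have g01 : 0 < sg <= 1 by rewrite g0.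
have RC := riemann_sum_le (@cos_max R) (@norm_cosB_le R) r1 g01 Xab dPhic ra rb.
have RS := riemann_sum_le (@sin_max R) (@norm_sinB_le R) r1 g01 Xab dPhis ra rb.
have rr : r <= r ^+ 4 by rewrite -{1}[r]expr1 ler_weXn2l.
have r2 : r ^+ 2 <= r ^+ 4 by rewrite ler_weXn2l.
have r41 : 1 <= r ^+ 4 by exact: le_trans rr.
have rie : 2 + (q - p)%:R * (sg * (2 * (r + 1))) <= 14 * r ^+ 4.
  have : (q - p)%:R * (sg * (2 * (r + 1))) <= 3 * wd * (sg * (2 * (r + 1))).
    by rewrite ler_wpM2r// mulr_ge0 ?(ltW g0)//; move: r0; clear; lra.
  rewrite (_ : 3 * wd * _ = 6 * (sg * wd) * (r + 1)); last by ring.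
  by rewrite w3; move: r1 rr r2 r41; clear; nra.
have {}RC := le_trans RC rie; have {}RS := le_trans RS rie.
set A := 2 * h%:R * mu * sv.
have win : `|\sum_(p <= n < q) cos (phase mu h n + c)
    - \sum_(p <= n < q) cos (A + c + (sg * (n%:R - x0)) ^+ 2)| <= 324 * r ^+ 4.
  rewrite -sumrB (le_trans (ler_norm_sum _ _ _))//.
  rewrite (@le_trans _ _ (\sum_(p <= n < q) (108 * sg * r ^+ 3)))//.
    apply: ler_sum_nat => n /andP[pn nq].
    rewrite -(cos_shift _ (l * n)) (le_trans (norm_cosB_le _ _))//.
    have hn : (a <= n < b)%N by rewrite (leq_trans aX)//= (leq_trans nq).
    have hw : `|n%:R - mu * cos vt| <= wd.
      rewrite -/x0 ler_norml; move: pn nq; rewrite natceil_le ltn_natceil; clear; move=> ? ?.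
      by apply/andP; split; lra.
    have := wph n hn hw; rewrite -/A -/x0.
    congr (`|_| <= _); ring.
  rewrite sumr_const_nat -[leLHS]mulr_natl.
  rewrite (@le_trans _ _ (3 * wd * (108 * sg * r ^+ 3)))//.
    by rewrite ler_wpM2r// !mulr_ge0 ?exprn_ge0 ?(ltW g0) ?(ltW r0).
  rewrite (_ : _ * _ = 324 * (sg * wd) * r ^+ 3); last by ring.
  by rewrite w3 [r ^+ 4]exprS mulrA.
have expand : \sum_(p <= n < q) cos (A + c + (sg * (n%:R - x0)) ^+ 2)
  = cos (A + c) * \sum_(p <= n < q) cos ((sg * (n%:R - x0)) ^+ 2)
   - sin (A + c) * \sum_(p <= n < q) sin ((sg * (n%:R - x0)) ^+ 2).
  by rewrite !mulr_sumr -sumrB; apply: eq_bigr => n _; rewrite cosD.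
have main : `|\sum_(p <= n < q) cos (A + c + (sg * (n%:R - x0)) ^+ 2)
   - ((Phic r - Phic (- r)) / sg * cos (A + c) - (Phis r - Phis (- r)) / sg * sin (A + c))|
   <= 28 * r ^+ 4.
  rewrite expand; set C := \sum_(_ <= _ < _) _ in RC *; set S := \sum_(_ <= _ < _) _ in RS *.
  rewrite (_ : _ - _ = cos (A + c) * (C - (Phic r - Phic (- r)) / sg)
     - sin (A + c) * (S - (Phis r - Phis (- r)) / sg)); last by ring.
  rewrite (le_trans (ler_normB _ _))// !normrM.
  have h1 : `|cos (A + c)| * `|C - (Phic r - Phic (- r)) / sg| <= 1 * (14 * r ^+ 4).
    by apply: ler_pM => //; exact: cos_max.
  have h2 : `|sin (A + c)| * `|S - (Phis r - Phis (- r)) / sg| <= 1 * (14 * r ^+ 4).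
    by apply: ler_pM => //; exact: sin_max.
  move: h1 h2; clear; lra.
have e4 : 2 * (2 + 2 / (r * sg)) = 4 + 4 / (r * sg) by rewrite mulrDr mulrA; congr (_ + _ / _); ring.
rewrite e4 in split3.
move: split3 win main; set U := \sum_(a <= n < b) _; set V := \sum_(p <= n < q) cos (phase _ _ _ + _).
set V' := \sum_(p <= n < q) _; set Z := _ - _ * sin _ => s1' s2' s3'.
rewrite (_ : U - Z = (U - V) + ((V - V') + (V' - Z))); last by ring.
rewrite (le_trans (ler_normD _ _))//.
have := ler_normD (V - V') (V' - Z); move: s1' s2' s3'; clear; lra.
Qed.

(** The largest [l] with [2 l < h] is [h.-1./2]. Only for even [h] is there one more block,
    [l = h / 2], whose stationary point is [n = 0]; it gets the trivial bound. *)
Lemma half_pred_facts h : (0 < h)%N ->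
  [/\ (h.-1./2.*2 < h)%N, (h./2 <= h.-1./2.+1)%N, (h./2.*2 <= h)%N,
      (h.-1./2 <= h./2)%N & (h.-1./2 <= h)%N].
Proof. by move=> h0; split; lia. Qed.

(** * Assembling the blocks into the dual sum *)

Section duality.
Context {R : realType}.
Variables (mu : R) (h : nat) (r B : R).
Hypothesis mu1 : 1 <= mu.
Hypothesis h0 : (0 < h)%N.
Hypothesis r1 : 1 <= r.
Hypothesis hr_mu : 16 * r ^+ 2 * h%:R ^+ 2 <= mu.
Hypothesis hB : forall (k : nat) (c : R), (k.*2 <= h.+1)%N ->
  `|\sum_(0 <= l < k) cos (2 * h%:R * mu * sin (pi * l%:R / h%:R) + c)| <= B.

Let hr : (0 : R) < h%:R. Proof. by rewrite ltr0n. Qed.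
Let mu0 : 0 < mu. Proof. exact: lt_le_trans mu1. Qed.

(** The amplitudes [sqrt (sin (pi l / h))] increase up to [l = h / 2] and stay below 1, so partial
    summation removes them. The added 1 pays for the term [l = 0], present in the hypothesis but
    absent here. *)
Lemma amplitude_sum (k : nat) (c : R) : (k.*2 < h)%N ->
  `|\sum_(1 <= l < k.+1) Num.sqrt (sin (pi * l%:R / h%:R)) *
      cos (2 * h%:R * mu * sin (pi * l%:R / h%:R) + c)| <= 2 * (B + 1).
Proof.
move=> kh.
have B0 : 0 <= B by apply: le_trans (hB 0 (leq0n _ : (0.*2 <= h.+1)%N)).
pose s l : R := sin (pi * l%:R / h%:R).
pose z l := cos (2 * h%:R * mu * s l + c).
pose S n := - \sum_(0 <= l < n) z l.+1.
have SS n : S n - S n.+1 = z n.+1 by rewrite /S big_nat_recr//=; ring.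
have -> : \sum_(1 <= l < k.+1) Num.sqrt (s l) * z l
    = \sum_(0 <= n < k) Num.sqrt (s n.+1) * (S n - S n.+1).
  by rewrite big_add1/=; apply: eq_bigr => n _; rewrite SS.
have pi0 := pi_gt0 R.
have angle l : (l.*2 <= h)%N -> 0 <= @pi R * l%:R / h%:R <= pi / 2.
  move=> lh; have lr : 2 * l%:R <= h%:R :> R by rewrite -natrM mul2n ler_nat.
  rewrite divr_ge0 ?mulr_ge0 ?(ltW pi0)//= ler_pdivrMr// mulrAC -mulrA ler_pM2l//; lra.
have sle n : (n < k)%N -> 0 <= Num.sqrt (s n.+1) <= 1.
  by move=> nk; rewrite sqrtr_ge0/= -[leRHS]sqrtr1 ler_wsqrtr// sin_le1.
have smono : monotone_below k (fun n => Num.sqrt (s n.+1)).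
  left=> n nk; apply: ler_wsqrtr; have n2h : (n.+2.*2 <= h)%N.
    by rewrite (leq_trans _ (ltnW kh))// leq_double.
  have /andP[_ a2] := angle _ n2h.
  apply: sin_mono => //; first by rewrite divr_ge0 ?mulr_ge0 ?(ltW pi0).
  by rewrite ler_pM2r ?invr_gt0// ler_pM2l// ler_nat.
have Sle n : (n <= k)%N -> `|S n| <= B + 1.
  move=> nk; have := hB c (_ : (n.+1.*2 <= h.+1)%N); rewrite big_nat_recl//.
  rewrite /S normrN; set w := cos _; set W := \sum_(_ <= _ < _) _ => hW.
  have : `|w| <= 1 by exact: cos_max.
  have : (n.+1.*2 <= h.+1)%N by rewrite doubleS ltnS (leq_ltn_trans _ kh)// leq_double.
  move=> /hW; rewrite !ler_norml => /andP[? ?] /andP[? ?]; apply/andP; split; lra.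
have := abel_sum_le ler01 sle smono Sle; by rewrite mulr1.
Qed.

(** The sine part of the stationary term is a cosine with [c] replaced by [c - pi / 2], so both
    parts are dual sums of the same kind; each has a Fresnel factor at most 5. The block [l = 0] and
    a possible block [l = h / 2] contribute [20 rho]. *)
Lemma phase_sum_dual (c : R) :
  `|\sum_(0 <= n < (Num.trunc mu).+1) cos (phase mu h n + c)|
    <= Num.sqrt (mu / h%:R) * (20 * (B + 2) + 4 * h%:R / r) + h%:R * (4 + 352 * r ^+ 4).
Proof.
set rho := Num.sqrt _.
have rho0 : 0 <= rho := sqrtr_ge0 _.
have r0 : 0 < r by exact: lt_le_trans r1.
have r4 : 0 <= r ^+ 4 by rewrite exprn_ge0// ltW.
have hmu : h%:R <= mu.
  rewrite (le_trans _ hr_mu)// (@le_trans _ _ (1 * h%:R ^+ 2))//.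
    by rewrite mul1r expr2 ler_peMl// ler1n.
  by rewrite ler_wpM2r ?sqr_ge0//; have := exprn_ege1 2 r1; lra.
have B0 : 0 <= B by apply: le_trans (hB 0 (leq0n _ : (0.*2 <= h.+1)%N)).
have r2 : `|r| < r + 2 by rewrite ger0_norm ?ltW//; lra.
have cc : continuous (fun u : R => cos (u ^+ 2)).
  move=> x; apply: continuous_comp; first exact: exprn_continuous.
  exact: continuous_cos.
have cs : continuous (fun u : R => sin (u ^+ 2)).
  move=> x; apply: continuous_comp; first exact: exprn_continuous.
  exact: continuous_sin.
have [Phic dPhic] := antiderivative_exists (r + 2) cc.
have [Phis dPhis] := antiderivative_exists (r + 2) cs.
have ur u : `|u| <= r -> `|u| < r + 2 by move=> /le_lt_trans; apply; lra.
have Jc : `|Phic r - Phic (- r)| <= 5.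
  apply: (@fresnel_bound R sin cos (@isd_sin0 R) (@sin_max R) (@cos_max R)) => // u /ur.
  exact: dPhic.
have Js : `|Phis r - Phis (- r)| <= 5.
  have dS (x : R) : has_deriv (fun y => - cos y) x (sin x).
    by apply: isd_eq; [isd|rewrite opprK].
  apply: (@fresnel_bound R (fun y => - cos y) sin dS _ (@sin_max R)) => // [x|u /ur].
    by rewrite normrN cos_max.
  exact: dPhis.
rewrite (sum_blocks mu1 h0).
pose m := (h.-1)./2.
have [mh h2m h2h mh2 mh1] := half_pred_facts h0; rewrite -/m in mh h2m mh2 mh1.
have mhr : m%:R <= h%:R :> R by rewrite ler_nat.
set D := fun l => \sum_(block_bound mu h l.+1 <= n < block_bound mu h l) cos (phase mu h n + c).
have D10 l : (l.*2 <= h)%N -> `|D l| <= 10 * rho by exact: block_trivial.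
pose A l := 2 * h%:R * mu * sin (pi * l%:R / h%:R).
pose E l := rho * Num.sqrt (sin (pi * l%:R / h%:R)) *
  ((Phic r - Phic (- r)) * cos (A l + c) - (Phis r - Phis (- r)) * cos (A l + (c - pi / 2))).
have DE l : (1 <= l < m.+1)%N -> `|D l - E l| <= 4 + 4 * rho / r + 352 * r ^+ 4.
  move=> /andP[l0 lm]; have lh : (l.*2 < h)%N by rewrite (leq_ltn_trans _ mh)// leq_double.
  have [s0 s1 hs] := @sv_bounds R h l l0 lh; rewrite /stat_angle in s0 s1 hs.
  have [g0 g1 rg g2] := sg_bounds mu1 l0 lh r1 hr_mu.
  have gE : (stat_scale mu h l)^-1 = rho * Num.sqrt (sin (pi * l%:R / h%:R)).
    apply: (mulfI (lt0r_neq0 g0)); rewrite divff ?lt0r_neq0//.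
    rewrite /rho -sqrtrM; last by rewrite divr_ge0// ltW.
    rewrite /stat_scale /stat_angle -sqrtrM; last by rewrite divr_ge0// mulr_ge0// ltW.
    rewrite (_ : _ * _ = 1) ?sqrtr1//.
    by field; rewrite !lt0r_neq0.
  have g_le : (stat_scale mu h l)^-1 <= rho.
    by rewrite gE ler_piMr// -[leRHS]sqrtr1 ler_wsqrtr.
  have := block_fine c mu1 l0 lh r1 hr_mu dPhic dPhis.
  rewrite -/(D l) /stat_angle -/(A l) gE.
  rewrite (_ : _ - _ * sin _ = E l); last first.
    by rewrite /E addrA cosBpihalf; ring.
  move=> /le_trans; apply; rewrite lerD2r lerD2l invfM.
  rewrite [leLHS](_ : _ = 4 * (stat_scale mu h l)^-1 / r); last by ring.
  by rewrite ler_pM2r ?invr_gt0// ler_pM2l.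
have E_le : `|\sum_(1 <= l < m.+1) E l| <= rho * (20 * (B + 1)).
  have -> : \sum_(1 <= l < m.+1) E l = rho * ((Phic r - Phic (- r)) *
      (\sum_(1 <= l < m.+1) Num.sqrt (sin (pi * l%:R / h%:R)) * cos (A l + c))
    - (Phis r - Phis (- r)) * (\sum_(1 <= l < m.+1) Num.sqrt (sin (pi * l%:R / h%:R)) *
        cos (A l + (c - pi / 2)))).
    by rewrite !mulr_sumr -sumrB mulr_sumr; apply: eq_bigr => l _; rewrite /E; ring.
  rewrite normrM ger0_norm// ler_wpM2l// (le_trans (ler_normB _ _))// !normrM.
  have a1 := amplitude_sum c mh; have a2 := amplitude_sum (c - pi / 2) mh.
  have := ler_pM (normr_ge0 _) (normr_ge0 _) Jc a1.
  have := ler_pM (normr_ge0 _) (normr_ge0 _) Js a2.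
  lra.
have first_le := D10 0%N (leq0n h).
have last_le : `|\sum_(m.+1 <= l < h./2.+1) D l| <= 10 * rho.
  have [hle|hlt] := leqP h./2 m; first by rewrite big_geq// normr0 mulr_ge0.
  have hE : h./2 = m.+1 by apply/eqP; rewrite eqn_leq h2m.
  by rewrite hE big_nat1; apply: D10; rewrite -hE.
have mid_le : `|\sum_(1 <= l < m.+1) D l - \sum_(1 <= l < m.+1) E l|
    <= h%:R * (4 + 4 * rho / r + 352 * r ^+ 4).
  rewrite -sumrB (le_trans (ler_norm_sum _ _ _))//.
  rewrite (@le_trans _ _ (\sum_(1 <= l < m.+1) (4 + 4 * rho / r + 352 * r ^+ 4)))//.
    exact: ler_sum_nat.
  rewrite sumr_const_nat subn1 -[leLHS]mulr_natl; apply: ler_wpM2r; last exact: mhr.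
  have : 0 <= 4 * rho / r by rewrite divr_ge0 ?mulr_ge0// ltW.
  lra.
have -> : \sum_(0 <= l < h./2.+1) \sum_(block_bound mu h l.+1 <= n < block_bound mu h l)
    cos (phase mu h n + c) = D 0%N + (\sum_(1 <= l < m.+1) D l + \sum_(m.+1 <= l < h./2.+1) D l).
  by rewrite big_ltn// (@big_cat_nat _ _ _ m.+1 1 h./2.+1).
set S1 := \sum_(_ <= _ < _) D _ in mid_le *; set S2 := \sum_(_ <= _ < _) D _ in last_le *.
set S3 := \sum_(_ <= _ < _) E _ in mid_le E_le.
rewrite (_ : _ + _ = D 0%N + S2 + (S1 - S3) + S3); last by ring.
have n1 := ler_normD (D 0%N + S2 + (S1 - S3)) S3.
have n2 := ler_normD (D 0%N + S2) (S1 - S3).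
have n3 := ler_normD (D 0%N) S2.
have -> : rho * (20 * (B + 2) + 4 * h%:R / r) + h%:R * (4 + 352 * r ^+ 4)
  = 20 * rho + rho * (20 * (B + 1)) + h%:R * (4 + 4 * rho / r + 352 * r ^+ 4) by ring.
lra.
Qed.

End duality.

(** * Smoothing the sawtooth function *)

Section sawtooth.
Context {R : realType}.

Definition saw (x : R) : R := x - (Num.floor x)%:~R - 1 / 2.

(** The continuous periodic primitive of [saw]: half the second Bernoulli polynomial of the
    fractional part, up to a constant that cancels in differences. *)
Definition saw_int (x : R) : R :=
  let y := x - (Num.floor x)%:~R in (y ^+ 2 - y) / 2.

Lemma frac_itv (x : R) : 0 <= x - (Num.floor x)%:~R < 1.
Proof.
have := floor_itv x; rewrite intrD => /andP[h1 h2]; apply/andP; split; lra.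
Qed.

Lemma saw_intE (n : int) (y : R) : 0 <= y <= 1 -> saw_int (n%:~R + y) = (y ^+ 2 - y) / 2.
Proof.
move=> /andP[y0]; rewrite le_eqVlt => /orP[/eqP ->|y1].
  rewrite /saw_int (_ : Num.floor _ = n + 1); last first.
    by apply: floor_def; rewrite !intrD; apply/andP; split; lra.
  by rewrite intrD; ring.
rewrite /saw_int (_ : Num.floor _ = n); last first.
  by apply: floor_def; rewrite intrD; apply/andP; split; lra.
by congr (_ / _); ring.
Qed.

Lemma saw_int_split (x : R) : exists n : int, exists2 y, 0 <= y < 1 & x = n%:~R + y.
Proof.
exists (Num.floor x), (x - (Num.floor x)%:~R); first exact: frac_itv.
by rewrite addrC subrK.
Qed.

Lemma sawE (n : int) (y : R) : 0 <= y < 1 -> saw (n%:~R + y) = y - 1 / 2.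
Proof.
move=> /andP[y0 y1]; rewrite /saw (_ : Num.floor _ = n); first by ring.
by apply: floor_def; rewrite intrD; apply/andP; split; lra.
Qed.

(** The sawtooth rises with slope 1 and jumps only downwards, so [saw x] exceeds its values on
    [[x - d, x]], hence their mean, by at most [d]. *)
Lemma saw_le (x d : R) : 0 < d <= 1 -> saw x <= (saw_int x - saw_int (x - d)) / d + d.
Proof.
move=> /andP[d0 d1]; have [n [y y01 ->]] := saw_int_split x.
rewrite sawE//; have /andP[y0 y1] := y01.
rewrite saw_intE ?y0 ?(ltW y1)//.
rewrite -lerBlDr ler_pdivlMr//.
have [dy|yd] := leP d y.
  rewrite (_ : n%:~R + y - d = n%:~R + (y - d)) ?saw_intE; [|by apply/andP; split; lra|ring].
  by nra.
rewrite (_ : n%:~R + y - d = (n - 1)%:~R + (y - d + 1)) ?saw_intE; [|by apply/andP; split; lra|rewrite intrD; ring].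
by nra.
Qed.

Lemma saw_ge (x d : R) : 0 < d <= 1 -> (saw_int (x + d) - saw_int x) / d - d <= saw x.
Proof.
move=> /andP[d0 d1]; have [n [y y01 ->]] := saw_int_split x.
rewrite sawE//; have /andP[y0 y1] := y01.
have -> : saw_int (n%:~R + y) = (y ^+ 2 - y) / 2 by rewrite saw_intE ?y0 ?(ltW y1).
rewrite lerBlDr ler_pdivrMr//.
have [dy|yd] := leP (y + d) 1.
  rewrite -addrA saw_intE; last by apply/andP; split; lra.
  by nra.
rewrite (_ : n%:~R + y + d = (n + 1)%:~R + (y + d - 1)) ?saw_intE; [|by apply/andP; split; lra|rewrite intrD; ring].
by nra.
Qed.

Lemma sin_npi n : sin (pi * n%:R) = 0 :> R.
Proof.
elim: n => [|n IH]; first by rewrite mulr0 sin0.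
by rewrite -natr1 mulrDr mulr1 sinDpi IH oppr0.
Qed.

Lemma isd_sum (F : nat -> R -> R) (dF : nat -> R) (x : R) a b :
  (forall h, (a <= h < b)%N -> has_deriv (F h) x (dF h)) ->
  has_deriv (fun y => \sum_(a <= h < b) F h y) x (\sum_(a <= h < b) dF h).
Proof.
move=> hF; have [ab|ba] := leqP b a.
  rewrite big_geq// (_ : (fun y => _) = fun=> 0); first exact: isd_cst.
  by apply/funext => y; rewrite big_geq.
have {ba} ab := ltnW ba; elim: b ab hF => [|b IH].
  rewrite leqn0 => /eqP -> _; rewrite big_geq// (_ : (fun y => _) = fun=> 0); first exact: isd_cst.
  by apply/funext => y; rewrite big_geq.
rewrite leq_eqVlt => /orP[/eqP ->|ab] hF.
  rewrite big_geq// (_ : (fun y => _) = fun=> 0); first exact: isd_cst.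
  by apply/funext => y; rewrite big_geq.
rewrite big_nat_recr//= (_ : (fun y => _) = fun y => \sum_(a <= h < b) F h y + F b y).
  apply: isd_add; last by apply: hF; rewrite ltnSn andbT -ltnS.
  by apply: IH => // h /andP[ah hb]; apply: hF; rewrite ah ltnW.
by apply/funext => y; rewrite big_nat_recr.
Qed.

(** Stated without division; the second factor is the second derivative of [bern_diff]. *)
Lemma dirichlet_kernel (K : nat) (x : R) :
  sin (pi * x) * (2 + \sum_(1 <= h < K.+1) 4 * cos (2 * pi * h%:R * x))
  = 2 * sin ((2 * K%:R + 1) * pi * x).
Proof.
elim: K => [|K IH].
  by rewrite big_geq// addr0 mulrC; congr (_ * sin _); ring.
rewrite big_nat_recr//= addrA mulrDr IH.
have -> : sin (pi * x) * (4 * cos (2 * pi * K.+1%:R * x)) =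
    2 * (sin ((2 * K.+1%:R + 1) * pi * x) - sin ((2 * K%:R + 1) * pi * x)).
  rewrite sinB_prod -[K.+1%:R]natr1.
  rewrite (_ : (_ - _) / 2 = pi * x); last by field.
  rewrite (_ : (_ + _) / 2 = 2 * pi * (K%:R + 1) * x); last by field.
  by ring.
by ring.
Qed.

(** * The truncated Fourier series of the second Bernoulli polynomial *)

Section approximation.
Variable K : nat.
Hypothesis K0 : (0 < K)%N.
Let s : R := (2 * K%:R + 1) * pi.
Let s0 : 0 < s. Proof. by rewrite mulr_gt0 ?pi_gt0// ltr_wpDl// mulr_ge0. Qed.

Definition bern_deriv (x : R) : R :=
  2 * x - 1 + \sum_(1 <= h < K.+1) 2 / (pi * h%:R) * sin (2 * pi * h%:R * x).

(** The Fourier remainder of [x^2 - x], up to the constant term -1/6. Only differences from the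
    value at [1 / 2] are bounded, so neither convergence of the series nor the sum of inverse
    squares is needed. *)
Definition bern_diff (x : R) : R :=
  x ^+ 2 - x - \sum_(1 <= h < K.+1) (pi * h%:R) ^- 2 * cos (2 * pi * h%:R * x).

Let pin0 h : (1 <= h < K.+1)%N -> pi != 0 :> R /\ h%:R != 0 :> R.
Proof. by move=> /andP[h0 _]; rewrite !lt0r_neq0 ?pi_gt0// ltr0n. Qed.

Lemma bern_diff_deriv x : has_deriv bern_diff x (bern_deriv x).
Proof.
rewrite /bern_diff; apply: isd_eq.
  apply: isd_add; first by isd.
  apply: isd_opp; apply: isd_sum => h _.
  by isd.
rewrite /bern_deriv /= -sumrN; congr (_ + _); first by ring.
apply: eq_big_nat => h /pin0[p0 hh0]; by move: (@pi R) p0 => p p0; field; rewrite p0 hh0.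
Qed.

Lemma bern_deriv_deriv x :
  has_deriv bern_deriv x (2 + \sum_(1 <= h < K.+1) 4 * cos (2 * pi * h%:R * x)).
Proof.
rewrite /bern_deriv; apply: isd_eq.
  apply: isd_add; first by isd.
  by apply: isd_sum => h _; isd.
rewrite /=; congr (_ + _); first by ring.
apply: eq_big_nat => h /pin0[p0 hh0]; by move: (@pi R) p0 => p p0; field; rewrite p0 hh0.
Qed.

Lemma bern_deriv_half : bern_deriv (1 / 2) = 0.
Proof.
rewrite /bern_deriv big_nat big1 ?addr0; first by field.
move=> h _; have -> : 2 * pi * h%:R * (1 / 2) = pi * h%:R :> R by field.
by rewrite sin_npi mulr0.
Qed.

(** Integration by parts of the kernel [2 sin (s y) / sin (pi y)] over [[x, 1/2]], starting from the
    zero of [bern_deriv] at [1 / 2]. In monotone form, the derivative of [G e] is a nonnegative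
    factor times [1 - e cos (s y)]; [e = 1] and [e = -1] give the two signs. *)
Lemma bern_deriv_le x : 0 < x <= 1 / 2 -> `|bern_deriv x| <= (K%:R * x)^-1.
Proof.
move=> /andP[x0 x1]; have pi0 := pi_gt0 R; have pi2 := pi_ge2 R.
pose u (y : R) := (sin (pi * y))^-1.
pose G (e y : R) := e * (bern_deriv y + 2 * cos (s * y) / s * u y) - 2 / s * u y.
have sp y : x <= y <= 1 / 2 -> 0 < sin (pi * y).
  by move=> /andP[? ?]; apply: sin_gt0_pi; apply/andP; split; nra.
have dG e y : x <= y <= 1 / 2 ->
    has_deriv (G e) y (2 * pi / s * cos (pi * y) / sin (pi * y) ^+ 2 * (1 - e * cos (s * y))).
  move=> yb; have sy := sp y yb.
  apply: isd_eq.
    apply: isd_add; last first.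
      apply: isd_opp; apply: isd_mul; first exact: isd_cst.
      by apply: isd_inv; [exact: lt0r_neq0|isd].
    apply: isd_mul; first exact: isd_cst.
    apply: isd_add; first exact: bern_deriv_deriv.
    apply: isd_mul; last by apply: isd_inv; [exact: lt0r_neq0|isd].
    by isd.
  rewrite /=; set T := 2 + _.
  have -> : T = 2 * sin (s * y) / sin (pi * y).
    by rewrite /T -dirichlet_kernel mulrAC divff ?mul1r// lt0r_neq0.
  by rewrite /u; field; rewrite !lt0r_neq0.
have mono e : `|e| <= 1 -> G e x <= G e (1 / 2).
  move=> e1; apply: (ger0_derive_le x1 (dG e)) => y yb; have sy := sp y yb.
  apply: mulr_ge0.
    rewrite !mulr_ge0 ?invr_ge0 ?(ltW s0) ?(ltW pi0) ?sqr_ge0//.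
    by apply: cos_ge0_pihalf; move: yb => /andP[? ?]; apply/andP; split; nra.
  have : `|e * cos (s * y)| <= 1 by rewrite normrM mulr_ile1 ?cos_max.
  by rewrite ler_norml subr_ge0 => /andP[].
have u12 : u (1 / 2) = 1 by rewrite /u (_ : pi * (1 / 2) = pi / 2) ?sin_pihalf ?invr1//; field.
have Ghalf e : `|e| <= 1 -> G e (1 / 2) <= 0.
  move=> e1; rewrite /G bern_deriv_half u12 add0r !mulr1.
  rewrite (_ : _ - _ = 2 / s * (e * cos (s * (1 / 2)) - 1)); last by field; rewrite lt0r_neq0.
  have : `|e * cos (s * (1 / 2))| <= 1 by rewrite normrM mulr_ile1 ?cos_max.
  by rewrite ler_norml => /andP[_ h]; rewrite mulr_ge0_le0 ?divr_ge0 ?(ltW s0)//; lra.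
have Gx e : `|e| <= 1 -> e * (bern_deriv x + 2 * cos (s * x) / s * u x) <= 2 / s * u x.
  by move=> e1; have := le_trans (mono e e1) (Ghalf e e1); rewrite /G subr_le0.
have ux : 0 < u x by rewrite invr_gt0 sp// lexx.
have hp := Gx 1; have hm := Gx (-1); rewrite normr1 in hp; rewrite normrN1 in hm.
move: (hp (lexx _)) (hm (lexx _)) => {}hp {}hm.
have hc : `|2 * cos (s * x) / s * u x| <= 2 / s * u x.
  rewrite !normrM (gtr0_norm ux) (gtr0_norm (_ : 0 < s^-1)) ?invr_gt0//.
  rewrite ler_pM2r// ler_pM2r ?invr_gt0// (ger0_norm (_ : 0 <= 2))//.
  by rewrite -[leRHS]mulr1 ler_pM2l// cos_max.
apply: (@le_trans _ _ (4 / s * u x)).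
  by move: hc hp hm; rewrite !ler_norml => /andP[? ?] ? ?; apply/andP; split; lra.
have sx : pi * x / 2 <= sin (pi * x) by apply: sin_ge_half; apply/andP; split; nra.
apply: (@le_trans _ _ (4 / s * (pi * x / 2)^-1)).
  by rewrite ler_pM2l ?divr_gt0// lef_pV2 ?posrE// ?sp ?lexx// divr_gt0// mulr_gt0.
have Kr : (0 : R) < K%:R by rewrite ltr0n.
rewrite [leLHS](_ : _ = (s / 4 * (pi * x / 2))^-1); last first.
  have inv3 (a b : R) : a != 0 -> b != 0 -> 4 / a / (b / 2) = (a / 4 * (b / 2))^-1.
    by move=> a0 b0; field; rewrite a0 b0.
  by apply: inv3; rewrite lt0r_neq0// mulr_gt0.
rewrite lef_pV2 ?posrE ?mulr_gt0 ?divr_gt0//.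
rewrite (_ : s / 4 * (pi * x / 2) = (pi ^+ 2 / 8 * (2 * K%:R + 1)) * x); last by rewrite /s; field.
rewrite ler_pM2r//.
have : 4 <= pi ^+ 2 :> R by rewrite expr2; nra.
nra.
Qed.

Lemma bern_deriv_le2 x : 0 <= x <= 1 / 2 -> `|bern_deriv x| <= 1 + 4 * K%:R * x.
Proof.
move=> /andP[x0 x1]; rewrite (le_trans (ler_normD _ _))// lerD//.
  by rewrite ler_norml; apply/andP; split; lra.
rewrite (le_trans (ler_norm_sum _ _ _))//.
rewrite (@le_trans _ _ (\sum_(1 <= h < K.+1) 4 * x))//.
  apply: ler_sum_nat => h hK; have [p0 hh0] := pin0 hK.
  have ph0 : 0 < pi * h%:R :> R by rewrite lt0r mulf_neq0// mulr_ge0// pi_ge0.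
  have d0 : 0 < 2 / (pi * h%:R) :> R by rewrite divr_gt0.
  rewrite normrM (gtr0_norm d0).
  rewrite (_ : 4 * x = 2 / (pi * h%:R) * (2 * pi * h%:R * x)); last first.
    by clear d0 ph0; move: (@pi R) p0 => p p0; field; rewrite p0 hh0.
  rewrite ler_pM2l//.
  have := norm_sinB_le 0 (2 * pi * h%:R * x); rewrite sin0 !subr0 => /le_trans; apply.
  by rewrite ger0_norm// -mulrA -[2 * pi * _]mulrA mulrA !mulr_ge0// pi_ge0.
by rewrite sumr_const_nat subn1/= -[leLHS]mulr_natl mulrCA mulrA.
Qed.

End approximation.

(* The cut [x = k^-2] balances the two bounds on the derivative. *)
Lemma bern_diff_le_half (k : nat) (x : R) : (1 < k)%N -> 0 <= x <= 1 / 2 ->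
  `|bern_diff (k ^ 3) x - bern_diff (k ^ 3) (1 / 2)| <= 6 / k%:R.
Proof.
move=> k1 /andP[x0 x1]; have k0 : (0 < k)%N by exact: ltnW.
have K0 : (0 < k ^ 3)%N by rewrite expn_gt0 k0.
have kr : (0 : R) < k%:R by rewrite ltr0n.
have k2 : (2 : R) <= k%:R by rewrite ler_nat.
have kn0 := lt0r_neq0 kr.
pose y : R := k%:R ^- 2.
have y0 : 0 < y by rewrite invr_gt0 exprn_gt0.
have yk : y * k%:R = k%:R^-1 by rewrite /y; field.
have yk2 : k%:R^-1 <= 2^-1 :> R by rewrite lef_pV2 ?posrE.
have y1 : y <= 1 / 2 by rewrite /y expr2 invfM; have : 0 < k%:R^-1 :> R; [rewrite invr_gt0//|nra].
have K3 : (k ^ 3)%:R = k%:R ^+ 3 :> R by rewrite natrX.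
have big z : y <= z <= 1 / 2 -> `|bern_diff (k ^ 3) z - bern_diff (k ^ 3) (1 / 2)| <= 1 / k%:R.
  move=> /andP[yz z1]; rewrite distrC.
  have := @mvt_norm_le R (bern_diff (k ^ 3)) (bern_deriv (k ^ 3)) z (1 / 2) k%:R^-1.
  move=> H; apply: (@le_trans _ _ (k%:R^-1 * `|1 / 2 - z|)).
    apply: H => w wb; first exact: bern_diff_deriv.
    have [wy w1] : y <= w /\ w <= 1 / 2 by move: wb => /orP[]/andP[? ?]; split; lra.
    rewrite (le_trans (bern_deriv_le K0 _))//; first by rewrite w1 andbT (lt_le_trans y0).
    rewrite lef_pV2 ?posrE ?mulr_gt0 ?ltr0n ?(lt_le_trans y0)//.
    rewrite K3 -(ler_pM2l y0); rewrite yk.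
    have -> : k%:R^-1 = y ^+ 2 * k%:R ^+ 3 by rewrite /y; field.
    rewrite [leLHS](_ : _ = y * (k%:R ^+ 3 * y)); last by ring.
    by rewrite ler_pM2l// ler_pM2l ?exprn_gt0.
  by rewrite mulrC ler_pM2r ?invr_gt0// ler_norml; apply/andP; split; lra.
have [yx|/ltW xy] := leP y x.
  rewrite (le_trans (big x _)) ?yx// ler_pM2r ?invr_gt0//; lra.
have hx : `|bern_diff (k ^ 3) x - bern_diff (k ^ 3) y| <= 5 / k%:R.
  apply: (@le_trans _ _ ((1 + 4 * k%:R) * `|x - y|)).
    apply: (@mvt_norm_le R (bern_diff (k ^ 3)) (bern_deriv (k ^ 3))) => w wb; first exact: bern_diff_deriv.
    have [w0 wy] : 0 <= w /\ w <= y by move: wb => /orP[]/andP[? ?]; split; lra.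
    rewrite (le_trans (bern_deriv_le2 _ _))//; first by rewrite w0/=; lra.
    rewrite lerD2l -mulrA ler_pM2l// K3.
    rewrite [leRHS](_ : _ = k%:R ^+ 3 * y) ?ler_pM2l ?exprn_gt0//.
    by rewrite /y; field.
  apply: (@le_trans _ _ (5 * k%:R * y)); last by rewrite -mulrA [_ * y]mulrC yk.
  apply: ler_pM; [lra|exact: normr_ge0|lra|rewrite ler0_norm; lra].
have := big y; rewrite lexx y1 => /(_ isT) hy.
rewrite (_ : _ - _ = (bern_diff (k ^ 3) x - bern_diff (k ^ 3) y)
  + (bern_diff (k ^ 3) y - bern_diff (k ^ 3) (1 / 2))); last by ring.
rewrite (le_trans (ler_normD _ _))//; move: hx hy; lra.
Qed.

Lemma cos_shift_int (x : R) (h : nat) (n : int) :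
  cos (2 * pi * h%:R * (n%:~R + x)) = cos (2 * pi * h%:R * x).
Proof.
have shift (y : R) (k : nat) : cos (y + 2 * pi * k%:R) = cos y.
  rewrite (_ : 2 * pi * k%:R = (pi *+ 2) *+ k); first exact: (periodicn (@cosD2pi R)).
  by rewrite -[RHS]mulr_natr -[pi *+ 2]mulr_natl.
case: n => [n|n].
  rewrite -(shift (2 * pi * h%:R * x) (h * n)%N); congr cos.
  by rewrite natrM -[(Posz n)%:~R]/(n%:R); ring.
rewrite -(shift _ (h * n.+1)%N); congr cos.
by rewrite natrM -[(Negz n)%:~R]/(- (n.+1%:R)); ring.
Qed.

Lemma bern_diff_refl K x : bern_diff K (1 - x) = bern_diff K x.
Proof.
rewrite /bern_diff; congr (_ - _); first by ring.
apply: eq_bigr => h _; congr (_ * _).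
have := cos_shift_int (- x) h 1; rewrite mulr1z => ->.
by rewrite mulrN cosN.
Qed.

Definition cos_series (K : nat) (x : R) : R :=
  \sum_(1 <= h < K.+1) (pi * h%:R) ^- 2 * cos (2 * pi * h%:R * x).

(** Periodicity and the reflection [1 - x] reduce to [[0, 1/2]]; the unknown constant
    [bern_diff (k ^ 3) (1 / 2)] cancels between [x] and [y]. *)
Lemma saw_int_approx (k : nat) (x y : R) : (1 < k)%N ->
  `|2 * (saw_int x - saw_int y) - (cos_series (k ^ 3) x - cos_series (k ^ 3) y)|
    <= 12 / k%:R.
Proof.
move=> k1.
have key z : `|2 * saw_int z - cos_series (k ^ 3) z - bern_diff (k ^ 3) (1 / 2)| <= 6 / k%:R.
  have [n [w w01 ->]] := saw_int_split z; have /andP[w0 w1] := w01.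
  have -> : 2 * saw_int (n%:~R + w) - cos_series (k ^ 3) (n%:~R + w) = bern_diff (k ^ 3) w.
    rewrite saw_intE ?w0 ?ltW// /bern_diff /cos_series; congr (_ - _); first by field.
    by apply: eq_bigr => h _; rewrite cos_shift_int.
  have [wh|wh] := leP w (1 / 2); first by apply: bern_diff_le_half; rewrite ?w0.
  by rewrite -bern_diff_refl; apply: bern_diff_le_half => //; apply/andP; split; lra.
have hx := key x; have hy := key y.
rewrite (_ : _ - _ = (2 * saw_int x - cos_series (k ^ 3) x - bern_diff (k ^ 3) (1 / 2))
  - (2 * saw_int y - cos_series (k ^ 3) y - bern_diff (k ^ 3) (1 / 2))); last by ring.
rewrite (le_trans (ler_normB _ _))// (_ : 12 / _ = 6 / k%:R + 6 / k%:R) ?lerD//.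
by rewrite -mulrDl; congr (_ / _); ring.
Qed.

(* [d] times the mean of [saw] over an interval of length [d] is a difference of
   values of [saw_int]; this bounds [saw] from either side. *)
Lemma saw_sum_le (x : nat -> R) (N k : nat) (d : R) (B : nat -> R) :
  (1 < k)%N -> 0 < d <= 1 ->
  (forall h c, (0 < h)%N -> `|\sum_(0 <= m < N) cos (2 * pi * h%:R * x m + c)| <= B h) ->
  `|\sum_(0 <= m < N) saw (x m)| <=
    N%:R * (d + 6 / (k%:R * d)) +
    \sum_(1 <= h < (k ^ 3).+1) Num.min h%:R^-1 (d * h%:R ^+ 2)^-1 * B h.
Proof.
move=> k1 d01 hB; have /andP[d0 d1] := d01.
have pi0 := pi_gt0 R; have pi2 := pi_ge2 R.
have kr : (0 : R) < k%:R by rewrite ltr0n ltnW.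
set W := \sum_(1 <= h < _) _.
have ser e : e = 1 \/ e = -1 ->
    `|\sum_(0 <= m < N) (cos_series (k ^ 3) (x m + e * d) - cos_series (k ^ 3) (x m))| <= 2 * d * W.
  move=> he.
  have -> : \sum_(0 <= m < N) (cos_series (k ^ 3) (x m + e * d) - cos_series (k ^ 3) (x m)) =
    \sum_(1 <= h < (k ^ 3).+1) (pi * h%:R) ^- 2 *
      (2 * sin (- (pi * h%:R * (e * d))) * \sum_(0 <= m < N) cos (2 * pi * h%:R * x m + (pi * h%:R * (e * d) - pi / 2))).
    rewrite /cos_series; under eq_bigr do rewrite -sumrB.
    rewrite exchange_big_nat/=; apply: eq_bigr => h _.
    rewrite !mulr_sumr; apply: eq_bigr => m _.
    rewrite -mulrBr cosB_prod; congr (_ * _).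
    rewrite (_ : (2 * pi * h%:R * x m - _) / 2 = - (pi * h%:R * (e * d))); last by field.
    rewrite (_ : (_ + _) / 2 = 2 * pi * h%:R * x m + pi * h%:R * (e * d)); last by field.
    by rewrite addrA cosBpihalf; ring.
  rewrite (le_trans (ler_norm_sum _ _ _))// /W mulr_sumr; apply: ler_sum_nat => h /andP[h1 _].
  have h0 : (0 : R) < h%:R by rewrite ltr0n.
  have ph : 0 < pi * h%:R :> R by rewrite mulr_gt0.
  have hBh := hB h (pi * h%:R * (e * d) - pi / 2) h1.
  set S := \sum_(0 <= m < N) _ in hBh *.
  have B0 : 0 <= B h by exact: le_trans hBh.
  (* A difference of cosines at distance [d] has a sine factor: bounding it by 1 gives the weight
     [1 / (d h^2)], bounding it by its argument gives [1 / h]. *)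
  have sin1 : `|sin (- (pi * h%:R * (e * d)))| <= 1 by exact: sin_max.
  have sin2 : `|sin (- (pi * h%:R * (e * d)))| <= pi * h%:R * d.
    have := norm_sinB_le 0 (- (pi * h%:R * (e * d))); rewrite sin0 !subr0 => /le_trans; apply.
    rewrite normrN !normrM (gtr0_norm pi0) (gtr0_norm h0) (gtr0_norm d0).
    by case: he => ->; rewrite ?normrN1 ?normr1 mul1r.
  rewrite !normrM (gtr0_norm (_ : 0 < (pi * h%:R) ^- 2)) ?invr_gt0 ?exprn_gt0//.
  rewrite (ger0_norm (_ : 0 <= 2))//.
  set s := `|sin _| in sin1 sin2 *.
  rewrite mulrA [leRHS]mulrA ler_pM// ?mulr_ge0 ?invr_ge0 ?exprn_ge0 ?normr_ge0 ?(ltW ph)//.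
  rewrite minr_pMr ?mulr_ge0 ?(ltW d0)// le_min; apply/andP; split.
    rewrite (@le_trans _ _ ((pi * h%:R) ^- 2 * (2 * (pi * h%:R * d))))//.
      by rewrite ler_pM2l ?invr_gt0 ?exprn_gt0// ler_pM2l.
    rewrite (_ : (pi * h%:R) ^- 2 * _ = 2 * d * (pi * h%:R)^-1); last first.
      by move: (pi * h%:R) (lt0r_neq0 ph) => z z0; field.
    rewrite ler_pM2l ?mulr_gt0// lef_pV2 ?posrE// ler_peMl ?ltW//; lra.
  rewrite (@le_trans _ _ ((pi * h%:R) ^- 2 * (2 * 1)))//.
    by rewrite ler_pM2l ?invr_gt0 ?exprn_gt0// ler_pM2l.
  rewrite mulr1 (_ : 2 * d * (d * h%:R ^+ 2)^-1 = h%:R ^- 2 * 2); last by field; rewrite !lt0r_neq0.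
  rewrite ler_pM2r// lef_pV2 ?posrE ?exprn_gt0// ler_pXn2r ?nnegrE ?(ltW ph) ?(ltW h0)//.
  by rewrite ler_peMl ?ltW//; lra.
have app e : e = 1 \/ e = -1 ->
    `|\sum_(0 <= m < N) (saw_int (x m + e * d) - saw_int (x m))| <= d * W + N%:R * (6 / k%:R).
  move=> he.
  have h1 : `|\sum_(0 <= m < N) (2 * (saw_int (x m + e * d) - saw_int (x m))
       - (cos_series (k ^ 3) (x m + e * d) - cos_series (k ^ 3) (x m)))| <= N%:R * (12 / k%:R).
    rewrite (le_trans (ler_norm_sum _ _ _))//.
    rewrite (@le_trans _ _ (\sum_(0 <= m < N) (12 / k%:R)))//.
      by apply: ler_sum => m _; exact: saw_int_approx.
    by rewrite sumr_const_nat subn0 -[leLHS]mulr_natl.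
  rewrite sumrB -mulr_sumr in h1; have h2 := ser e he.
  set a := \sum_(0 <= m < N) (saw_int _ - _) in h1 *.
  set b := \sum_(0 <= m < N) _ in h1 h2.
  have := ler_normD (2 * a - b) b; rewrite subrK normrM (ger0_norm (_ : 0 <= 2))//.
  have -> : N%:R * (6 / k%:R) = N%:R * (12 / k%:R) / 2 :> R by field; rewrite lt0r_neq0.
  lra.
rewrite ler_norml; apply/andP; split.
- have := app 1 (or_introl erefl); rewrite ler_norml => /andP[h1 _].
  rewrite (@le_trans _ _ (\sum_(0 <= m < N) ((saw_int (x m + 1 * d) - saw_int (x m)) / d - d)))//.
    rewrite sumrB -mulr_suml sumr_const_nat subn0 -[d *+ N]mulr_natl.
    rewrite (_ : - _ = (- (d * W + N%:R * (6 / k%:R))) / d - N%:R * d); last by field; rewrite !lt0r_neq0.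
    by rewrite lerD2r ler_pM2r ?invr_gt0.
  by apply: ler_sum => m _; rewrite mul1r; exact: saw_ge.
- have := app (-1) (or_intror erefl); rewrite ler_norml => /andP[h1 _].
  rewrite (@le_trans _ _ (\sum_(0 <= m < N) ((saw_int (x m) - saw_int (x m + -1 * d)) / d + d)))//.
    by apply: ler_sum => m _; rewrite mulN1r; exact: saw_le.
  rewrite big_split/= -mulr_suml sumr_const_nat subn0 -[d *+ N]mulr_natl.
  rewrite [leRHS](_ : _ = (d * W + N%:R * (6 / k%:R)) / d + N%:R * d); last by field; rewrite !lt0r_neq0.
  rewrite lerD2r ler_pM2r ?invr_gt0//.
  rewrite -lerN2 -sumrN; under eq_bigr do rewrite opprB.
  exact: h1.
Qed.

End sawtooth.

(** * Area and lattice points *)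

Section area.
Local Open Scope classical_set_scope.
Context {R : realType}.
Implicit Types (a b t x : R).

Let pi0 : 0 < @pi R := pi_gt0 R.

Lemma acos_itv x : -1 <= x <= 1 -> 0 <= acos x <= pi.
Proof. by move=> h; rewrite acos_ge0 ?acos_lepi. Qed.

(** The derivative of [acos] blows up at both ends, and this Hoelder estimate supplies continuity on
    the closed interval. Both sines in the product formula for [cos p - cos q] are at least
    [(q - p) / 4], the one at the midpoint after reflection in [pi / 2] if necessary. *)
Lemma norm_acosB_le a b : -1 <= a <= 1 -> -1 <= b <= 1 -> `|acos a - acos b| ^+ 2 <= 8 * `|a - b|.
Proof.
wlog hab : a b / b <= a => [hw ha hb|ha hb].
  have [h|/ltW] := leP b a; first exact: hw.
  by move=> /hw h; rewrite distrC (distrC a); exact: h.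
have [ea eb] := (acosK ha, acosK hb).
have /andP[ta0 tapi] := acos_itv ha; have /andP[tb0 tbpi] := acos_itv hb.
have tab : acos a <= acos b.
  rewrite leNgt; apply/negP => h.
  have := cos_le tb0 (ltW h) tapi; rewrite ea eb => h1.
  by move: h; rewrite (_ : a = b) ?ltxx//; apply/eqP; rewrite eq_le h1 hab.
rewrite (ger0_norm (_ : 0 <= a - b)) ?subr_ge0// -{2}ea -{2}eb cosB_prod.
rewrite distrC ger0_norm ?subr_ge0//.
set p := acos a in ta0 tapi tab *; set q := acos b in tb0 tbpi tab *.
have [pip] := pi0; have d1 : (q - p) / 4 <= sin ((q - p) / 2).
  have := @sin_ge_half R ((q - p) / 2); rewrite (_ : (q - p) / 2 / 2 = (q - p) / 4); last by field.
  by apply; apply/andP; split; lra.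
have d2 : (q - p) / 4 <= sin ((p + q) / 2).
  have [h|h] := leP (p + q) pi.
    apply: le_trans (_ : (p + q) / 2 / 2 <= _); first lra.
    by apply: sin_ge_half; apply/andP; split; lra.
  have <- : sin (pi - (p + q) / 2) = sin ((p + q) / 2) by rewrite sinB sinpi cospi; ring.
  apply: le_trans (_ : (pi - (p + q) / 2) / 2 <= _); first lra.
  by apply: sin_ge_half; apply/andP; split; lra.
have e0 : 0 <= (q - p) / 4 by lra.
have := ler_pM e0 e0 d2 d1.
by rewrite expr2; set u := sin _ * _; rewrite -[2 * sin _ * _]mulrA -/u; nra.
Qed.

Lemma continuous_acos_within : {within `[-1, 1], continuous (@acos R)}.
Proof.
apply/subspace_continuousP => x /=; rewrite in_itv/= => hx.
apply/cvgrPdist_lt => e e0; near=> y.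
have hy : -1 <= y <= 1 by near: y; rewrite !near_simpl near_withinE; apply: nearW => y /=; rewrite in_itv.
have hd : `|x - y| < e ^+ 2 / 8.
  near: y; rewrite near_simpl; apply: (@cvg_within _ (nbhs x)); rewrite near_simpl.
  have : e ^+ 2 / 8 > 0 by rewrite divr_gt0 ?exprn_gt0.
  by move: (e ^+ 2 / 8); apply/cvgrPdist_lt; exact: cvg_id.
have := norm_acosB_le hx hy.
rewrite -(ltr_pXn2r (n:=2)) ?nnegrE ?(ltW e0)//; move: hd; set u := _ ^+ 2; set v := _ ^+ 2; lra.
Unshelve. all: by end_near. Qed.

Definition g_prim t : R := pi^-1 * (3 / 4 * (t * Num.sqrt (1 - t ^+ 2)) - acos t / 4 - t ^+ 2 * acos t / 2).

Lemma g_cvg (F : set_system R) (FF : Filter F) x : y @[y --> F] --> x -> acos y @[y --> F] --> acos x ->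
  g y @[y --> F] --> g x.
Proof.
move=> cx ca; apply: cvgM; first exact: cvg_cst.
apply: cvgB; last exact: cvgM.
apply: (@cvg_comp _ _ _ (fun y => 1 - y ^+ 2) Num.sqrt _ (nbhs (1 - x ^+ 2))); last exact: sqrt_continuous.
apply: cvgB; first exact: cvg_cst.
by rewrite expr2; under eq_fun do rewrite expr2; exact: cvgM.
Qed.

Lemma g_prim_cvg (F : set_system R) (FF : Filter F) x : y @[y --> F] --> x -> acos y @[y --> F] --> acos x ->
  g_prim y @[y --> F] --> g_prim x.
Proof.
move=> cx ca; apply: cvgM; first exact: cvg_cst.
have cs : (y ^+ 2 : R) @[y --> F] --> x ^+ 2.
  by rewrite expr2; under eq_fun do rewrite expr2; exact: cvgM.
apply: cvgB; last by apply: cvgM; [exact: cvgM|exact: cvg_cst].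
apply: cvgB; last by apply: cvgM => //; exact: cvg_cst.
apply: cvgM; first exact: cvg_cst.
apply: cvgM => //.
apply: (@cvg_comp _ _ _ (fun y => 1 - y ^+ 2) Num.sqrt _ (nbhs (1 - x ^+ 2))); last exact: sqrt_continuous.
by apply: cvgB => //; exact: cvg_cst.
Qed.

Lemma g_prim_deriv x : -1 < x < 1 -> has_deriv g_prim x (g x).
Proof.
move=> hx; have /andP[x1 x2] := hx.
have p : 0 < 1 - x ^+ 2 by nra.
have da : has_deriv acos x (- (Num.sqrt (1 - x ^+ 2))^-1) by exact: is_derive1_acos.
have d1 : has_deriv (fun y => 1 - y ^+ 2) x (- (2 * x)).
  by isdr; rewrite !mulr1; ring.
have ds : has_deriv (fun y => Num.sqrt (1 - y ^+ 2)) x ((2 * Num.sqrt (1 - x ^+ 2))^-1 * (- (2 * x))).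
  by apply: (isd_comp (f := Num.sqrt) _ d1); exact: is_derive1_sqrt.
rewrite /g_prim /g.
apply: isd_eq.
  apply: isd_mul; first exact: isd_cst.
  apply: isd_add.
    apply: isd_add.
      by apply: isd_mul; [exact: isd_cst|apply: isd_mul; [exact: isd_id|exact: ds]].
    by apply: isd_opp; apply: isd_mul; [exact: da|exact: isd_cst].
  apply: isd_opp; apply: isd_mul; [apply: isd_mul; [|exact: da]|exact: isd_cst].
  by apply: isd_exp; exact: isd_id.
rewrite /=.
have s0 : 0 < Num.sqrt (1 - x ^+ 2) by rewrite sqrtr_gt0.
have s2 : Num.sqrt (1 - x ^+ 2) ^+ 2 = 1 - x ^+ 2 by rewrite sqr_sqrtr// ltW.
move: (Num.sqrt _) (acos x) s0 s2 => s a s0 s2.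
move: (@pi R) pi0 => p0 pp0.
rewrite mul0r add0r; congr (_ * _).
have s0' := lt0r_neq0 s0.
have e1 : x * ((2 * s)^-1 * (- (2 * x))) = - (x ^+ 2 * s^-1) by field.
have e2 : x ^+ 2 * s^-1 = s^-1 - s.
  by rewrite (_ : x ^+ 2 = 1 - s ^+ 2); [field|rewrite s2; ring].
rewrite e1 e2 expr1 mulr1 mul0r add0r !mulr0 addr0 mul1r.
rewrite (_ : x ^+ 2 * - s^-1 = s - s^-1); last by rewrite mulrN e2; ring.
by move: s^-1 => v; field.
Qed.

Lemma g_itv_le t : -1 <= t <= 1 -> Num.max 0 (- t) <= g t.
Proof.
move=> /[dup] ht /andP[t1 t2]; have /andP[a0 api] := acos_itv ht.
have e := acosK ht; have hs := sin_acos ht.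
have e2 : g t = pi^-1 * (sin (acos t) - acos t * cos (acos t)) by rewrite /g hs e mulrC [t * _]mulrC mulrC.
have h1 := mulr_cos_le_sin (x := acos t); rewrite a0 api in h1.
have h2 := mulr_cos_le_sin (x := pi - acos t).
have c2 : cos (pi - acos t) = - t by rewrite cosB cospi sinpi e; ring.
have s2 : sin (pi - acos t) = sin (acos t) by rewrite sinB sinpi cospi; ring.
rewrite c2 s2 in h2; rewrite e in h1 e2.
have {}h2 : (pi - acos t) * - t <= sin (acos t) by apply: h2; apply/andP; split; move: a0 api; clear; lra.
rewrite ge_max; apply/andP; split.
  by rewrite e2 mulr_ge0 ?invr_ge0 ?(ltW pi0)// subr_ge0; exact: h1.
rewrite e2 mulrC ler_pdivlMr//.
by move: h1 h2; set s := sin _; set a := acos t; clear; nra.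
Qed.

Lemma continuous_g_within a b : -1 <= a -> b <= 1 -> {within `[a, b], continuous (@g R)}.
Proof.
move=> ha hb; have ca := continuous_acos_within.
have {ca}: {within `[a, b], continuous (@acos R)}.
  by apply: continuous_subspaceW ca => x /=; rewrite !in_itv/= => /andP[h1 h2]; apply/andP; split; lra.
move=> /subspace_continuousP ca; apply/subspace_continuousP => x hx.
by apply: g_cvg (ca x hx); apply: cvg_within.
Qed.

Lemma continuous_g_prim_within a b : -1 <= a -> b <= 1 -> {within `[a, b], continuous g_prim}.
Proof.
move=> ha hb; have ca := continuous_acos_within.
have {ca}: {within `[a, b], continuous (@acos R)}.
  by apply: continuous_subspaceW ca => x /=; rewrite !in_itv/= => /andP[h1 h2]; apply/andP; split; lra.
move=> /subspace_continuousP ca; apply/subspace_continuousP => x hx.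
by apply: g_prim_cvg (ca x hx); apply: cvg_within.
Qed.

Lemma cvg_linear (F : set_system R) (FF : Filter F) x c : y @[y --> F] --> x ->
  c * y @[y --> F] --> c * x.
Proof. by move=> h; apply: cvgM => //; exact: cvg_cst. Qed.

(** The linear term serves the lower boundary [max (0, -t)]: [c = 1] on the left half, [c = 0] on
    the right. *)
Lemma integral_gD c a b : -1 <= a -> a < b -> b <= 1 ->
  (\int[lebesgue_measure]_(t in `[a, b]) (g t + c * t)%:E =
   ((g_prim b + c / 2 * (b * b)) - (g_prim a + c / 2 * (a * a)))%:E)%E.
Proof.
move=> ha ab hb; rewrite EFinB.
have cg := continuous_g_within ha hb; have cG := continuous_g_prim_within ha hb.
pose G := fun t : R => g_prim t + c / 2 * (t * t).
have cF : {within `[a, b], continuous G}.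
  move/subspace_continuousP : cG => cG; apply/subspace_continuousP => x hx.
  apply: cvgD; first exact: cG.
  apply: cvgM; first exact: cvg_cst.
  by apply: cvgM; apply: cvg_within.
have dF x : x \in `]a, b[%R -> has_deriv G x (g x + c * x).
  rewrite in_itv/= => /andP[xa xb]; apply: isd_eq.
    by apply: isd_add; [apply: g_prim_deriv; apply/andP; split; lra|isd].
  by rewrite /=; field.
apply: (@continuous_FTC2 R _ G) => //.
- move/subspace_continuousP : cg => cg; apply/subspace_continuousP => x hx.
  by apply: cvgD; [exact: cg|apply: cvg_linear; apply: cvg_within].
- have /(continuous_within_itvP _ ab)[_ h1 h2] := cF.
  split; [move=> x hx|exact: h1|exact: h2].
  by have [+ _] := dF _ hx; exact.
- by move=> x hx; rewrite derive1E; have := dF _ hx => -[].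
Qed.

Lemma xsection_Omega t :
  xsection (Omega R) t = if -1 <= t <= 1 then `[Num.max 0 (- t), g t] else set0.
Proof.
apply/seteqP; split => y; rewrite /xsection/= inE /Omega/=.
  by move=> [-> h]; rewrite /= in_itv.
by case: ifP => // h; rewrite /= in_itv/=.
Qed.

Lemma area_Omega : area (Omega R) = 1 / 4.
Proof.
rewrite /area /product_measure1.
pose D : set R := `[-1, 1].
rewrite (_ : (\int[_]_x _)%E = (\int[lebesgue_measure]_(t in D) (g t - Num.max 0 (- t))%:E)%E); last first.
  rewrite [RHS]integral_mkcond; apply: eq_integral => t _.
  rewrite /= patchE xsection_Omega mem_setE /D /= in_itv/=.
  case: ifP => ht; last by rewrite measure0.
  by rewrite lebesgue_measure_itv/= lte_fin; case: ltP => // h; rewrite (_ : g t = Num.max 0 (- t)) ?subrr//; apply/le_anti; rewrite h g_itv_le.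
have mh : measurable_fun D (EFin \o (fun t : R => g t - Num.max 0 (- t))).
  apply/measurable_EFinP; apply: measurable_funB; last first.
    by apply: measurable_maxr => //; exact: measurable_funN.
  apply/measurable_EFinP.
  have := @continuous_compact_integrable R (@g R) D.
  move=> /(_ (@segment_compact _ _ _)) /(_ (continuous_g_within (lexx _) (lexx _))).
  by move=> /measurable_int.
have DE : D = `[-1, 0[ `|` `[0, 1] by rewrite /D (@itv_bndbnd_setU _ _ _ (BLeft 0))// bnd_simp; lra.
rewrite DE ge0_integral_setU//=; first last.
- by apply/disj_setPS => y [/=]; rewrite !in_itv/=; lra.
- move=> t ht; rewrite lee_fin subr_ge0 g_itv_le//; by move: ht; rewrite !in_itv/= => -[]/andP[h1 h2]; apply/andP; split; lra.
- by rewrite -DE.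
rewrite integral_itv_bndo_bndc; last first.
  by apply: measurable_funS mh => //; [exact: measurable_itv|rewrite DE; exact: subsetUl].
have -> : (\int[@lebesgue_measure R]_(t in `[(-1)%R, 0%R]) (g t - Num.max 0 (- t))%:E =
    \int[@lebesgue_measure R]_(t in `[(-1)%R, 0%R]) (g t + 1 * t)%:E)%E.
  by apply: eq_integral => t; rewrite inE/= in_itv/= => ht; congr (_%:E); rewrite /Num.max; case: ifPn; lra.
have -> : (\int[@lebesgue_measure R]_(t in `[0%R, 1%R]) (g t - Num.max 0 (- t))%:E =
    \int[@lebesgue_measure R]_(t in `[0%R, 1%R]) (g t + 0 * t)%:E)%E.
  by apply: eq_integral => t; rewrite inE/= in_itv/= => ht; congr (_%:E); rewrite /Num.max; case: ifPn; lra.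
clear D mh DE; rewrite !integral_gD; [|by [|lra]..].
rewrite -EFinD /= /g_prim acosN1 acos0 acos1 expr1n expr0n/= sqrrN expr1n subrr sqrtr0.
by move: (@pi R) (Num.sqrt _) (lt0r_neq0 pi0) => p s p0; field.
Qed.
End area.

Lemma card_fset_set_seq (T : choiceType) (s : seq T) (A : set T) :
  uniq s -> (forall x, A x <-> x \in s) -> #|` fset_set A|%fset = size s.
Proof.
move=> us hA; have -> : A = [set` [fset x in s]%fset]%classic.
  by apply/seteqP; split => x /=; rewrite inE /=; move/hA.
by rewrite set_fsetK card_fseq undup_id.
Qed.

(** * Counting lattice points by columns *)

Section count.
Context {R : realType}.
Implicit Types (mu t : R).
Local Notation acos := (@acos R).

Definition height mu (k : nat) : R := mu * g (k%:R / mu).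

Lemma g_opp t : -1 <= t <= 1 -> g (- t) = g t + t.
Proof.
move=> ht; rewrite /g acosN// sqrrN; have := lt0r_neq0 (@pi_gt0 R).
by move: (@pi R) (acos t) => p a p0; field.
Qed.

Lemma mem_lattice mu z : 0 < mu ->
  (dilation mu (Omega R) `&` translate (Z2 R) (0, - (1 / 4)))%classic z <->
  exists m n : int, [/\ z = (m%:~R, n%:~R - 1 / 4) :> R * R, `|m%:~R : R| <= mu &
    Num.max 0 (- m%:~R : R) <= n%:~R - 1 / 4 <= mu * g (m%:~R / mu)].
Proof.
move=> mu0; have mu0' := lt0r_neq0 mu0; split.
  move=> [[[x y] [hx hy] <-] [_ [[m n] _ <-] [e1 e2]]]; exists m, n.
  rewrite /= in hx hy e1 e2; rewrite addr0 in e1.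
  split; first by rewrite e1 e2.
    by rewrite e1 normrM (gtr0_norm mu0) ger_pMr// ler_norml.
  rewrite e2 e1 [_ / mu]mulrAC mulfV// mul1r ler_pM2l// andbC.
  have /andP[h1 ->] := hy; rewrite /= -mulrN -{1}(mulr0 mu) -maxr_pMr ?(ltW mu0)//.
  by rewrite ler_pM2l.
move=> [m [n [-> hm /andP[h1 h2]]]]; split; last first.
  by exists (m%:~R, n%:~R); [exists (m, n)|rewrite /= addr0].
exists (m%:~R / mu, (n%:~R - 1 / 4) / mu); last by rewrite /= ![mu * _]mulrC !divfK.
split=> /=.
  by rewrite -ler_norml normrM normfV (gtr0_norm mu0) ler_pdivrMr ?mul1r.
rewrite -[- (m%:~R / mu)]mulNr -{1}(mul0r mu^-1) -maxr_pMl ?invr_ge0 ?(ltW mu0)// ler_pM2r ?invr_gt0// h1/=.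
by rewrite ler_pdivrMr// [leRHS]mulrC.
Qed.

Lemma natr_max_opp (k : nat) : Num.max 0 (- k%:R) = 0 :> R.
Proof. by apply/max_idPl; rewrite oppr_le0. Qed.

Lemma height_ge0 mu k : 0 < mu -> k%:R <= mu -> 0 <= height mu k.
Proof.
move=> mu0 kmu; rewrite mulr_ge0 ?(ltW mu0)//.
have /andP[h1 h2] : 0 <= k%:R / mu <= 1 by rewrite divr_ge0 ?(ltW mu0)//= ler_pdivrMr// mul1r.
have := @g_itv_le R (k%:R / mu); rewrite ge_max => h.
by have /andP[] : (0 <= g (k%:R / mu)) && (- (k%:R / mu) <= g (k%:R / mu)) by apply: h; apply/andP; split; lra.
Qed.

(** In column [- k.+1] the lower boundary is [k.+1] and, by [g_opp], the upper one is
    [height mu k.+1 + k.+1]. Lowering by [k.+1] rows, an integer, matches it with column [k.+1];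
    hence the row index [k.+1 + i] in [L2]. *)
Lemma N_Omega_sum mu : 1 <= mu ->
  N_Omega mu = (\sum_(0 <= k < (Num.trunc mu).+1) Num.trunc (height mu k + 1 / 4) +
               \sum_(0 <= k < Num.trunc mu) Num.trunc (height mu k.+1 + 1 / 4))%N.
Proof.
move=> mu1; have mu0 : 0 < mu by lra.
pose K k := Num.trunc (height mu k + 1 / 4).
pose L1 := [seq (k%:R, i%:R - 1 / 4) : R * R | k <- iota 0 (Num.trunc mu).+1, i <- iota 1 (K k)].
pose L2 := [seq (- k.+1%:R, (k.+1 + i)%:R - 1 / 4) : R * R | k <- iota 0 (Num.trunc mu), i <- iota 1 (K k.+1)].
have kmu (k : nat) : (k <= Num.trunc mu)%N = (k%:R <= mu) by rewrite truncn_ge_nat// ltW.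
have Kle (k i : nat) : k%:R <= mu -> (i <= K k)%N = (i%:R - 1 / 4 <= height mu k).
  by move=> hk; rewrite truncn_ge_nat ?addr_ge0 ?height_ge0// lerBlDr.
(* Row 0 lies at height -1/4, outside the domain, so the rows start at 1. *)
have quarter_gt0 (i : nat) : (0 <= i%:R - 1 / 4 :> R) = (0 < i)%N.
  case: i => [|i]; first by apply/negbTE; rewrite -ltNge; lra.
  by rewrite ltn0Sn -natr1; have := ler0n R i; lra.
have hN (k : nat) : k%:R <= mu -> mu * g (- (k%:R / mu)) = height mu k + k%:R.
  move=> hk; rewrite g_opp ?mulrDr ?[_ * (_ / _)]mulrC ?divfK ?lt0r_neq0//.
  have /andP[h1 h2] : 0 <= k%:R / mu <= 1 by rewrite divr_ge0 ?(ltW mu0)//= ler_pdivrMr// mul1r.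
  by apply/andP; split; lra.
have hL1 (z : R * R) : z \in L1 <-> exists k i : nat, [/\ z = (k%:R, i%:R - 1 / 4) :> R * R, k%:R <= mu & (0 : R) <= i%:R - 1 / 4 <= height mu k].
  split.
    move=> /allpairsPdep[k [i [hk hi ->]]]; exists k, i; move: hk hi.
    rewrite !mem_iota add0n add1n !ltnS leq0n/= kmu => hk /andP[i0].
    by rewrite Kle// => ->; split=> //; rewrite quarter_gt0 i0.
  move=> [k [i [-> hk /andP[i0 hi]]]]; apply/allpairsPdep; exists k, i; split=> //.
    by rewrite mem_iota add0n ltnS kmu.
  by rewrite mem_iota add1n ltnS Kle// hi andbT -quarter_gt0.
have hL2 (z : R * R) : z \in L2 <-> exists k i : nat, [/\ z = (- k.+1%:R, (k.+1 + i)%:R - 1 / 4) :> R * R, k.+1%:R <= mu & (0 : R) <= i%:R - 1 / 4 <= height mu k.+1].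
  split.
    move=> /allpairsPdep[k [i [hk hi ->]]]; exists k, i; move: hk hi.
    rewrite !mem_iota add0n add1n !ltnS leq0n/= kmu => hk /andP[i0].
    by rewrite Kle// => ->; split=> //; rewrite quarter_gt0 i0.
  move=> [k [i [-> hk /andP[i0 hi]]]]; apply/allpairsPdep; exists k, i; split=> //.
    by rewrite mem_iota add0n /= kmu.
  by rewrite mem_iota add1n ltnS Kle// hi andbT -quarter_gt0.
rewrite /N_Omega (@card_fset_set_seq _ (L1 ++ L2)).
- rewrite size_cat !size_allpairs_dep !sumnE !big_map /index_iota !subn0.
  by congr addn; apply: eq_bigr => k _; rewrite size_iota.
- have nat_inj : injective (fun n : nat => n%:R : R) by apply: mulrIn; rewrite oner_neq0.
  rewrite cat_uniq; apply/and3P; split.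
  + apply: allpairs_uniq_dep => [|k _|]; [exact: iota_uniq..|].
    by move=> [k i] [k' i'] _ _ /= [/nat_inj -> /addIr/nat_inj ->].
  + apply/hasPn => z /hL2[k [i [-> _ _]]]; apply/negP => /hL1[k' [i' [[h _] _ _]]].
    by have := ler0n R k'; rewrite -h oppr_ge0 (@pmulrn_lle0 R) // ler10.
  + apply: allpairs_uniq_dep => [|k _|]; [exact: iota_uniq..|].
    move=> [k i] [k' i'] _ _ /= [/oppr_inj/nat_inj [->]].
    by move=> /addIr/nat_inj/addnI ->.
move=> z; rewrite mem_lattice// mem_cat; split.
  move=> [m [n [-> hm]]]; case: m hm => [k|k].
    rewrite -pmulrn normr_nat natr_max_opp => hk hn; apply/orP; left; apply/hL1.
    case: n hn => [i hn|i /andP[h _]]; last first.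
      by move: h; rewrite NegzE mulrNz -pmulrn; have := ler0n R i.+1; lra.
    by exists k, i.
  rewrite NegzE mulrNz -pmulrn normrN normr_nat opprK mulNr => hk; rewrite hN// => /andP[h1 h2].
  have {}h1 : k.+1%:R <= n%:~R - 1 / 4 :> R by move: h1; rewrite ge_max => /andP[].
  apply/orP; right; apply/hL2; exists k, `|n - k.+1%:Z|%N.
  have hn : `|n - k.+1%:Z|%N%:Z = n - k.+1%:Z.
    rewrite gez0_abs// subr_ge0 -(ler_int R); rewrite -pmulrn; lra.
  have hr : `|n - k.+1%:Z|%N%:R = n%:~R - k.+1%:R :> R.
    by rewrite pmulrn hn intrB -pmulrn.
  split=> //.
    by rewrite natrD hr [_ + (_ - _)]addrC subrK.
  by rewrite hr; apply/andP; split; lra.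
move=> /orP[/hL1|/hL2] [k [i [-> hk hi]]].
  by exists k%:Z, i%:Z; rewrite -!pmulrn normr_nat natr_max_opp.
exists (- k.+1%:Z), (k.+1 + i)%:Z; rewrite mulrNz -!pmulrn normrN normr_nat opprK mulNr hN//.
by split=> //; rewrite max_r ?ler0n// natrD; move: hi => /andP[h1 h2]; apply/andP; split; lra.
Qed.

End count.

(** * The trapezoid rule for the column heights *)

Section trapezoid.
Context {R : realType} (mu : R).
Hypothesis mu0 : 0 < mu.
Implicit Types (a b x : R).

Let pi0 : 0 < @pi R := pi_gt0 R.

(* [height] and a primitive of it, in the angular variable [n = mu * cos x]. *)
Definition ang_height x : R := mu / pi * (sin x - x * cos x).
Definition ang_prim x : R := mu ^+ 2 / pi * (3 / 4 * (cos x * sin x) - x / 4 - x * cos x ^+ 2 / 2).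

Lemma height_ang n : n%:R <= mu -> height mu n = ang_height (theta mu n).
Proof.
move=> nmu; rewrite /ang_height cos_theta// /theta sin_acos ?divr_mu_itv//.
by rewrite /height /g; ring.
Qed.

Lemma phase_height (h n : nat) : n%:R <= mu -> phase mu h n = 2 * pi * h%:R * height mu n.
Proof.
move=> nmu; rewrite height_ang// /phase /ang_height.
have := lt0r_neq0 pi0; move: (@pi R) => p p0.
by field.
Qed.

Lemma ang_height_tangent a b x : 0 <= x -> x <= b -> b <= pi ->
  0 <= ang_height x - ang_height b + mu * (cos x - cos b) * b / pi.
Proof.
move=> x0 xb bpi; have hb : 0 <= b <= pi by apply/andP; split; lra.
have hx : 0 <= x <= pi by apply/andP; split; lra.
have h := sin_tangent_le hb hx.
rewrite /ang_height [leRHS](_ : _ = mu / pi * (sin x + (b - x) * cos x - sin b)); last first.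
  by have := lt0r_neq0 pi0; move: (@pi R) => p p0; field.
by rewrite mulr_ge0 ?divr_ge0 ?(ltW mu0) ?(ltW pi0)// subr_ge0.
Qed.

(** As a function of [n = mu cos x] the height has slope [- x / pi]. On an interval of length at
    most 1 the error is bounded by half the change of slope, which telescopes to a bounded total. *)
Lemma trapezoid_step a b : 0 <= a -> a <= b -> b <= pi -> mu * (cos a - cos b) <= 1 ->
  `|ang_prim a - ang_prim b - mu * (cos a - cos b) * (ang_height a + ang_height b) / 2|
    <= (b - a) / (2 * pi).
Proof.
move=> a0 ab bpi hab; have pn := lt0r_neq0 pi0.
(* [D x - ang_prim b] is the trapezoid error over the part between [x] and [b]. Its derivative is
   [- mu sin x / 2] times the tangent defect [U]. *)
pose D x := ang_prim x - mu * (cos x - cos b) * (ang_height x + ang_height b) / 2.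
pose U x := ang_height x - ang_height b + mu * (cos x - cos b) * x / pi.
pose c := (b - a) / (2 * pi); have c0 : 0 <= c by rewrite divr_ge0 ?subr_ge0// mulr_ge0 ?(ltW pi0).
have dD x : has_deriv D x (- (mu * sin x / 2 * U x)).
  rewrite /D /ang_prim /ang_height; apply: isd_eq; first by isd.
  rewrite /= /U /ang_height.
  apply/eqP; rewrite -subr_eq0; apply/eqP.
  transitivity (mu ^+ 2 / (4 * pi) * (cos x ^+ 2 + sin x ^+ 2 - 1)); last first.
    by rewrite cos2Dsin2 subrr mulr0.
  by move: (@pi R) pn => p p0; field.
have hU x : a <= x <= b -> - (2 * c) <= U x <= 0.
  move=> /andP[xa xb]; have x0 : 0 <= x by lra.
  have hb : 0 <= b <= pi by apply/andP; split; lra.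
  have hx : 0 <= x <= pi by apply/andP; split; lra.
  have h1 := sin_tangent_le hx hb; have h2 := ang_height_tangent a x0 xb bpi.
  have cb : cos b <= cos x by exact: cos_le.
  have ca : cos x <= cos a by apply: cos_le => //; lra.
  apply/andP; split.
    have -> : U x = ang_height x - ang_height b + mu * (cos x - cos b) * b / pi
        - mu * (cos x - cos b) * ((b - x) / pi).
      by rewrite /U; move: (@pi R) pn => p p0; field.
    have -> : 2 * c = (b - a) / pi by rewrite /c; move: (@pi R) pn => p p0; field.
    have : mu * (cos x - cos b) * ((b - x) / pi) <= 1 * ((b - a) / pi).
      apply: ler_pM; rewrite ?mulr_ge0 ?invr_ge0 ?(ltW mu0) ?(ltW pi0) ?subr_ge0//.
        by apply: le_trans hab; rewrite ler_pM2l//; lra.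
      by rewrite ler_pM2r ?invr_gt0//; lra.
    rewrite mul1r; move: h2; set u := _ - _ + _; set v := _ * ((b - x) / pi); set w := (b - a) / pi.
    by clear; lra.
  have -> : U x = mu / pi * (sin x - (sin b + (x - b) * cos b)).
    by rewrite /U /ang_height; move: (@pi R) pn => p p0; field.
  by rewrite mulr_ge0_le0 ?divr_ge0 ?(ltW mu0) ?(ltW pi0)// subr_le0.
have hs x : a <= x <= b -> 0 <= mu * sin x.
  by move=> /andP[xa xb]; rewrite mulr_ge0 ?(ltW mu0)// sin_ge0_pi//; apply/andP; split; lra.
have h1 := @ger0_derive_le R (fun x => D x - c * mu * cos x) (fun x => - (mu * sin x / 2 * U x) + c * mu * sin x) a b ab.
have h2 := @ger0_derive_le R (fun x => - D x - c * mu * cos x) (fun x => (mu * sin x / 2 * U x) + c * mu * sin x) a b ab.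
have {}h1 : D a - c * mu * cos a <= D b - c * mu * cos b.
  apply: h1 => x hx.
    by apply: isd_eq; [apply: isd_add; [exact: dD|isd]|rewrite /=; ring].
  rewrite addr_ge0//; last by rewrite -mulrA mulr_ge0// hs.
  by rewrite -mulrN mulr_ge0 ?divr_ge0 ?hs// oppr_ge0; have /andP[] := hU _ hx.
have {}h2 : - D a - c * mu * cos a <= - D b - c * mu * cos b.
  apply: h2 => x hx.
    by apply: isd_eq; [apply: isd_add; [apply: isd_opp; exact: dD|isd]|rewrite /=; ring].
  rewrite (_ : _ + _ = mu * sin x / 2 * (U x + 2 * c)); last by field.
  by rewrite mulr_ge0 ?divr_ge0 ?hs//; have /andP[+ _] := hU _ hx; rewrite -subr_ge0 opprK.
have Db : D b = ang_prim b by rewrite /D subrr mulr0 mul0r mul0r subr0.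
have Da : D a = ang_prim a - mu * (cos a - cos b) * (ang_height a + ang_height b) / 2 by [].
have h3 : c * (mu * (cos a - cos b)) <= c by rewrite ler_piMr.
rewrite -/c addrAC -Da -Db ler_norml.
by move: (D a) (D b) h1 h2 h3; clear; move=> A B h1 h2 h3; apply/andP; split; lra.
Qed.

(** The integral of the height is [ang_prim 0 - ang_prim (pi / 2) = mu^2 / 8]. At most 1/4 each
    comes from the full cells, the trapezoid error of the partial cell beyond the last integer, its
    trapezoid area, and the half weight of the last height. *)
Lemma height_sum : 1 <= mu ->
  `|\sum_(0 <= k < (Num.trunc mu).+1) height mu k - height mu 0 / 2 - mu ^+ 2 / 8| <= 1.
Proof.
move=> mu1; set M := Num.trunc mu; have pn := lt0r_neq0 pi0.
have kmu (k : nat) : (k <= M)%N = (k%:R <= mu) by rewrite truncn_ge_nat// ltW.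
have tk k : (k <= M)%N -> 0 <= theta mu k <= pi / 2 by rewrite kmu => hk; exact: theta_itv.
have step k : (k < M)%N ->
    `|(ang_prim (theta mu k.+1) - ang_prim (theta mu k)) - (height mu k.+1 + height mu k) / 2|
      <= (theta mu k - theta mu k.+1) / (2 * pi).
  move=> kM; have k1 : k.+1%:R <= mu by rewrite -kmu.
  have k0 : k%:R <= mu by rewrite -kmu ltnW.
  have /andP[a0 a1] := tk _ kM; have /andP[b0 b1] := tk _ (ltnW kM).
  have e : mu * (cos (theta mu k.+1) - cos (theta mu k)) = 1.
    by rewrite mulrBr !mu_cos_theta// -natr1 addrAC subrr add0r.
  have := @trapezoid_step (theta mu k.+1) (theta mu k) a0.
  rewrite e mul1r -!height_ang// lexx; apply => //; last by have := pi0; lra.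
  rewrite theta_le//; last by apply/andP; split => //; have := pi0; lra.
  by rewrite mu_cos_theta// ler_nat.
have tele : `|\sum_(0 <= k < M) ((ang_prim (theta mu k.+1) - ang_prim (theta mu k)) - (height mu k.+1 + height mu k) / 2)|
    <= (theta mu 0 - theta mu M) / (2 * pi).
  apply: le_trans (ler_norm_sum _ _ _) _.
  apply: (@le_trans _ _ (\sum_(0 <= k < M) ((- theta mu k.+1 / (2 * pi)) - (- theta mu k / (2 * pi))))).
    apply: ler_sum_nat => k /andP[_ kM]; apply: le_trans (step _ kM) _.
    by rewrite le_eqVlt -mulrBl opprK [- _ + _]addrC eqxx.
  by rewrite (telescope_sumr (fun k => - theta mu k / (2 * pi)))// -mulrBl opprK [- _ + _]addrC.
have mM : M%:R <= mu by rewrite -kmu.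
have M1 : mu < M.+1%:R by exact: truncnS_gt.
have /andP[t0 t1] := tk M (leqnn _); have tMpi : theta mu M <= pi by have := pi0; lra.
have cM := mu_cos_theta mu0 mM.
have sM1 : mu * (cos 0 - cos (theta mu M)) <= 1.
  by rewrite cos0 mulrBr mulr1 cM lerBlDr addrC natr1 ltW.
have sM0 : 0 <= mu * (cos 0 - cos (theta mu M)) by rewrite cos0 mulrBr mulr1 cM subr_ge0.
have last := trapezoid_step (lexx 0) t0 tMpi sM1.
have h0 : ang_height 0 = 0 by rewrite /ang_height sin0 mul0r subrr mulr0.
have p0 : ang_prim 0 = 0 by rewrite /ang_prim sin0; ring.
have hM := ang_height_tangent 0 (lexx 0) t0 tMpi.
rewrite h0 sub0r in hM.
have hM1 : ang_height (theta mu M) <= 1 / 2.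
  apply: (@le_trans _ _ (mu * (cos 0 - cos (theta mu M)) * theta mu M / pi)); first by move: hM; clear; lra.
  rewrite ler_pdivrMr// -[leRHS]mul1r -[1 / 2 * pi]mulrA ler_pM//; first lra.
have hM0 : 0 <= ang_height (theta mu M) by rewrite -height_ang// height_ge0.
have pihalf : theta mu 0 = pi / 2 by rewrite /theta mul0r acos0.
have pp : ang_prim (theta mu 0) = - mu ^+ 2 / 8.
  by rewrite pihalf /ang_prim cos_pihalf; move: (@pi R) pn => p p0'; field.
rewrite p0 sub0r h0 add0r subr0 in last.
rewrite sumrB (telescope_sumr (fun k => ang_prim (theta mu k)))// pp -mulr_suml big_split/= in tele.
have e1 : \sum_(0 <= k < M) height mu k = \sum_(0 <= k < M.+1) height mu k - ang_height (theta mu M).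
  by rewrite big_nat_recr//= height_ang// addrK.
have e2 : \sum_(0 <= k < M) height mu k.+1 = \sum_(0 <= k < M.+1) height mu k - height mu 0.
  by rewrite big_nat_recl//= addrAC subrr add0r.
rewrite e1 e2 pihalf in tele.
have q1 : (pi / 2 - theta mu M) / (2 * pi) <= 1 / 4.
  by rewrite ler_pdivrMr ?mulr_gt0//; have := pi0; lra.
have q2 : theta mu M / (2 * pi) <= 1 / 4 by rewrite ler_pdivrMr ?mulr_gt0//; have := pi0; lra.
have q3 : `|mu * (cos 0 - cos (theta mu M)) * ang_height (theta mu M) / 2| <= 1 / 4.
  move: (mu * _) sM0 sM1 (ang_height _) hM0 hM1 => s s0 s1 H H0 H1.
  by rewrite ger0_norm ?divr_ge0 ?mulr_ge0//; clear - s0 s1 H0 H1; nra.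
move: (le_trans tele q1) (le_trans last q2) q3 hM0 hM1.
move: (\sum_(0 <= k < M.+1) _) (height mu 0) (ang_height _) (ang_prim _) (mu * _ * _ / 2) (mu ^+ 2).
clear => S H0 HM P Q m2; rewrite !ler_norml => /andP[h1 h2] /andP[h3 h4] /andP[h5 h6] h7 h8.
by apply/andP; split; lra.
Qed.

End trapezoid.

Section count_asymptotics.
Context {R : realType}.

Lemma trunc_saw (x : R) : 0 <= x -> (Num.trunc x)%:R = x - 1 / 2 - saw x.
Proof.
move=> x0; rewrite /saw truncn_floor x0 pmulrn gez0_abs ?floor_ge0//; ring.
Qed.

(** The identity [trunc x = x - 1/2 - saw x] at [x = height + 1/4] leaves -1/4 per column; over
    about [2 mu] columns this is the term [- mu / 2]. *)
Lemma P_Omega_saw (mu : R) : 1 <= mu ->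
  `|P_Omega mu + mu / 2 + 2 * \sum_(0 <= k < (Num.trunc mu).+1) saw (height mu k + 1 / 4)| <= 6.
Proof.
move=> mu1; have mu0 : 0 < mu by lra.
rewrite /P_Omega area_Omega N_Omega_sum//.
set M := Num.trunc mu.
have kmu (k : nat) : (k <= M)%N = (k%:R <= mu) by rewrite truncn_ge_nat// ltW.
have hk k : (k <= M)%N -> 0 <= height mu k + 1 / 4 :> R.
  by rewrite kmu => h; rewrite addr_ge0 ?height_ge0.
have h0 : 0 <= height mu 0 + 1 / 4 by exact: hk.
have -> : ((\sum_(0 <= k < M.+1) Num.trunc (height mu k + 1 / 4) +
     \sum_(0 <= k < M) Num.trunc (height mu k.+1 + 1 / 4))%N%:R : R) =
   2 * \sum_(0 <= k < M.+1) (Num.trunc (height mu k + 1 / 4))%:R - (Num.trunc (height mu 0 + 1 / 4))%:R.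
  by rewrite natrD !natr_sum big_nat_recl//=; ring.
have -> : \sum_(0 <= k < M.+1) (Num.trunc (height mu k + 1 / 4))%:R =
   \sum_(0 <= k < M.+1) height mu k - M.+1%:R / 4 - \sum_(0 <= k < M.+1) saw (height mu k + 1 / 4).
  have -> : M.+1%:R / 4 = \sum_(0 <= k < M.+1) (1 / 4) :> R.
    by rewrite sumr_const_nat subn0 -[RHS]mulr_natl mul1r.
  rewrite -!sumrB; apply: eq_big_nat => k /andP[_ kM]; rewrite trunc_saw ?hk//; lra.
have hs := height_sum mu0 mu1; rewrite -/M in hs.
have /andP[e1 e2] := truncn_itv h0.
have mM : M%:R <= mu by rewrite -kmu.
have M1 : mu < M.+1%:R by exact: truncnS_gt.
rewrite -[_.+1%:R in ltRHS]natr1 in e2; rewrite -[M.+1%:R]natr1 in M1.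
have fin (t m S H W m2 : R) : `|S - H / 2 - m2 / 8| <= 1 -> t <= H + 1 / 4 -> H + 1 / 4 < t + 1 ->
    m <= mu -> mu < m + 1 -> `|2 * (S - (m + 1) / 4 - W) - t - 1 / 4 * m2 + mu / 2 + 2 * W| <= 6.
  by rewrite !ler_norml => /andP[h1 h2] h3 h4 h5 h6; apply/andP; split; lra.
by rewrite -[M.+1%:R]natr1; exact: fin hs e1 e2 mM M1.
Qed.

End count_asymptotics.

(** * The error term *)

Section sums.
Context {R : realType}.
Implicit Types (y mu : R).

Let pi0 : 0 < @pi R := pi_gt0 R.

Lemma pi_le4 : pi <= 4 :> R.
Proof.
have := @sin_ge_half R (pi / 2); rewrite lexx andbT sin_pihalf divr_ge0 ?(ltW pi0)// => /(_ isT).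
lra.
Qed.

(** As [y >= 2], a constant [2^n] is paid for by [n] units of exponent; parameter conditions become
    comparisons of integers. *)
Lemma mulr_expr_le y (n a b : nat) : 2 <= y -> (n + a <= b)%N -> 2 ^+ n * y ^+ a <= y ^+ b.
Proof.
move=> y2 nab; have y0 : 0 <= y by lra.
apply: (@le_trans _ _ (y ^+ (n + a))); last by apply: ler_weXn2l => //; lra.
by rewrite exprD ler_wpM2r ?exprn_ge0// lerXn2r ?nnegrE.
Qed.

Lemma expr_quot y (a b : nat) : 0 < y -> (a <= b)%N -> y ^+ a / y ^+ b = (y ^+ (b - a))^-1.
Proof.
move=> y0 ab; have h n : y ^+ n != 0 by rewrite expf_neq0// lt0r_neq0.
by rewrite -{1}(subnK ab) exprD invfM mulrCA mulfV// mulr1.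
Qed.

Lemma natceil_expr y n : 2 <= y -> y ^+ n <= (natceil (y ^+ n))%:R <= 2 * y ^+ n.
Proof.
move=> y2; rewrite natceil_ge/=; have h : 1 <= y ^+ n by apply: exprn_ege1; lra.
have := @natceil_lt R (y ^+ n); rewrite exprn_ge0; last lra.
by move=> /(_ isT); lra.
Qed.

(** Applies [sine_sum_le] with [L = h] and [Y = y^3] to all but the last part of the range, where
    the cosine in the increments degenerates. *)
Lemma dual_sum_le y (h k : nat) (c : R) : 2 <= y -> y ^+ 326 <= h%:R -> h%:R <= y ^+ 338 ->
  (k.*2 <= h.+1)%N ->
  `|\sum_(0 <= l < k) cos (2 * h%:R * y ^+ 990 * sin (pi * l%:R / h%:R) + c)| <= 6 * h%:R / y ^+ 3.
Proof.
move=> y2 hlo hhi kh; have y0 : 0 < y by lra.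
have P n : 0 < y ^+ n by exact: exprn_gt0.
have P1 n : 1 <= y ^+ n by apply: exprn_ege1; lra.
have H0 : 0 < h%:R :> R by exact: lt_le_trans hlo.
(* The cut part has about [eta h / 2] terms, well below the target [h / y^3], and Kusmin-Landau
   loses only the factor [y^6]. *)
pose eta : R := (y ^+ 6)^-1.
have eta0 : 0 < eta by rewrite invr_gt0.
have eta1 : eta <= 1 by rewrite invf_le1.
pose M := minn k (Num.trunc ((1 - eta) * h%:R / 2)).
have Mk : (M <= k)%N by exact: geq_minl.
have E0 : 0 <= (1 - eta) * h%:R / 2 by rewrite divr_ge0// mulr_ge0 ?subr_ge0.
have Meta : M%:R * 2 <= (1 - eta) * h%:R.
  rewrite -ler_pdivlMr//; apply: (@le_trans _ _ (Num.trunc ((1 - eta) * h%:R / 2))%:R).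
    by rewrite ler_nat geq_minr.
  by rewrite truncn_le.
have tail : k%:R - M%:R <= 3 * h%:R / y ^+ 3.
  have e1 : eta * h%:R <= h%:R / y ^+ 3.
    by rewrite mulrC ler_pM2l// lef_pV2 ?posrE// ler_eXn2l//; lra.
  have e2 : 1 <= h%:R / y ^+ 3.
    rewrite ler_pdivlMr// mul1r (le_trans _ hlo)// ler_eXn2l//; lra.
  have kh' : k%:R * 2 <= h%:R + 1 :> R by rewrite natr1 -natrM ler_nat muln2.
  rewrite -mulrA; move: (h%:R / _) e1 e2 => u e1 e2.
  have [ke|ke] := leqP k (Num.trunc ((1 - eta) * h%:R / 2)).
    by rewrite /M (minn_idPl ke) subrr; lra.
  rewrite /M (minn_idPr (ltnW ke)); have := truncnS_gt ((1 - eta) * h%:R / 2); rewrite -[(Num.trunc _).+1%:R]natr1.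
  lra.
have [pi2 pi4] := (pi_ge2 R, pi_le4).
have pisq : 1 <= pi ^+ 2 / 4 :> R.
  by rewrite ler_pdivlMr// mul1r (_ : 4 = 2 ^+ 2) ?lerXn2r ?nnegrE//; [lra|ring].
(* [Q] must reach [Y^16 = y^48]; [q] keeps the differenced amplitude from below and leaves room in
   both conditions on it. *)
pose Q := natceil (y ^+ 48); pose q := natceil (y ^+ 24).
have /andP[Q1 Q2] := natceil_expr 48%N y2; rewrite -/Q in Q1 Q2.
have /andP[q1 q2] := natceil_expr 24%N y2; rewrite -/q in q1 q2.
have Q0 : (0 < Q)%N by rewrite -(ltr_nat R); exact: lt_le_trans Q1.
have q0 : (0 < q)%N by rewrite -(ltr_nat R); exact: lt_le_trans q1.
have h0 : (0 < h)%N by rewrite -(ltr_nat R).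
have Qq : (Q * q)%:R <= 4 * y ^+ 72.
  rewrite natrM (_ : 4 * _ = 2 * y ^+ 48 * (2 * y ^+ 24)); first exact: ler_pM.
  by rewrite (_ : 72 = 48 + 24)%N// exprD; ring.
have Qqh : (Q * q <= h)%N.
  rewrite -(ler_nat R) (le_trans Qq)// (le_trans _ hlo)//.
  by rewrite (_ : 4 = 2 ^+ 2); [exact: mulr_expr_le|ring].
have A0 : 0 < 2 * h%:R * y ^+ 990 by apply: mulr_gt0 => //; apply: mulr_gt0.
(* The factor [h] of the amplitude cancels. The exponent is [990 + 4 (72 - 326) < 0]; the proof uses
   250 for 254 to absorb constants. *)
have c1 : 2 * h%:R * y ^+ 990 * (pi * (Q * q)%:R / h%:R) ^+ 4 / h%:R <= 1.
  have z0 : 0 <= @pi R * (Q * q)%:R / h%:R by rewrite divr_ge0 ?mulr_ge0 ?(ltW pi0) ?(ltW H0).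
  have z1 : @pi R * (Q * q)%:R / h%:R <= (y ^+ 250)^-1.
    rewrite ler_pdivrMr// [leRHS]mulrC ler_pdivlMr// (le_trans _ hlo)//.
    apply: (@le_trans _ _ (4 * (4 * y ^+ 72) * y ^+ 250)).
      by rewrite ler_pM2r// ler_pM// ltW.
    rewrite (_ : _ * _ = 2 ^+ 4 * y ^+ (250 + 72)); first exact: mulr_expr_le.
    by rewrite exprD; ring.
  have z4 : (@pi R * (Q * q)%:R / h%:R) ^+ 4 <= (y ^+ 1000)^-1.
    rewrite (_ : 1000 = 250 * 4)%N// exprM -exprVn lerXn2r ?nnegrE ?invr_ge0 ?(ltW (P _))//.
  rewrite (_ : _ / h%:R = 2 * y ^+ 990 * (pi * (Q * q)%:R / h%:R) ^+ 4); last first.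
    by field; rewrite lt0r_neq0.
  apply: (@le_trans _ _ (2 * y ^+ 990 * (y ^+ 1000)^-1)).
    by rewrite ler_pM2l// mulr_gt0.
  by rewrite ler_pdivrMr// mul1r -{1}[2]expr1; exact: mulr_expr_le.
(* The smallest increment has exponent [990 - 4 (338 - 24) - 6 = -272], so Kusmin-Landau gives about
   [y^272], below [h / Q], which is about [y^278] at worst. *)
have c2 : 2 + 2 / (2 * (2 * h%:R * y ^+ 990 * (pi * q%:R / (2 * h%:R)) ^+ 4)
     * (pi / (4 * h%:R)) * (pi * eta / 4)) <= h%:R / Q%:R.
  have p1 : (y ^+ 314)^-1 <= pi * q%:R / (2 * h%:R).
    have <- : y ^+ 24 / y ^+ 338 = (y ^+ 314)^-1 by rewrite expr_quot.
    apply: (@le_trans _ _ (q%:R / h%:R)).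
      by rewrite ler_pM ?invr_ge0 ?lef_pV2 ?posrE ?(ltW (P _)).
    rewrite [leRHS](_ : _ = (pi / 2) * (q%:R / h%:R)); last by field; rewrite lt0r_neq0.
    by rewrite ler_peMl ?divr_ge0//; lra.
  have p4 : (y ^+ 1256)^-1 <= (pi * q%:R / (2 * h%:R)) ^+ 4.
    rewrite (_ : 1256 = 314 * 4)%N// exprM -exprVn lerXn2r ?nnegrE ?invr_ge0 ?(ltW (P _))//.
    by rewrite (le_trans _ p1)// invr_ge0 ltW.
  have den : (y ^+ 272)^-1 <= 2 * (2 * h%:R * y ^+ 990 * (pi * q%:R / (2 * h%:R)) ^+ 4)
     * (pi / (4 * h%:R)) * (pi * eta / 4).
    set p := _ ^+ 4 in p4 *.
    rewrite [leRHS](_ : _ = pi ^+ 2 / 4 * (y ^+ 990 * p / y ^+ 6)); last first.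
      rewrite /eta; move: (h%:R : R) (lt0r_neq0 H0) (y ^+ 6) (lt0r_neq0 (P 6%N)) (y ^+ 990) (@pi R) => ? ? ? ? ? ?.
      by field; apply/andP.
    apply: (@le_trans _ _ (y ^+ 990 * (y ^+ 1256)^-1 / y ^+ 6)).
      rewrite expr_quot// -invfM -exprD.
      by rewrite (_ : (1256 - 990 + 6 = 272)%N).
    have p0 : 0 <= p by apply: le_trans p4; rewrite invr_ge0 ltW.
    apply: (@le_trans _ _ (y ^+ 990 * p / y ^+ 6)).
      by rewrite ler_pM2r ?invr_gt0// ler_pM2l.
    exact: ler_peMl (divr_ge0 (mulr_ge0 (ltW (P 990%N)) p0) (ltW (P 6%N))) pisq.
  set D := _ * (pi * eta / 4) in den *.
  have D0 : 0 < D by apply: lt_le_trans den; rewrite invr_gt0.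
  have D1 : D^-1 <= y ^+ 272 by rewrite -[leRHS]invrK lef_pV2 ?posrE ?invr_gt0.
  apply: (@le_trans _ _ (2 ^+ 2 * y ^+ 272)).
    have := P1 272%N; move: (y ^+ 272) D1 => u D1 u1.
    by move: D1 u1; clear; move: (D^-1) => d; lra.
  apply: (@le_trans _ _ (y ^+ 274)); first exact: mulr_expr_le.
  rewrite ler_pdivlMr ?ltr0n// (le_trans _ hlo)//.
  apply: (@le_trans _ _ (y ^+ 274 * (2 * y ^+ 48))); first by rewrite ler_pM2l.
  rewrite mulrCA -exprD -[X in X * _]expr1; exact: mulr_expr_le.
have main := @sine_sum_le R h q Q M (2 * h%:R * y ^+ 990) h%:R eta h0 q0 Q0 Qqh A0 (y ^+ 3) c eta0 Meta.
have {}main : `|\sum_(0 <= n < M) cos (2 * h%:R * y ^+ 990 * sin (pi * n%:R / h%:R) + c)| <= 3 * h%:R / y ^+ 3.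
  apply: main => //.
  - by rewrite ler_nat (leq_trans Mk)//; move: kh h0; clear; lia.
  - by rewrite ler_nat.
  - by rewrite -exprM.
rewrite (big_cat_nat _ Mk)//=.
apply: le_trans (ler_normD _ _) _.
have tail' : `|\sum_(M <= l < k) cos (2 * h%:R * y ^+ 990 * sin (pi * l%:R / h%:R) + c)| <= k%:R - M%:R.
  rewrite -natrB//; apply: norm_sum_nat_le => l _; exact: cos_max.
have := lerD main (le_trans tail' tail); rewrite -mulrDl -mulrDl.
by move=> /le_trans; apply; rewrite ler_pM2r ?invr_gt0// ler_pM2r//; lra.
Qed.

(** The window parameter is [r = y^4]: [h / r] stays below the saved [h / y^3], and the block errors
    [h r^4] are at most [y^(169 + 16) sqrt h] up to constants, far below [y^492 sqrt h]. *)
Lemma phase_sum_mid y (h : nat) (c : R) : 2 <= y -> y ^+ 326 <= h%:R -> h%:R <= y ^+ 338 ->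
  `|\sum_(0 <= n < (Num.trunc (y ^+ 990)).+1) cos (phase (y ^+ 990) h n + c)|
    <= 165 * y ^+ 492 * Num.sqrt h%:R.
Proof.
move=> y2 hlo hhi; have y0 : 0 < y by lra.
have P n : 0 < y ^+ n by exact: exprn_gt0.
have P1 n : 1 <= y ^+ n by apply: exprn_ege1; lra.
have H0 : 0 < h%:R :> R by exact: lt_le_trans hlo.
have h0 : (0 < h)%N by rewrite -(ltr_nat R).
have hr : 16 * (y ^+ 4) ^+ 2 * h%:R ^+ 2 <= y ^+ 990.
  apply: (@le_trans _ _ (16 * (y ^+ 4) ^+ 2 * (y ^+ 338) ^+ 2)).
    by rewrite ler_pM2l ?mulr_gt0 ?exprn_gt0// lerXn2r ?nnegrE ?(ltW H0) ?(ltW (P _)).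
  rewrite -!exprM -mulrA -exprD (_ : 16 = 2 ^+ 4); last by ring.
  exact: mulr_expr_le.
have := @phase_sum_dual R (y ^+ 990) h (y ^+ 4) (6 * h%:R / y ^+ 3) (P1 _) h0 (P1 _) hr
  (fun k c => @dual_sum_le y h k c y2 hlo hhi) c.
move=> /le_trans; apply.
have s0 : 0 < Num.sqrt h%:R :> R by rewrite sqrtr_gt0.
have s2 : Num.sqrt h%:R ^+ 2 = h%:R :> R by rewrite sqr_sqrtr// ltW.
have s169 : Num.sqrt h%:R <= y ^+ 169.
  rewrite -(@ler_pXn2r _ 2) ?nnegrE ?(ltW s0) ?(ltW (P _))//.
  by rewrite s2 -exprM.
have -> : Num.sqrt (y ^+ 990 / h%:R) = y ^+ 495 / Num.sqrt h%:R.
  rewrite sqrtrM ?(ltW (P _))// sqrtrV ?(ltW H0)//; congr (_ / _).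
  by rewrite (_ : 990 = 495 * 2)%N// exprM sqrtr_sqr ger0_norm// ltW.
move: (Num.sqrt h%:R) s0 s2 s169 => s s0 s2 s169; rewrite -s2.
have e1 : 1 <= s ^+ 2 / y ^+ 3.
  by rewrite s2 ler_pdivlMr// mul1r (le_trans _ hlo)// ler_eXn2l//; lra.
have e2 : s ^+ 2 / y ^+ 4 <= s ^+ 2 / y ^+ 3.
  by rewrite ler_pM2l ?exprn_gt0// lef_pV2 ?posrE// ler_eXn2l//; lra.
have m1 : y ^+ 495 / s * (20 * (6 * s ^+ 2 / y ^+ 3 + 2) + 4 * s ^+ 2 / y ^+ 4) <= 164 * y ^+ 492 * s.
  apply: (@le_trans _ _ (y ^+ 495 / s * (164 * (s ^+ 2 / y ^+ 3)))).
    rewrite ler_pM2l ?divr_gt0//.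
    rewrite -[6 * _ / _]mulrA -[4 * _ / _]mulrA.
    move: (s ^+ 2 / y ^+ 3) (s ^+ 2 / y ^+ 4) e1 e2; clear => a b; lra.
  rewrite (_ : 495 = 492 + 3)%N// exprD; have := lt0r_neq0 (P 3%N); have := lt0r_neq0 s0.
  move: (y ^+ 3) (y ^+ 492) => a b sn an; rewrite le_eqVlt; apply/orP; left; apply/eqP; field.
  by rewrite sn an.
have m2 : s ^+ 2 * (4 + 352 * (y ^+ 4) ^+ 4) <= y ^+ 492 * s.
  rewrite expr2 -mulrA mulrC ler_pM2r// -exprM.
  have e16 : 4 + 352 * y ^+ (4 * 4) <= 2 ^+ 9 * y ^+ 16.
    by have := P1 16%N; move: (y ^+ (4 * 4)) => u u1; rewrite (_ : 2 ^+ 9 = 512); [lra|ring].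
  have e0 : 0 <= 4 + 352 * y ^+ (4 * 4) by have := P1 16%N; move: (y ^+ (4 * 4)) => u u1; lra.
  apply: (@le_trans _ _ (y ^+ 169 * (2 ^+ 9 * y ^+ 16))); first exact: ler_pM (ltW s0) e0 s169 e16.
  by rewrite mulrCA -exprD; exact: mulr_expr_le.
apply: le_trans (lerD m1 m2) _; move: (y ^+ 492) => u.
by rewrite -![_ * u * s]mulrA; move: (u * s) => v; lra.
Qed.

(** For [h > mu] the number of terms, at most [2 mu], is already below the bound. *)
Lemma phase_sum_sqrt_le mu (h : nat) (c : R) : 1 <= mu -> (0 < h)%N ->
  `|\sum_(0 <= n < (Num.trunc mu).+1) cos (phase mu h n + c)| <= 10 * Num.sqrt mu * Num.sqrt h%:R.
Proof.
move=> mu1 h0; have mu0 : 0 < mu by lra.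
have H0 : 0 < h%:R :> R by rewrite ltr0n.
have s0 : 0 < Num.sqrt h%:R :> R by rewrite sqrtr_gt0.
have m0 : 0 < Num.sqrt mu by rewrite sqrtr_gt0.
have s2 : Num.sqrt h%:R ^+ 2 = h%:R :> R by rewrite sqr_sqrtr// ltW.
have m2 : Num.sqrt mu ^+ 2 = mu by rewrite sqr_sqrtr// ltW.
have [hmu|hmu] := leP h%:R mu.
  have := phase_sum_trivial mu1 h0 c hmu; move=> /le_trans; apply.
  rewrite sqrtrM ?(ltW mu0)// sqrtrV ?(ltW H0)// -{1}s2 le_eqVlt; apply/orP; left; apply/eqP.
  by field; rewrite lt0r_neq0.
apply: (@le_trans _ _ ((Num.trunc mu).+1%:R)).
  by rewrite -[(Num.trunc mu).+1 in leRHS]subn0; apply: norm_sum_nat_le => n _; exact: cos_max.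
have sm : Num.sqrt mu <= Num.sqrt h%:R by rewrite ler_sqrt// ltW.
have : (Num.trunc mu)%:R <= mu by rewrite truncn_le ltW.
by rewrite -natr1; nra.
Qed.

End sums.

(** * Summation over the frequencies *)

Section weights.
Context {R : realType}.
Implicit Types (X y mu : R).

(** Telescoping with [1 / sqrt n <= 2 (sqrt n - sqrt (n - 1))]; the induction needs the sharper
    bound with the minimum of [K] and [X]. *)
Lemma sum_invsqrt_le (K : nat) X : 0 <= X ->
  \sum_(1 <= h < K) (h%:R <= X)%R%:R * (Num.sqrt h%:R)^-1 <= 2 * Num.sqrt X.
Proof.
move=> X0; case: K => [|K]; first by rewrite big_geq// mulr_ge0 ?sqrtr_ge0.
suff h : \sum_(1 <= h < K.+1) (h%:R <= X)%R%:R * (Num.sqrt h%:R)^-1 <= 2 * Num.sqrt (Num.min K%:R X).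
  by rewrite (le_trans h)// ler_pM2l// ler_wsqrtr// ge_min lexx orbT.
elim: K => [|K IH]; first by rewrite big_geq// mulr_ge0 ?sqrtr_ge0.
rewrite big_nat_recr//=; have [hX|hX] := leP K.+1%:R X; last first.
  by rewrite mul0r addr0 (le_trans IH)// ler_pM2l// ler_wsqrtr// ge_min lexx orbT.
have KX : K%:R <= X by rewrite (le_trans _ hX)// ler_nat.
move: IH; rewrite (min_l KX) mul1r => IH.
have b2 : Num.sqrt K%:R ^+ 2 = K%:R :> R by rewrite sqr_sqrtr.
have a2 : Num.sqrt K.+1%:R ^+ 2 = K%:R + 1 :> R by rewrite sqr_sqrtr// natr1.
have a0 : 0 < Num.sqrt K.+1%:R :> R by rewrite sqrtr_gt0.
have b0 : 0 <= Num.sqrt K%:R :> R by rewrite sqrtr_ge0.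
have ba : Num.sqrt K%:R <= Num.sqrt K.+1%:R :> R by rewrite ler_wsqrtr// ler_nat.
move: IH a2 a0 ba; set S := \sum_(1 <= h < K.+1) _; set a := Num.sqrt K.+1%:R; set b := Num.sqrt K%:R => IH a2 a0 ba.
have : a^-1 <= 2 * (a - b).
  rewrite -[leLHS]mul1r ler_pdivrMr//.
  have e1 : (a - b) * (a + b) = 1 by rewrite -subr_sqr a2 b2 addrAC subrr add0r.
  by rewrite -[leLHS]e1 mulrAC [leLHS]mulrC ler_wpM2r ?subr_ge0//; lra.
lra.
Qed.

Lemma sum_invsqrt3_le (K : nat) X : 0 < X ->
  \sum_(1 <= h < K) (X < h%:R)%R%:R * (h%:R * Num.sqrt h%:R)^-1 <= 6 / Num.sqrt X.
Proof.
move=> X0; case: K => [|K]; first by rewrite big_geq// divr_ge0 ?sqrtr_ge0.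
have sp z : 0 < z -> 0 < Num.sqrt (z : R) by rewrite sqrtr_gt0.
have mp n : 0 < Num.sqrt (Num.max n%:R X) by rewrite sp// lt_max X0 orbT.
suff h : \sum_(1 <= h < K.+1) (X < h%:R)%R%:R * (h%:R * Num.sqrt h%:R)^-1
    + 6 / Num.sqrt (Num.max K.+1%:R X) <= 6 / Num.sqrt X.
  by rewrite (le_trans _ h)// lerDl divr_ge0// ltW.
elim: K => [|K IH].
  rewrite big_geq// add0r ler_pM2l// lef_pV2 ?posrE ?sp ?lt_max ?ltr01//.
  by rewrite ler_wsqrtr// le_max lexx orbT.
rewrite big_nat_recr//=; apply: le_trans IH; rewrite -addrA lerD2l.
have [hX|hX] := ltP X K.+1%:R; last first.
  rewrite mul0r add0r ler_pM2l// lef_pV2 ?posrE ?sp ?lt_max ?ltr0n//.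
  by rewrite ler_wsqrtr// le_max lexx orbT.
have hX' : X < K.+2%:R by rewrite (lt_le_trans hX)// ler_nat.
rewrite (max_l (ltW hX')) mul1r.
have b2 : Num.sqrt K.+2%:R ^+ 2 = K.+1%:R + 1 :> R by rewrite sqr_sqrtr// natr1.
have a2 : Num.sqrt K.+1%:R ^+ 2 = K.+1%:R :> R by rewrite sqr_sqrtr.
have a0 : 0 < Num.sqrt K.+1%:R :> R by rewrite sqrtr_gt0.
have b0 : 0 < Num.sqrt K.+2%:R :> R by rewrite sqrtr_gt0.
have K1 : 1 <= K.+1%:R :> R by rewrite ler1n.
rewrite -{1}a2; move: a2 a0 b2 b0 K1.
set a := Num.sqrt K.+1%:R; set b := Num.sqrt K.+2%:R; move: (K.+1%:R : R) => k; move: a b => a b a2 a0 b2 b0 k1.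
rewrite -subr_ge0 (_ : _ - _ = (6 * a ^+ 2 * (b - a) - b) / (a ^+ 3 * b)); last first.
  by field; rewrite !lt0r_neq0.
rewrite divr_ge0 ?mulr_ge0 ?exprn_ge0 ?(ltW a0) ?(ltW b0)//.
have e : (b - a) * (b + a) = 1 by rewrite -subr_sqr b2 a2 addrAC subrr add0r.
have ba : b <= 3 / 2 * a.
  by rewrite -(@ler_pXn2r _ 2) ?nnegrE ?mulr_ge0 ?(ltW a0) ?(ltW b0)// exprMn; lra.
have ab0 : 0 < b + a by lra.
rewrite -(pmulr_rge0 _ ab0) mulrBr (_ : _ * (6 * _ * _) = 6 * a ^+ 2 * ((b - a) * (b + a))); last by ring.
by rewrite e mulr1; nra.
Qed.

Lemma sqrt_expr y (n : nat) : 0 <= y -> Num.sqrt (y ^+ (n * 2)) = y ^+ n.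
Proof. by move=> y0; rewrite exprM sqrtr_sqr ger0_norm ?exprn_ge0. Qed.

Definition phase_bound y (h : nat) : R :=
  if (y ^+ 326 <= h%:R) && (h%:R <= y ^+ 338) then 165 * y ^+ 492 * Num.sqrt h%:R
  else 10 * y ^+ 495 * Num.sqrt h%:R.

Lemma phase_sum_le y h c : 2 <= y -> (0 < h)%N ->
  `|\sum_(0 <= n < (Num.trunc (y ^+ 990)).+1) cos (phase (y ^+ 990) h n + c)| <= phase_bound y h.
Proof.
move=> y2 h0; have y0 : 0 <= y by lra.
rewrite /phase_bound; case: ifPn => [/andP[h1 h2]|_]; first exact: phase_sum_mid.
rewrite -(@sqrt_expr y 495%N)//; apply: phase_sum_sqrt_le => //.
by apply: exprn_ege1; lra.
Qed.

(** The weight switches at [1 / d = y^332] and the phase bound at [y^326] and [y^338]. The four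
    resulting sums have exponents [495 + 163], [492 + 166], [824 - 166] and [827 - 169], all equal
    to 658. *)
Lemma weighted_phase_sum_le y K : 2 <= y ->
  \sum_(1 <= h < K) Num.min h%:R^-1 ((y ^+ 332)^-1 * h%:R ^+ 2)^-1 * phase_bound y h <= 1400 * y ^+ 658.
Proof.
move=> y2; have y0 : 0 < y by lra.
have P n : 0 < y ^+ n by exact: exprn_gt0.
have P' n : 0 <= y ^+ n by exact: ltW.
pose I X (h : nat) : R := (h%:R <= X)%R%:R * (Num.sqrt h%:R)^-1.
pose J X (h : nat) : R := (X < h%:R)%R%:R * (h%:R * Num.sqrt h%:R)^-1.
have I0 X h : 0 <= I X h by rewrite mulr_ge0 ?invr_ge0 ?sqrtr_ge0.
have J0 X h : 0 <= J X h by rewrite mulr_ge0// invr_ge0 mulr_ge0 ?sqrtr_ge0.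
have term h : (0 < h)%N -> Num.min h%:R^-1 ((y ^+ 332)^-1 * h%:R ^+ 2)^-1 * phase_bound y h <=
    10 * y ^+ 495 * I (y ^+ 326) h + 165 * y ^+ 492 * I (y ^+ 332) h
    + (165 * y ^+ 824 * J (y ^+ 332) h + 10 * y ^+ 827 * J (y ^+ 338) h).
  move=> h0; have H0 : 0 < h%:R :> R by rewrite ltr0n.
  have s0 : 0 < Num.sqrt h%:R :> R by rewrite sqrtr_gt0.
  have s2 : Num.sqrt h%:R ^+ 2 = h%:R :> R by rewrite sqr_sqrtr// ltW.
  have t1 : 0 <= 10 * y ^+ 495 * I (y ^+ 326) h := mulr_ge0 (mulr_ge0 (ler0n _ 10) (P' 495%N)) (I0 _ h).
  have t2 : 0 <= 165 * y ^+ 492 * I (y ^+ 332) h := mulr_ge0 (mulr_ge0 (ler0n _ 165) (P' 492%N)) (I0 _ h).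
  have t3 : 0 <= 165 * y ^+ 824 * J (y ^+ 332) h := mulr_ge0 (mulr_ge0 (ler0n _ 165) (P' 824%N)) (J0 _ h).
  have t4 : 0 <= 10 * y ^+ 827 * J (y ^+ 338) h := mulr_ge0 (mulr_ge0 (ler0n _ 10) (P' 827%N)) (J0 _ h).
  have near (C a : R) : 0 <= C -> 0 <= a -> Num.min h%:R^-1 ((y ^+ 332)^-1 * h%:R ^+ 2)^-1 * (C * a * Num.sqrt h%:R)
      <= C * a * (Num.sqrt h%:R)^-1.
    move=> C0 a0; apply: (@le_trans _ _ (h%:R^-1 * (C * a * Num.sqrt h%:R))).
      apply: ler_wpM2r; first by apply: mulr_ge0; [exact: mulr_ge0|exact: ltW].
      by rewrite ge_min lexx.
    move: (Num.sqrt h%:R) s0 s2 => s s0 <-; rewrite le_eqVlt; apply/orP; left; apply/eqP.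
    by field; rewrite lt0r_neq0.
  have far (C : R) (m n : nat) : 0 <= C -> (n = 332 + m)%N ->
      Num.min h%:R^-1 ((y ^+ 332)^-1 * h%:R ^+ 2)^-1 * (C * y ^+ m * Num.sqrt h%:R)
      <= C * y ^+ n * (h%:R * Num.sqrt h%:R)^-1.
    move=> C0 ->; apply: (@le_trans _ _ (((y ^+ 332)^-1 * h%:R ^+ 2)^-1 * (C * y ^+ m * Num.sqrt h%:R))).
      apply: ler_wpM2r; first by apply: mulr_ge0; [exact: mulr_ge0|exact: ltW].
      by rewrite ge_min lexx orbT.
    rewrite exprD le_eqVlt; apply/orP; left; apply/eqP.
    move: (Num.sqrt h%:R) s0 s2 (y ^+ 332) (P 332%N) (y ^+ m) => s s0 <- u u0 v.
    by field; rewrite !lt0r_neq0.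
  rewrite /phase_bound; case: ifPn => [/andP[h1 h2]|].
    have [h3|h3] := leP h%:R (y ^+ 332).
      have := near 165 (y ^+ 492) (ler0n _ _) (P' _).
      have -> : (Num.sqrt h%:R)^-1 = I (y ^+ 332) h by rewrite /I h3 mul1r.
      by move=> /le_trans; apply; move: t1 t3 t4; clear; lra.
    have := @far 165 492%N 824%N (ler0n _ _) erefl.
    have -> : (h%:R * Num.sqrt h%:R)^-1 = J (y ^+ 332) h by rewrite /J h3 mul1r.
    by move=> /le_trans; apply; move: t1 t2 t4; clear; lra.
  rewrite negb_and -!ltNge => /orP[h1|h1].
    have := near 10 (y ^+ 495) (ler0n _ _) (P' _).
    have -> : (Num.sqrt h%:R)^-1 = I (y ^+ 326) h by rewrite /I ltW// mul1r.
    by move=> /le_trans; apply; move: t2 t3 t4; clear; lra.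
  have := @far 10 495%N 827%N (ler0n _ _) erefl.
  have -> : (h%:R * Num.sqrt h%:R)^-1 = J (y ^+ 338) h by rewrite /J h1 mul1r.
  by move=> /le_trans; apply; move: t1 t2 t3; clear; lra.
apply: (@le_trans _ _ (\sum_(1 <= h < K) (10 * y ^+ 495 * I (y ^+ 326) h + 165 * y ^+ 492 * I (y ^+ 332) h
    + (165 * y ^+ 824 * J (y ^+ 332) h + 10 * y ^+ 827 * J (y ^+ 338) h)))).
  by apply: ler_sum_nat => h /andP[h0 _]; exact: term.
rewrite !big_split/= -!mulr_sumr.
have i1 := sum_invsqrt_le K (P' 326%N); have i2 := sum_invsqrt_le K (P' 332%N).
have j1 := sum_invsqrt3_le K (P 332%N); have j2 := sum_invsqrt3_le K (P 338%N).
rewrite (@sqrt_expr y 163%N) ?(ltW y0)// in i1; rewrite (@sqrt_expr y 166%N) ?(ltW y0)// in i2.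
rewrite (@sqrt_expr y 166%N) ?(ltW y0)// in j1; rewrite (@sqrt_expr y 169%N) ?(ltW y0)// in j2.
have mono (C a b c : R) (m n : nat) : 0 <= C -> a <= b -> y ^+ m * b = c * y ^+ n -> C * y ^+ m * a <= C * c * y ^+ n.
  move=> C0 ab e; rewrite -[C * c * _]mulrA -e mulrA; apply: ler_wpM2l => //; exact: mulr_ge0.
have k1 : 10 * y ^+ 495 * (\sum_(1 <= h < K) I (y ^+ 326) h) <= 10 * 2 * y ^+ 658.
  by apply: mono i1 _ => //; rewrite mulrCA -exprD.
have k2 : 165 * y ^+ 492 * (\sum_(1 <= h < K) I (y ^+ 332) h) <= 165 * 2 * y ^+ 658.
  by apply: mono i2 _ => //; rewrite mulrCA -exprD.
have k3 : 165 * y ^+ 824 * (\sum_(1 <= h < K) J (y ^+ 332) h) <= 165 * 6 * y ^+ 658.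
  apply: mono j1 _ => //; rewrite (_ : 824 = 658 + 166)%N// exprD mulrCA mulfK ?lt0r_neq0//.
have k4 : 10 * y ^+ 827 * (\sum_(1 <= h < K) J (y ^+ 338) h) <= 10 * 6 * y ^+ 658.
  apply: mono j2 _ => //; rewrite (_ : 827 = 658 + 169)%N// exprD mulrCA mulfK ?lt0r_neq0//.
apply: le_trans (lerD (lerD k1 k2) (lerD k3 k4)) _.
by move: (y ^+ 658) (P' 658%N) => u u0; clear - u0; lra.
Qed.

Lemma P_Omega_le y : 2 <= y -> `|P_Omega (y ^+ 990) + y ^+ 990 / 2| <= 3000 * y ^+ 658.
Proof.
move=> y2; have y0 : 0 < y by lra.
have P n : 0 < y ^+ n by exact: exprn_gt0.
have P1 n : 1 <= y ^+ n by apply: exprn_ege1; lra.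
have hP := P_Omega_saw (P1 990%N).
(* With [k >= d^-2] the truncation error [6 / (k d)] is at most [6 d]. The Fourier length [k^3] is
   harmless because the frequency sum is bounded independently of it. *)
pose k := natceil (y ^+ 664); have /andP[k1 _] := natceil_expr 664%N y2; rewrite -/k in k1.
have k2 : (1 < k)%N.
  rewrite -(ltr_nat R) (lt_le_trans _ k1)// (lt_le_trans (_ : 1 < y))//; first lra.
  by rewrite -{1}[y]expr1; apply: ler_weXn2l => //; lra.
have d01 : 0 < (y ^+ 332)^-1 <= 1 by rewrite invr_gt0 P/= invf_le1.
have := @saw_sum_le R (fun m => height (y ^+ 990) m + 1 / 4) (Num.trunc (y ^+ 990)).+1 k (y ^+ 332)^-1
  (phase_bound y) k2 d01.
have kmu (m : nat) : (m < (Num.trunc (y ^+ 990)).+1)%N -> m%:R <= y ^+ 990.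
  by rewrite ltnS truncn_ge_nat// ltW.
move=> /(_ _)/wrap[h c h0|hs].
  rewrite (@eq_big_nat _ _ _ _ _ _ (fun m => cos (phase (y ^+ 990) h m + (2 * pi * h%:R * (1 / 4) + c)))).
    exact: phase_sum_le.
  move=> m /andP[_ /kmu hm]; rewrite phase_height//; congr cos.
  by move: (height _ _) => u; ring.
have N2 : (Num.trunc (y ^+ 990)).+1%:R <= 2 * y ^+ 990.
  have : (Num.trunc (y ^+ 990))%:R <= y ^+ 990 by rewrite truncn_le ltW.
  rewrite -[(Num.trunc _).+1%:R]natr1; have := P1 990%N; move: (Num.trunc (y ^+ 990)) (y ^+ 990) => a b; clear; lra.
have e1 : (y ^+ 332)^-1 + 6 / (k%:R * (y ^+ 332)^-1) <= 7 / y ^+ 332.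
  have : (k%:R * (y ^+ 332)^-1)^-1 <= (y ^+ 332)^-1.
    rewrite lef_pV2 ?posrE// ?divr_gt0 ?ltr0n ?(ltnW k2)//.
    rewrite ler_pdivlMr// -exprD (le_trans _ k1)//.
  move: (_^-1) (_^-1) => a b; clear; lra.
have e2 : (Num.trunc (y ^+ 990)).+1%:R * ((y ^+ 332)^-1 + 6 / (k%:R * (y ^+ 332)^-1)) <= 14 * y ^+ 658.
  apply: (@le_trans _ _ (2 * y ^+ 990 * (7 / y ^+ 332))).
    apply: ler_pM => //; apply: addr_ge0; first by case/andP: d01 => /ltW.
    by apply: divr_ge0 => //; apply: mulr_ge0 => //; case/andP: d01 => /ltW.
  rewrite (_ : 990 = 658 + 332)%N// exprD le_eqVlt; apply/orP; left; apply/eqP.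
  by move: (y ^+ 658) (y ^+ 332) (P 332%N) => a b b0; field; rewrite lt0r_neq0.
have h1 := le_trans hs (lerD e2 (weighted_phase_sum_le (k ^ 3).+1 y2)).
have fin (p m v S : R) : `|p + m + 2 * S| <= 6 -> 1 <= v -> `|S| <= 14 * v + 1400 * v ->
    `|p + m| <= 3000 * v.
  by clear; rewrite !ler_norml => /andP[? ?] ? /andP[? ?]; apply/andP; split; lra.
exact: fin hP (P1 658%N) h1.
Qed.

End weights.

Local Open Scope classical_set_scope.
Local Open Scope ring_scope.

Theorem theorem1p2 (R : realType) :
  (P_Omega : R -> R) =
    (fun mu : R => - (mu / 2))
      +O_ (pinfty_nbhs R) (fun mu : R => mu `^ (2 / 3 - 1 / 495)).
Proof.
apply/eqaddOP; near=> k; near=> mu.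
have mu2 : 2 ^+ 990 <= mu by near: mu; apply: nbhs_pinfty_ge; exact: num_real.
have k3 : 3000 <= k by near: k; apply: nbhs_pinfty_ge; exact: num_real.
have mu0 : 0 < mu by apply: lt_le_trans mu2; apply: exprn_gt0.
(* Passing to the 990th root makes every exponent an integer; [2 ^+ 990 <= mu] is exactly
   [2 <= y]. *)
pose y := mu `^ (990^-1).
have y0 : 0 < y by rewrite powR_gt0.
have yn (n : nat) : y ^+ n = mu `^ (n%:R / 990).
  by rewrite -powR_mulrn ?ltW// -powRrM mulrC.
have ymu : y ^+ 990 = mu.
  rewrite yn divff ?pnatr_eq0//.
  by rewrite powRr1 ?(ltW mu0).
have y2 : 2 <= y by rewrite -(@ler_pXn2r _ 990) ?nnegrE ?(ltW y0)// ymu.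
have := P_Omega_le y2; rewrite ymu yn.
have -> : (658%:R / 990 = 2 / 3 - 1 / 495 :> R) by field.
rewrite /= opprK => h.
rewrite (le_trans h)// ger0_norm ?powR_ge0// ler_wpM2r// powR_ge0.
Unshelve. all: by end_near. Qed.
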